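(* Let $\mathcal A$ be a one-clock labelled stochastic timed automaton satisfying conditions (i), (ii), (iii) of the context, and $\mathcal M$ a deterministic Muller automaton over the same atomic propositions. Then: 1. we can decide whether $\mathcal A$ satisfies $\mathcal M$ almost-surely; 2. for every initial distribution $\mu$ which is numerically amenable w.r.t. $\mathcal A$, we can compute arbitrary approximations of $\mathrm{Prob}^{\mathcal T_{\mathcal A}}_\mu(\mathcal M)$.
   Context: Stochastic timed automaton (STA): $\mathcal A=(L,\ell_0,X,E,(\mu_\gamma)_\gamma,(w_e)_{e\in E})$ with $L$ a finite set of locations, $\ell_0\in L$ the initial location, $X$ a finite set of clocks, $E\subseteq L\times G(X)\times2^X\times L$ a finite set of edges, where $G(X)$ is the set of guards (finite conjunctions of $x\bowtie c$, $x\in X$, $\bowtie\in\{<,\le,=,\ge,>\}$, $c\in\mathbb N$), weights $w_e$ positive integers, and for each configuration $\gamma=(\ell,\nu)\in L\times\mathbb R_{\ge0}^X$ a probability distribution $\mu_\gamma$ on delays with support $I(\gamma)=\{d\ge0\mid\exists e=(\ell,g,Y,\ell')\in E,\ \nu+d\models g\}$. It is assumed that if $I(\gamma)$ has positive Lebesgue measure then $\mu_\gamma$ has the same null sets as Lebesgue measure restricted to $I(\gamma)$, and otherwise $\mu_\gamma$ is uniform on the points of $I(\gamma)$. Here $\nu+d$ adds $d$ to every clock, $\gamma+d=(\ell,\nu+d)$, and $[Y\leftarrow0](\nu)$ resets the clocks in $Y$ to $0$. An edge $(\ell,g,Y,\ell')$ is enabled at $(\ell,\nu)$ if $\nu\models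 g$; $p_\gamma(e)=w_e/\sum\{w_{e'}\mid e'\text{ enabled at }\gamma\}$ if $e$ is enabled at $\gamma$, else $0$. $\mathcal T_{\mathcal A}$ is the stochastic transition system (Markov chain on a general state space) with state space $L\times\mathbb R_{\ge0}^X$ (product of $2^L$ and the Borel $\sigma$-algebra) and kernel, for $\gamma=(\ell,\nu)$, $$\kappa_{\mathcal A}(\gamma,B)=\sum_{e=(\ell,g,Y,\ell')\in E}\int_{d\ge0}\mathbf 1_B(\ell',[Y\leftarrow0](\nu+d))\,p_{\gamma+d}(e)\,\mathrm d\mu_\gamma(d).$$ For an initial distribution $\mu$ on the state space, $\mathrm{Prob}^{\mathcal T_{\mathcal A}}_\mu$ is the law on infinite sequences of configurations of the Markov chain with initial distribution $\mu$ and kernel $\kappa_{\mathcal A}$. $\mathcal A$ is one-clock if $|X|=1$. It is labelled if each location carries a label in $2^{\mathrm{AP}}$, $\mathrm{AP}$ a finite set of atomic propositions; a configuration $(\ell,\nu)$ has the label of $\ell$. For $\gamma=(\ell,\nu)$ and $e=(\ell,g,Y,\ell')\in E$ let $I(\gamma,e)=\{d\ge0\mid\nu+d\models g\}$. Conditions: (i) for all $\ell\in L$ and all $[a,b]\subseteq\mathbb R_{\ge0}$, the function $\nu\mapsto\mu_{(\ell,\nu)}([a,b])$ is continuous; (ii) if $\gamma'=\gamma+t$ for some $t\ge0$ and $0\notin I(\gamma+t',e)$ for each $0\le t'\le t$, then $\mu_\gamma(I(\gamma,e))\le\mu_{\gamma'}(I(\gamma',e))$; (iii) there is $0<\lambda_0<1$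 such that $\mu_\gamma([0,\tfrac12])\le\lambda_0$ for every $\gamma$ with $I(\gamma)$ unbounded. A deterministic Muller automaton over $\mathrm{AP}$ is $\mathcal M=(Q,q_0,E',\mathcal F)$ with $Q$ finite, $q_0\in Q$, $E'\subseteq Q\times2^{\mathrm{AP}}\times Q$ deterministic and complete (exactly one successor for each $(q,u)$), $\mathcal F\subseteq2^Q$; a word in $(2^{\mathrm{AP}})^\omega$ is accepted if the set of locations visited infinitely often by its unique run from $q_0$ is in $\mathcal F$. $\mathrm{Prob}^{\mathcal T_{\mathcal A}}_\mu(\mathcal M)$ is the probability that the label sequence of the path is accepted by $\mathcal M$. Almost-sure satisfaction of $\mathcal M$ by $\mathcal A$ means that this probability is $1$ (for the initial distribution under consideration). Regions: let $M_{\mathcal A}$ be the maximal integer appearing in guards. Valuations $\nu,\nu'$ are region-equivalent if: for every $x\in X$, either $\nu(x),\nu'(x)>M_{\mathcal A}$, or $\lfloor\nu(x)\rfloor=\lfloor\nu'(x)\rfloor$ and ($\nu(x)$ is an integer iff $\nu'(x)$ is); and for all $x,y$ with $\nu(x),\nu(y)\le M_{\mathcal A}$, $\{\nu(x)\}\le\{\nu(y)\}$ iff $\{\nu'(x)\}\le\{\nu'(y)\}$ ($\{\cdot\}$ = fractional part). $R_{\mathcal A}$ is the finite set of classes (regions). $\mu$ is numerically amenable w.r.t. $\mathcal A$ if, given $k\in\mathbb N$, $\varepsilon>0$ and a sequence $(\ell_0,r_0),\dots,(\ell_k,r_k)$ in $L\times R_{\mathcal A}$, one can compute a numerical approximation up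 to $\varepsilon$ of the probability under $\mathrm{Prob}^{\mathcal T_{\mathcal A}}_\mu$ that for all $0\le i\le k$ the $i$-th configuration lies in $\{\ell_i\}\times r_i$. *)

(* Defs.v *)
From HB Require Import structures.
From mathcomp Require Import all_boot all_order all_algebra finmap.
From mathcomp Require Import all_classical all_reals all_analysis.

Set Implicit Arguments.
Unset Strict Implicit.
Unset Printing Implicit Defensive.

Import Order.TTheory GRing.Theory Num.Theory.
Import numFieldNormedType.Exports.

Local Open Scope classical_set_scope.
Local Open Scope ring_scope.

(** Algorithms are programs of the WHILE language over binary trees (a
    point-free form of Jones' language), a Turing-complete model in which
    finite data are coded without arithmetic. *)

Inductive tree := Leaf | Node of tree & tree.

Inductive prog :=
  | PId
  | PLeaf
  | PLeft
  | PRight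
  | PNode of prog & prog
  | PSeq of prog & prog
  | PIf of prog & prog & prog
  | PWhile of prog & prog
  | POracle.

(** [run o p x y]: on input [x], program [p] halts with output [y], where
    [POracle] queries the partial function with graph [o]. [Leaf] is false in
    tests, and [PSeq p q] executes [p] first. *)
Inductive run (o : tree -> tree -> Prop) : prog -> tree -> tree -> Prop :=
  | RunId x : run o PId x x
  | RunLeaf x : run o PLeaf x Leaf
  | RunLeftLeaf : run o PLeft Leaf Leaf
  | RunLeftNode x y : run o PLeft (Node x y) x
  | RunRightLeaf : run o PRight Leaf Leaf
  | RunRightNode x y : run o PRight (Node x y) y
  | RunNode p q x y z :
      run o p x y -> run o q x z -> run o (PNode p q) x (Node y z)
  | RunSeq p q x y z :
      run o p x y -> run o q y z -> run o (PSeq p q) x z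
  | RunIfFalse b p q x y :
      run o b x Leaf -> run o q x y -> run o (PIf b p q) x y
  | RunIfTrue b p q x t u y :
      run o b x (Node t u) -> run o p x y -> run o (PIf b p q) x y
  | RunWhileFalse b p x :
      run o b x Leaf -> run o (PWhile b p) x x
  | RunWhileTrue b p x t u y z :
      run o b x (Node t u) -> run o p x y -> run o (PWhile b p) y z ->
      run o (PWhile b p) x z
  | RunOracle x y : o x y -> run o POracle x y.

Definition no_oracle : tree -> tree -> Prop := fun _ _ => False.

Definition code_nat (n : nat) : tree := iter n (Node Leaf) Leaf.
Definition code_bool (b : bool) : tree := if b then Node Leaf Leaf else Leaf.
Definition code_list (s : seq tree) : tree := foldr Node Leaf s.
Definition code_fin (T : finType) (x : T) : tree := code_nat (enum_rank x).
Definition code_set (T : finType) (A : {set T}) : tree :=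
  code_list [seq code_fin x | x <- enum A].

(** A nonnegative rational is represented by any pair [(a, b)] such that it
    equals [a / (b + 1)]. *)
Definition nnrat : Type := (nat * nat)%type.
Definition nnrat_val (R : realType) (q : nnrat) : {nonneg R} :=
  (q.1%:R / q.2.+1%:R)%:nng.
Definition code_nnrat (q : nnrat) : tree := Node (code_nat q.1) (code_nat q.2).

Inductive cmp := CLt | CLe | CEq | CGe | CGt.

Definition nat_of_cmp (c : cmp) : nat :=
  match c with CLt => 0 | CLe => 1 | CEq => 2 | CGe => 3 | CGt => 4 end%N.
Definition cmp_of_nat (n : nat) : option cmp :=
  nth None [:: Some CLt; Some CLe; Some CEq; Some CGe; Some CGt] n.
Lemma nat_of_cmpK : pcancel nat_of_cmp cmp_of_nat.
Proof. by case. Qed.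
HB.instance Definition _ := Countable.copy cmp (pcan_type nat_of_cmpK).

Definition eval_cmp (R : realType) (c : cmp) (x y : R) : bool :=
  match c with
  | CLt => x < y | CLe => x <= y | CEq => x == y | CGe => y <= x | CGt => y < x
  end.

Definition guard (X : finType) : Type := seq (X * cmp * nat).

Section Edges.
Variables (L X : finType).

Definition edge : Type := (L * guard X * {set X} * L)%type.
HB.instance Definition _ := Countable.on edge.

Definition src (e : edge) : L := e.1.1.1.
Definition grd (e : edge) : guard X := e.1.1.2.
Definition rst (e : edge) : {set X} := e.1.2.
Definition tgt (e : edge) : L := e.2.
End Edges.

Section Configurations.
Variables (R : realType) (L X : finType) (l0 : L).

Definition valuation : Type := X -> {nonneg R}.

Definition valuation_fun (nu : valuation) : {ptws X -> R} :=
  fun x => (nu x)%:num.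

(** [nu + d]; only used with [0 <= d], where [`|d| = d]. *)
Definition elapse (nu : valuation) (d : R) : valuation :=
  fun x => ((nu x)%:num + `|d|)%:nng.

Definition reset (Y : {set X}) (nu : valuation) : valuation :=
  fun x => if x \in Y then 0%:nng else nu x.

Definition sat (nu : valuation) (g : guard X) : bool :=
  all (fun a => eval_cmp a.1.2 (nu a.1.1)%:num a.2%:R) g.

(** Measurable types are pointed in the library: the initial location [l0] is
    a parameter of the type so as to provide the point. *)
Definition state of L : Type := (L * valuation)%type.
HB.instance Definition _ := gen_eqMixin (state l0).
HB.instance Definition _ := gen_choiceMixin (state l0).
HB.instance Definition _ := isPointed.Build (state l0) (l0, fun=> 0%:nng).

(** Generators of the product of the discrete sigma-algebra of [L] and the
    Borel sigma-algebra of the space of valuations. *)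
Definition config_gen : set (set (state l0)) :=
  [set C | (exists l, C = [set c | c.1 = l]) \/
    (exists x, exists2 B : set (measurableTypeR R), measurable B &
       C = [set c | B (c.2 x)%:num])].

Definition config : Type := g_sigma_algebraType config_gen.
HB.instance Definition _ := Measurable.on config.

Definition elapsec (c : config) (d : R) : config := (c.1, elapse c.2 d).

Definition config_seq : Type := nat -> config.
HB.instance Definition _ := gen_eqMixin config_seq.
HB.instance Definition _ := gen_choiceMixin config_seq.
HB.instance Definition _ := isPointed.Build config_seq (fun=> point).

Definition trajectory_gen : set (set config_seq) :=
  [set C | exists n, exists2 B : set config, measurable B &
     C = [set w | B (w n)]].

Definition trajectory : Type := g_sigma_algebraType trajectory_gen.
HB.instance Definition _ := Measurable.on trajectory.

End Configurations.
Arguments config R {L} X l0.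
Arguments trajectory R {L} X l0.

Section Delays.
Variables (R : realType) (L X : finType) (l0 : L).

Definition enabled (c : config R X l0) (e : edge L X) : bool :=
  (src e == c.1) && sat c.2 (grd e).

Definition edge_delays (c : config R X l0) (e : edge L X) : set R :=
  [set d | 0 <= d /\ sat (elapse c.2 d) (grd e)].

Definition delays (E : {fset edge L X}) (c : config R X l0) : set R :=
  [set d | exists2 e, e \in E & src e = c.1 /\ edge_delays c e d].

End Delays.

(** As a set of delays which is Lebesgue-null is finite (a finite union of
    null intervals), a probability on it giving equal mass to its points is
    the uniform one. The two axioms force [delays edges c] to be nonempty. *)
Record sta (R : realType) (L X : finType) (l0 : L) := STA {
  edges : {fset edge L X};
  weight : edge L X -> nat;
  weight_gt0 : forall e, e \in edges -> (0 < weight e)%N;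
  delay : config R X l0 -> probability (measurableTypeR R) R;
  delay_equiv : forall c,
    (0 < @lebesgue_measure R (delays edges c))%E ->
    forall B : set (measurableTypeR R), measurable B ->
      delay c B = 0%E <-> @lebesgue_measure R (B `&` delays edges c) = 0%E;
  delay_uniform : forall c,
    @lebesgue_measure R (delays edges c) = 0%E ->
    delay c (delays edges c) = 1%E /\
    forall d d', delays edges c d -> delays edges c d' ->
      delay c [set d] = delay c [set d']
}.

Section Semantics.
Variables (R : realType) (L X : finType) (l0 : L) (A : sta R X l0).

Definition edge_prob (c : config R X l0) (e : edge L X) : R :=
  if enabled c e then
    (weight A e)%:R / (\sum_(e' <- edges A | enabled c e') weight A e')%:R
  else 0.

Definition kernel_sta (c : config R X l0) (B : set (config R X l0)) : \bar R :=
  (\sum_(e <- edges A | src e == c.1)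
    \int[delay A c]_(d in [set d : measurableTypeR R | (0 <= d)%R])
      (\1_B (tgt e, reset (rst e) (elapse c.2 d))
         * edge_prob (elapsec c d) e)%:E)%E.

(** [P] is the law of the Markov chain with initial distribution [mu] and
    kernel [kernel_sta]. It is unique, and exists by the Ionescu-Tulcea theorem
    when the kernel is measurable. *)
Definition trajectory_law (mu : probability (config R X l0) R)
    (P : probability (trajectory R X l0) R) : Prop :=
  (forall B, measurable B -> P [set w | B (w 0%N)] = mu B) /\
  (forall n (C : nat -> set (config R X l0)) B,
     (forall i, measurable (C i)) -> measurable B ->
     let past := [set w : trajectory R X l0 | forall i, (i <= n)%N -> C i (w i)] in
     P (past `&` [set w | B (w n.+1)]) =
       (\int[P]_(w in past) kernel_sta (w n) B)%E).

Definition delay_continuous : Prop :=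
  forall (l : L) (a b : R), 0 <= a -> a <= b ->
  continuous (fun nu : initial_topology (@valuation_fun R X) =>
    fine (delay A (l, nu) `[a, b]%classic) : R).

Definition delay_monotone : Prop :=
  forall (c : config R X l0) (t : R) (e : edge L X),
    0 <= t -> e \in edges A -> src e = c.1 ->
    (forall t', 0 <= t' -> t' <= t -> ~ edge_delays (elapsec c t') e 0) ->
    (delay A c (edge_delays c e) <=
     delay A (elapsec c t) (edge_delays (elapsec c t) e))%E.

Definition delay_unbounded : Prop :=
  exists lambda0 : R, [/\ 0 < lambda0, lambda0 < 1 &
    forall c, ~ has_ubound (delays (edges A) c) ->
      (delay A c `[0%R, 2^-1%R]%classic <= lambda0%:E)%E].

Definition max_const : nat :=
  \max_(e <- edges A) \max_(a <- grd e) a.2.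

Definition fract (x : R) : R := x - (Num.floor x)%:~R.

Definition region_equiv (nu nu' : valuation R X) : Prop :=
  (forall x,
     (max_const%:R < (nu x)%:num /\ max_const%:R < (nu' x)%:num) \/
     (Num.floor (nu x)%:num = Num.floor (nu' x)%:num /\
      ((nu x)%:num \is a Num.int <-> (nu' x)%:num \is a Num.int))) /\
  (forall x y,
     (nu x)%:num <= max_const%:R -> (nu y)%:num <= max_const%:R ->
     (fract (nu x)%:num <= fract (nu y)%:num <->
      fract (nu' x)%:num <= fract (nu' y)%:num)).

End Semantics.

(** A pair (location, region) is given by the location and a rational
    valuation in the region; every region contains one. *)
Definition locreg (L X : finType) : Type := (L * {ffun X -> nnrat})%type.

Section Regions.
Variables (R : realType) (L X : finType) (l0 : L).

Definition locreg_set (A : sta R X l0) (r : locreg L X) : set (config R X l0) :=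
  [set c | c.1 = r.1 /\ region_equiv A (fun x => nnrat_val R (r.2 x)) c.2].

Definition code_locreg (r : locreg L X) : tree :=
  Node (code_fin r.1) (code_list [seq code_nnrat (r.2 x) | x <- enum X]).

(** [s] lists the pairs (location, region) of positive [mu]-mass. *)
Definition region_support (A : sta R X l0) (mu : probability (config R X l0) R)
    (s : seq (locreg L X)) : Prop :=
  forall r : locreg L X, (0 < mu (locreg_set A r))%E <->
    exists2 r', r' \in s & locreg_set A r' = locreg_set A r.

(** [A] and [mu] are fixed, hence the program [p] may depend on them. *)
Definition approximates_region_trajectories (A : sta R X l0)
    (mu : probability (config R X l0) R) (p : prog) : Prop :=
  forall P, trajectory_law A mu P ->
  forall (k : nat) (r : 'I_k.+1 -> locreg L X) (eps : nnrat), (0 < eps.1)%N ->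
  exists q : nnrat,
    run no_oracle p
      (Node (code_list [seq code_locreg (r i) | i <- enum 'I_k.+1])
            (code_nnrat eps))
      (code_nnrat q) /\
    `| (nnrat_val R q)%:num -
       fine (P [set w | forall i : 'I_k.+1, locreg_set A (r i) (w i)]) |
      <= (nnrat_val R eps)%:num.

Definition numerically_amenable (A : sta R X l0)
    (mu : probability (config R X l0) R) : Type :=
  {p : prog | approximates_region_trajectories A mu p}.

End Regions.

(** The deterministic and complete transition relation is given as a
    function. *)
Record muller (AP Q : finType) := Muller {
  minit : Q;
  mtrans : Q -> {set AP} -> Q;
  mfinal : {set {set Q}}
}.

Section MullerSemantics.
Variables (AP Q : finType) (M : muller AP Q).

Fixpoint mrun (u : nat -> {set AP}) (n : nat) : Q :=
  if n is n'.+1 then mtrans M (mrun u n') (u n') else minit M.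

Definition minf (u : nat -> {set AP}) : {set Q} :=
  [set q | `[< forall n, exists2 m, (n <= m)%N & mrun u m = q >]]%SET.

Definition maccepts (u : nat -> {set AP}) : Prop := minf u \in mfinal M.

Definition maccepting (R : realType) (L X : finType) (l0 : L) (lab : L -> {set AP}) :
    set (trajectory R X l0) :=
  [set w | maccepts (fun n => lab (w n).1)].

End MullerSemantics.

Definition code_cmp (c : cmp) : tree := code_nat (nat_of_cmp c).

Definition code_guard (X : finType) (g : guard X) : tree :=
  code_list [seq Node (code_fin a.1.1) (Node (code_cmp a.1.2) (code_nat a.2))
            | a <- g].

Definition code_sta (R : realType) (L X AP : finType) (l0 : L) (A : sta R X l0)
    (lab : L -> {set AP}) : tree :=
  code_list [::
    code_nat #|L|; code_nat #|X|; code_nat #|AP|;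
    code_fin l0;
    code_list [seq code_list [:: code_fin (src e); code_guard (grd e);
                                 code_set (rst e); code_fin (tgt e);
                                 code_nat (weight A e)]
              | e <- edges A];
    code_list [seq code_set (lab l) | l <- enum L] ].

Definition code_muller (AP Q : finType) (M : muller AP Q) : tree :=
  code_list [::
    code_nat #|Q|; code_fin (minit M);
    code_list [seq code_list [:: code_fin q; code_set u;
                                 code_fin (mtrans M q u)]
              | q <- enum Q, u <- enum {set AP}];
    code_list [seq code_set F | F <- enum (mfinal M)] ].

(* Main.v *)
From HB Require Import structures.
Require Import Defs.
From mathcomp Require Import all_boot all_order all_algebra.
From mathcomp Require Import all_classical all_reals all_analysis.
From mathcomp Require Import measurable_realfun ring lra zify.

(** Since delay distributions are total, every location has an edge enabled at
    all large clock values.  Hence the configurations with clock value [0] and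
    those with clock value above every constant of the guards play the role of
    a finite attractor: continuity of the delays on a compact interval bounds
    from below the probability of entering them in one step, and from them the
    probability of following any given path of the region graph is bounded
    below, uniformly in the past.  A Borel-Cantelli argument then shows that the
    set of product states (location, region, Muller state) visited infinitely
    often is almost surely a bottom strongly connected component of the region
    graph.  Deciding almost-sure acceptance is therefore a reachability problem
    in that graph, and the acceptance probability is the limit of the
    probabilities of having reached, after [k] steps, a state all of whose
    reachable bottom components are accepting; the probability of having
    reached a state that accepts or rejects almost surely tends to [1], which
    gives a stopping criterion. *)
Set Implicit Arguments.
Unset Strict Implicit.
Unset Printing Implicit Defensive.

(** * Computable functions on trees *)

(** The obstacle is that no lower bound need hold on a whole open region: when the clock approaches
    the right end of the interval, the probability of an edge taken inside it may vanish. Bounds are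
    therefore propagated along sets called [piece]: compact subintervals of a region, on which a
    continuous positive function has a positive minimum, and the unbounded region, where delaying
    does not change the truth of the guards. Aiming at a compact window inside the next open region
    yields a piece again. A delay distribution has the null sets of Lebesgue measure on the enabled
    delays, so edges are almost surely taken at noninteger clock values. The region graph thus
    depends on guards and resets alone, which is why it can be computed without knowing the
    distributions. The law of the chain is given by one-step identities on rectangular pasts. Markov
    arguments accordingly take the form of inequalities between the probability of a past and that
    of its continuation, with a factor [eta] that does not depend on the past, and are summed over
    finitely many disjoint pasts. *)

Definition tleft (t : tree) : tree := if t is Node a _ then a else Leaf.
Definition tright (t : tree) : tree := if t is Node _ b then b else Leaf.
(** [lst] is a bijection: a tree is read as the list of the left sons along its
    right spine, so that [code_nat n] is a list of [n] leaves. *)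
Fixpoint lst (t : tree) : seq tree := if t is Node a b then a :: lst b else [::].
Definition sz (t : tree) : nat := size (lst t).

Lemma code_listK : cancel code_list lst.
Proof. by elim=> //= x s ->. Qed.

Lemma lstK : cancel lst code_list.
Proof. by elim=> //= a _ b ->. Qed.

Lemma code_natE n : code_nat n = code_list (nseq n Leaf).
Proof. by elim: n => //= n ->. Qed.

Lemma code_natK : cancel code_nat sz.
Proof. by move=> n; rewrite /sz code_natE code_listK size_nseq. Qed.

(** One program must work for every oracle, so these functions serve both in the decision program,
    run with [no_oracle], and in the approximation program. *)
Definition computable (f : tree -> tree) : Prop :=
  exists p, forall o x, run o p x (f x).

Notation comp_list f := (computable (fun x => code_list (f x))).
Notation comp_nat f := (computable (fun x => code_nat (f x))).
Notation comp_bool f := (computable (fun x => code_bool (f x))).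

Section ClosureProperties.
Implicit Types (f g : tree -> tree) (s : tree -> seq tree) (n m : tree -> nat).
Implicit Types (b c : tree -> bool).

Lemma computable_ext f g : f =1 g -> computable f -> computable g.
Proof. by move=> fg [p rp]; exists p => o x; rewrite -fg. Qed.

Lemma computable_id : computable (fun x => x).
Proof. by exists PId => o x; constructor. Qed.

Lemma computable_app f g :
  computable f -> computable g -> computable (fun x => f (g x)).
Proof. by move=> [p rp] [q rq]; exists (PSeq q p) => o x; econstructor. Qed.

Lemma computable_Leaf : computable (fun=> Leaf).
Proof. by exists PLeaf => o x; constructor. Qed.

Lemma computable_Node f g :
  computable f -> computable g -> computable (fun x => Node (f x) (g x)).
Proof. by move=> [p rp] [q rq]; exists (PNode p q) => o x; constructor. Qed.

Lemma computable_tleft f : computable f -> computable (fun x => tleft (f x)).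
Proof.
by apply: computable_app; exists PLeft => o [|x y]; constructor.
Qed.

Lemma computable_tright f : computable f -> computable (fun x => tright (f x)).
Proof.
by apply: computable_app; exists PRight => o [|x y]; constructor.
Qed.

Lemma computable_const t : computable (fun=> t).
Proof.
elim: t => [|t1 H1 t2 H2]; first exact: computable_Leaf.
exact: computable_Node H1 H2.
Qed.

Lemma computable_if T (enc : T -> tree) b (f g : tree -> T) :
  comp_bool b -> computable (fun x => enc (f x)) ->
  computable (fun x => enc (g x)) ->
  computable (fun x => enc (if b x then f x else g x)).
Proof.
move=> [pb rb] [p rp] [q rq]; exists (PIf pb p q) => o x.
have := rb o x; case: (b x) => /= rbx; first exact: RunIfTrue rbx (rp o x).
exact: RunIfFalse rbx (rq o x).
Qed.

(** The only closure lemma that builds a [PWhile]; the later recursion schemes are reduced to it.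
    The loop state is [Node x (Node acc rest)]: keeping [x] lets the body depend on the
    environment. *)
Lemma computable_foldl T (enc : T -> tree) (dec : tree -> T)
    (F : tree -> T -> tree -> T) (g : tree -> T) s :
  cancel enc dec ->
  computable
    (fun e => enc (F (tleft e) (dec (tleft (tright e))) (tright (tright e)))) ->
  computable (fun x => enc (g x)) -> comp_list s ->
  computable (fun x => enc (foldl (F x) (g x) (s x))).
Proof.
move=> encK [pF rF] [pg rg] [ps rs].
pose body := PNode PLeft (PNode
  (PSeq (PNode PLeft (PNode (PSeq PRight PLeft)
                            (PSeq PRight (PSeq PRight PLeft)))) pF)
  (PSeq PRight (PSeq PRight PRight))).
exists (PSeq (PNode PId (PNode pg ps))
  (PSeq (PWhile (PSeq PRight PRight) body) (PSeq PRight PLeft))) => o x.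
econstructor.
  by constructor; [exact: RunId|constructor; [exact: rg|exact: rs]].
apply: (@RunSeq _ _ _ _ (Node x (Node (enc (foldl (F x) (g x) (s x))) Leaf)));
  last by do !econstructor.
elim: (s x) (g x) => [|y r IH] a /=.
  by apply: RunWhileFalse; do !econstructor.
apply: RunWhileTrue; first by do !econstructor.
  rewrite /body; do !econstructor; exact: rF.
by rewrite /= encK; exact: IH.
Qed.

Lemma comp_lst f : computable f -> comp_list (fun x => lst (f x)).
Proof. by apply: computable_ext => x; rewrite lstK. Qed.

Lemma comp_nil : comp_list (fun=> [::]).
Proof. exact: computable_Leaf. Qed.

Lemma comp_cons f s :
  computable f -> comp_list s -> comp_list (fun x => f x :: s x).
Proof. exact: computable_Node. Qed.

Lemma comp_behead s : comp_list s -> comp_list (fun x => behead (s x)).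
Proof. by move=> /computable_tright; apply: computable_ext => x; case: (s x). Qed.

Lemma comp_rev s : comp_list s -> comp_list (fun x => rev (s x)).
Proof.
move=> hs; have -> : (fun x => code_list (rev (s x))) =
    (fun x => code_list (foldl (fun a y => y :: a) [::] (s x))).
  apply/funext => x; congr code_list; rewrite -[LHS]cats0.
  by elim: (s x) [::] => //= y r IH a; rewrite rev_cons cat_rcons IH.
apply: computable_foldl (code_listK) _ comp_nil hs.
apply: comp_cons; last apply: comp_lst.
  by do 2!apply: computable_tright; apply: computable_id.
by apply: computable_tleft; apply: computable_tright; apply: computable_id.
Qed.

Lemma computable_foldr T (enc : T -> tree) (dec : tree -> T)
    (F : tree -> tree -> T -> T) (g : tree -> T) s :
  cancel enc dec ->
  computable
    (fun e => enc (F (tleft e) (tright (tright e)) (dec (tleft (tright e))))) ->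
  computable (fun x => enc (g x)) -> comp_list s ->
  computable (fun x => enc (foldr (F x) (g x) (s x))).
Proof.
move=> encK hF hg hs.
have -> : (fun x => enc (foldr (F x) (g x) (s x))) =
    (fun x => enc (foldl (fun z y => F x y z) (g x) (rev (s x)))).
  by apply/funext => x; rewrite foldl_rev.
by apply: (computable_foldl (F := fun x z y => F x y z)) hg (comp_rev hs).
Qed.

Lemma comp_list_foldr (F : tree -> tree -> seq tree -> seq tree) t s :
  comp_list
    (fun e => F (tleft e) (tright (tright e)) (lst (tleft (tright e)))) ->
  comp_list t -> comp_list s ->
  comp_list (fun x => foldr (F x) (t x) (s x)).
Proof. exact: computable_foldr code_listK. Qed.

Lemma comp_nat_foldr (F : tree -> tree -> nat -> nat) n s :
  comp_nat (fun e => F (tleft e) (tright (tright e)) (sz (tleft (tright e)))) ->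
  comp_nat n -> comp_list s ->
  comp_nat (fun x => foldr (F x) (n x) (s x)).
Proof. exact: computable_foldr code_natK. Qed.

Lemma comp_proj3 : computable (fun e => tright (tright e)) /\
  computable (fun e => tleft (tright e)) /\ computable tleft.
Proof.
have h := computable_id.
by do ![split|apply: computable_tleft|apply: computable_tright].
Qed.

Lemma comp_cat s t :
  comp_list s -> comp_list t -> comp_list (fun x => s x ++ t x).
Proof.
move=> hs ht; have -> : (fun x => code_list (s x ++ t x)) =
    (fun x => code_list (foldr cons (t x) (s x))).
  by apply/funext => x; congr code_list; elim: (s x) => //= y r ->.
have [h1 [h2 _]] := comp_proj3.
by apply: comp_list_foldr ht hs; apply: comp_cons => //; exact: comp_lst.
Qed.

Lemma comp_map (F : tree -> tree -> tree) s :
  computable (fun e => F (tleft e) (tright e)) -> comp_list s ->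
  comp_list (fun x => [seq F x y | y <- s x]).
Proof.
move=> hF hs; have [h1 [h2 h3]] := comp_proj3.
apply: (@comp_list_foldr (fun x y a => F x y :: a)) (comp_nil) hs.
apply: comp_cons; last exact: comp_lst.
apply: (computable_app (g := fun e => Node (tleft e) (tright (tright e)))) hF _.
exact: computable_Node.
Qed.

Lemma comp_filter (p : tree -> pred tree) s :
  comp_bool (fun e => p (tleft e) (tright e)) -> comp_list s ->
  comp_list (fun x => [seq y <- s x | p x y]).
Proof.
move=> hp hs; have [h1 [h2 h3]] := comp_proj3.
have -> : (fun x => code_list [seq y <- s x | p x y]) = (fun x => code_list
    (foldr (fun y a => if p x y then y :: a else a) [::] (s x))).
  by apply/funext => x; congr code_list; elim: (s x) => //= y r ->.
apply: (@comp_list_foldr (fun x y a => if p x y then y :: a else a)) comp_nil hs.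
apply: (@computable_if _ code_list (fun e => p (tleft e) (tright (tright e)))).
- apply: (computable_app (g := fun e => Node (tleft e) (tright (tright e)))) hp _.
  exact: computable_Node.
- by apply: comp_cons => //; exact: comp_lst.
- exact: comp_lst.
Qed.

Lemma comp_flatten_map (F : tree -> tree -> seq tree) s :
  comp_list (fun e => F (tleft e) (tright e)) -> comp_list s ->
  comp_list (fun x => flatten [seq F x y | y <- s x]).
Proof.
move=> hF hs; have [h1 [h2 h3]] := comp_proj3.
have -> : (fun x => code_list (flatten [seq F x y | y <- s x])) =
    (fun x => code_list (foldr (fun y a => F x y ++ a) [::] (s x))).
  by apply/funext => x; congr code_list; elim: (s x) => //= y r <-.
apply: (@comp_list_foldr (fun x y a => F x y ++ a)) comp_nil hs.
apply: comp_cat; last exact: comp_lst.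
apply: (computable_app (g := fun e => Node (tleft e) (tright (tright e)))) hF _.
exact: computable_Node.
Qed.

Lemma comp_is_nil s : comp_list s -> comp_bool (fun x => nilp (s x)).
Proof.
move=> [p rp]; exists (PSeq p (PIf PId PLeaf (PNode PLeaf PLeaf))) => o x.
econstructor; first exact: rp.
case: (s x) => [|y r] /=; last by do !econstructor.
by apply: RunIfFalse; do !econstructor.
Qed.

Lemma comp_negb b : comp_bool b -> comp_bool (fun x => ~~ b x).
Proof.
move=> hb.
have -> : (fun x => code_bool (~~ b x)) =
    (fun x => code_bool (if b x then false else true)).
  by apply/funext => x; case: (b x).
by apply: (computable_if (enc := code_bool)) => //; exact: computable_const.
Qed.

Lemma comp_andb b c :
  comp_bool b -> comp_bool c -> comp_bool (fun x => b x && c x).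
Proof.
move=> hb hc; apply: (computable_if (enc := code_bool)) => //.
exact: computable_const.
Qed.

Lemma comp_orb b c :
  comp_bool b -> comp_bool c -> comp_bool (fun x => b x || c x).
Proof.
move=> hb hc; apply: (computable_if (enc := code_bool)) => //.
exact: computable_const.
Qed.

Lemma comp_implyb b c :
  comp_bool b -> comp_bool c -> comp_bool (fun x => b x ==> c x).
Proof.
move=> hb hc; apply: (computable_if (enc := code_bool)) => //.
exact: computable_const.
Qed.

Lemma comp_has (p : tree -> pred tree) s :
  comp_bool (fun e => p (tleft e) (tright e)) -> comp_list s ->
  comp_bool (fun x => has (p x) (s x)).
Proof.
move=> hp hs; have -> : (fun x => code_bool (has (p x) (s x))) =
    (fun x => code_bool (~~ nilp [seq y <- s x | p x y])).
  apply/funext => x; congr code_bool.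
  by rewrite /nilp size_filter -lt0n has_count.
by apply: comp_negb; apply: comp_is_nil; exact: comp_filter.
Qed.

Lemma comp_all (p : tree -> pred tree) s :
  comp_bool (fun e => p (tleft e) (tright e)) -> comp_list s ->
  comp_bool (fun x => all (p x) (s x)).
Proof.
move=> hp hs; have -> : (fun x => code_bool (all (p x) (s x))) =
    (fun x => code_bool (~~ has (fun y => ~~ p x y) (s x))).
  by apply/funext => x; rewrite -all_predC; congr code_bool;
    apply: eq_all => y /=; rewrite negbK.
by apply: comp_negb; apply: comp_has hs; exact: comp_negb.
Qed.

Lemma comp_size s : comp_list s -> comp_nat (fun x => size (s x)).
Proof.
move=> hs; have -> : (fun x => code_nat (size (s x))) =
    (fun x => code_list [seq Leaf | _ <- s x]).
  by apply/funext => x; rewrite code_natE; congr code_list; elim: (s x) => //= y r ->.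
apply: (@comp_map (fun _ _ => Leaf)) hs; exact: computable_Leaf.
Qed.

Lemma comp_sz f : computable f -> comp_nat (fun x => sz (f x)).
Proof. by move=> hf; apply: comp_size; exact: comp_lst. Qed.

Lemma comp_nat0 : comp_nat (fun=> 0). Proof. exact: computable_Leaf. Qed.

Lemma comp_succn n : comp_nat n -> comp_nat (fun x => (n x).+1).
Proof. by move=> hn; apply: computable_Node hn; exact: computable_Leaf. Qed.

Lemma comp_predn n : comp_nat n -> comp_nat (fun x => (n x).-1).
Proof. by move=> /computable_tright; apply: computable_ext => x; case: (n x). Qed.

Lemma comp_nseq n : comp_nat n -> comp_list (fun x => nseq (n x) Leaf).
Proof. by apply: computable_ext => x; rewrite code_natE. Qed.

Lemma computable_iter T (enc : T -> tree) (dec : tree -> T)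
    (F : tree -> T -> T) (g : tree -> T) n :
  cancel enc dec ->
  computable (fun e => enc (F (tleft e) (dec (tright e)))) ->
  computable (fun x => enc (g x)) -> comp_nat n ->
  computable (fun x => enc (iter (n x) (F x) (g x))).
Proof.
move=> encK hF hg hn; have [h1 [h2 h3]] := comp_proj3.
have -> : (fun x => enc (iter (n x) (F x) (g x))) =
    (fun x => enc (foldr (fun _ a => F x a) (g x) (nseq (n x) Leaf))).
  by apply/funext => x; congr enc; elim: (n x) => //= k ->.
apply: (@computable_foldr _ _ dec (fun x _ a => F x a)) hg (comp_nseq hn) => //.
apply: (computable_app (g := fun e => Node (tleft e) (tleft (tright e)))) hF _.
exact: computable_Node.
Qed.

Lemma comp_list_iter (F : tree -> seq tree -> seq tree) s n :
  comp_list (fun e => F (tleft e) (lst (tright e))) ->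
  comp_list s -> comp_nat n ->
  comp_list (fun x => iter (n x) (F x) (s x)).
Proof. exact: computable_iter code_listK. Qed.

Lemma computable_iter_tright f n :
  computable f -> comp_nat n -> computable (fun x => iter (n x) tright (f x)).
Proof.
move=> hf hn; apply: (@computable_iter _ id id (fun _ => tright)) hf hn => //.
by do 2!apply: computable_tright; exact: computable_id.
Qed.

Lemma comp_addn n m : comp_nat n -> comp_nat m -> comp_nat (fun x => n x + m x)%N.
Proof.
move=> hn hm.
have -> : (fun x => code_nat (n x + m x)) = (fun x => code_list
    (nseq (n x) Leaf ++ nseq (m x) Leaf)).
  by apply/funext => x; rewrite code_natE nseqD.
by apply: comp_cat; exact: comp_nseq.
Qed.

Lemma comp_muln n m : comp_nat n -> comp_nat m -> comp_nat (fun x => n x * m x)%N.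
Proof.
move=> hn hm.
have -> : (fun x => code_nat (n x * m x)) = (fun x => code_nat
    (iter (n x) (fun k => m x + k)%N 0%N)).
  by apply/funext => x; congr code_nat; elim: (n x) => //= k <-; rewrite mulSn.
apply: (@computable_iter _ code_nat sz (fun x k => m x + k)%N) comp_nat0 hn;
  first exact: code_natK.
apply: (comp_addn (n := fun e => m (tleft e))).
  apply: (computable_app (g := tleft)) hm _.
  by have [_ []] := comp_proj3.
by apply: comp_sz; apply: computable_tright; exact: computable_id.
Qed.

Lemma comp_leq n m : comp_nat n -> comp_nat m -> comp_bool (fun x => n x <= m x)%N.
Proof.
move=> hn hm.
(* Truncated subtraction in unary: removing [m x] elements empties a list of length [n x]. *)
have -> : (fun x => code_bool (n x <= m x)%N) = (fun x => code_bool
    (nilp (iter (m x) behead (nseq (n x) Leaf)))).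
  apply/funext => x; congr code_bool; rewrite /nilp.
  suff -> k (t : seq tree) : size (iter k behead t) = (size t - k)%N.
    by rewrite size_nseq.
  by elim: k => [|k IH]; rewrite ?subn0 //= size_behead IH subnS.
apply: comp_is_nil; apply: (@comp_list_iter (fun _ => behead)) (comp_nseq hn) hm.
apply: comp_behead; apply: comp_lst.
by apply: computable_tright; exact: computable_id.
Qed.

Lemma comp_eqn n m : comp_nat n -> comp_nat m -> comp_bool (fun x => n x == m x)%N.
Proof.
move=> hn hm.
have -> : (fun x => code_bool (n x == m x)%N) = (fun x => code_bool
    ((n x <= m x) && (m x <= n x))%N) by apply/funext => x; rewrite eqn_leq.
by apply: comp_andb; exact: comp_leq.
Qed.

Lemma comp_maxn n m : comp_nat n -> comp_nat m -> comp_nat (fun x => maxn (n x) (m x)).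
Proof.
move=> hn hm; apply: (computable_if (enc := code_nat)) => //.
by apply: comp_leq => //; exact: comp_succn.
Qed.

Lemma comp_iota n :
  comp_nat n -> comp_list (fun x => [seq code_nat i | i <- iota 0 (n x)]).
Proof.
move=> hn.
have -> : (fun x => code_list [seq code_nat i | i <- iota 0 (n x)]) =
    (fun x => code_list (iter (n x) (fun a => a ++ [:: code_nat (size a)]) [::])).
  apply/funext => x; congr code_list.
  elim: (n x) => // k IH; rewrite -addn1 iotaD map_cat IH /= addn1 /=.
  by rewrite -IH size_map size_iota.
apply: (@comp_list_iter (fun _ a => a ++ [:: code_nat (size a)])) comp_nil hn.
have h : comp_list (fun e => lst (tright e)).
  by apply: comp_lst; apply: computable_tright; exact: computable_id.
by apply: comp_cat => //; apply: comp_cons comp_nil; exact: comp_size.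
Qed.

End ClosureProperties.

(** Under [map], [has] or a fold the environment [x] becomes a projection of a pair, so hypotheses
    have to be used at an argument [g x]. *)
Ltac comp_hyp :=
  match goal with
  | H : computable ?f |- computable (fun x => ?f (@?g x)) =>
      apply: (computable_app (g := g) H)
  | H : computable (fun x => ?enc (?f x)) |-
      computable (fun x => ?enc (?f (@?g x))) =>
      apply: (computable_app (g := g) H)
  end.

(** Extended by [::=] below with the closure lemmas of new functions. *)
Ltac comp_lib := fail.

Ltac comp_step :=
  first
    [ eassumption | comp_hyp | comp_lib
    | simple apply computable_id | simple apply computable_Leaf | simple apply comp_nat0
    | simple apply computable_const | simple apply comp_nil
    | simple apply comp_succn | simple apply comp_predn
    | simple apply comp_sz | simple apply comp_size
    | simple apply comp_addn | simple apply comp_muln | simple apply comp_maxn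
    | simple apply comp_leq | simple apply comp_eqn
    | simple apply comp_has | simple apply comp_all | simple apply comp_is_nil
    | simple apply comp_andb | simple apply comp_orb
    | simple apply comp_implyb | simple apply comp_negb
    | simple apply comp_cons | simple apply comp_cat
    | simple apply comp_map | simple apply comp_filter
    | simple apply comp_flatten_map | simple apply comp_iota | simple apply comp_rev
    | simple apply comp_lst
    | simple apply computable_tleft | simple apply computable_tright
    | simple apply computable_iter_tright
    | simple apply comp_nat_foldr | simple apply comp_list_iter
    | simple apply computable_Node
    | simple apply (computable_if (enc := code_bool)) ].
Ltac comp := repeat (cbv beta; comp_step).

(** * The algorithm *)

Definition item (i : nat) (t : tree) : tree := tleft (iter i tright t).

Arguments item : simpl never.
Arguments code_list : simpl never.
Arguments code_nat : simpl never.
Arguments code_fin : simpl never.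

Lemma item_code_list i s : item i (code_list s) = nth Leaf s i.
Proof.
have h n : iter n tright Leaf = Leaf by elim: n => //= n ->.
by elim: s i => [|x s IH] [|i] //=; rewrite /item ?h // iterSr /= -IH.
Qed.

Lemma comp_item (n : tree -> nat) f :
  comp_nat n -> computable f -> computable (fun x => item (n x) (f x)).
Proof. by move=> hn hf; rewrite /item; comp. Qed.

Definition codes (n : nat) : seq tree := [seq code_nat i | i <- iota 0 n].

Arguments codes : simpl never.

(** The comparison of number [i] for [nat_of_cmp], on region indices instead of clock values;
    [guard_atom] relates the two. *)
Definition cmp_index (i k m : nat) : bool :=
  [|| (i == 0) && (k < m), (i == 1) && (k <= m), (i == 2) && (k == m),
      (i == 3) && (m <= k) | (i == 4) && (m < k)]%N.

Definition same_set (u v : tree) : bool :=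
  all (fun y => has (fun z => sz y == sz z) (lst v)) (lst u) &&
  all (fun y => has (fun z => sz y == sz z) (lst u)) (lst v).

(** The functions [a_f] compute on codes what the functions [f] of the region
    graph compute on states; the input [inp] is the list of the codes of the
    automaton, of the Muller automaton, and of the regions or the precision. *)
Definition decode_nnrat (t : tree) : nnrat := (sz (tleft t), sz (tright t)).

Lemma code_nnratK : cancel code_nnrat decode_nnrat.
Proof. by case=> a b; rewrite /decode_nnrat /= !code_natK. Qed.

(** The second component stores the denominator minus one, hence the final [.-1]. *)
Definition qadd (p q : nnrat) : nnrat :=
  (p.1 * q.2.+1 + q.1 * p.2.+1, (p.2.+1 * q.2.+1).-1)%N.

Section Algorithm.
Variable inp : tree.

Local Notation a_sta := (item 0 inp).
Local Notation a_mul := (item 1 inp).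

Definition a_max : nat :=
  foldr (fun e => maxn
    (foldr (fun a => maxn (sz (tright (tright a)))) 0 (lst (item 1 e))))
    0 (lst (item 4 a_sta)).

Definition a_guard (g : tree) (k : nat) : bool :=
  all (fun a => cmp_index (sz (tleft (tright a))) k (2 * sz (tright (tright a))))
    (lst g).

Definition loc (s : tree) := sz (tleft s).
Definition reg (s : tree) := sz (tleft (tright s)).
Definition mst (s : tree) := sz (tright (tright s)).

Definition a_eq (s t : tree) : bool :=
  [&& loc s == loc t, reg s == reg t & mst s == mst t].

(** With a single clock, an edge resets it exactly when its reset list is nonempty. *)
Definition a_thick (s t : tree) : bool :=
  has (fun e => [&& sz (item 0 e) == loc s, sz (item 3 e) == loc t &
    has (fun n => [&& reg s <= (2 * sz n).+1, a_guard (item 1 e) (2 * sz n).+1 &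
      (if nilp (lst (item 2 e)) then reg t == (2 * sz n).+1 else reg t == 0)])
    (codes a_max.+1)]) (lst (item 4 a_sta)).

Definition a_trans (s t : tree) : bool :=
  has (fun d => [&& sz (item 0 d) == mst s,
    same_set (item 1 d) (item (loc s) (item 5 a_sta)) &
    sz (item 2 d) == mst t]) (lst (item 2 a_mul)).

Definition a_step (s t : tree) : bool := a_thick s t && a_trans s t.

Definition a_states : seq tree :=
  flatten [seq flatten [seq [seq Node l (Node k q)
    | q <- codes (sz (item 0 a_mul))] | k <- codes (2 * a_max.+1)]
    | l <- codes (sz (item 0 a_sta))].

(** Breadth-first saturation. Each round keeps the vertices already found, and a simple path is no
    longer than the number of rounds. *)
Definition a_reach (s : tree) : seq tree :=
  iter (size a_states)
    (fun r => [seq t <- a_states | has (fun u => a_eq u t || a_step u t) r])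
    [:: s].

Definition a_connect (s t : tree) : bool := has (fun u => a_eq u t) (a_reach s).

Definition a_bottom (t : tree) : bool :=
  all (fun u => a_connect t u ==> a_connect u t) a_states.

(** Some accepting set equals the set of Muller states reachable from [t]. When [t] lies in a bottom
    component, that is the set visited infinitely often by a run which fills the component. *)
Definition a_accept (t : tree) : bool :=
  has (fun F =>
    all (fun u => a_connect t u ==> has (fun q => sz q == mst u) (lst F)) a_states
    && all (fun q => has (fun u => a_connect t u && (sz q == mst u)) a_states)
         (lst F)) (lst (item 3 a_mul)).

Definition a_good (t : tree) : bool :=
  all (fun u => a_connect t u ==> (a_bottom u ==> a_accept u)) a_states.

Definition a_bad (t : tree) : bool :=
  all (fun u => a_connect t u ==> (a_bottom u ==> ~~ a_accept u)) a_states.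

(** If the rational has floor [m] at most the maximal constant, the first count is [m + 1] and the
    second is [m] or [m + 1] according to whether it is an integer, which gives [2 m] or [2 m + 1].
    Comparisons are cross-multiplied. *)
Definition a_index (q : tree) : nat :=
  (size [seq n <- codes a_max.+1 | sz n * (sz (tright q)).+1 <= sz (tleft q)] +
   size [seq n <- codes a_max.+1 | sz n * (sz (tright q)).+1 < sz (tleft q)]).-1.

Definition a_initial (r : tree) : tree :=
  Node (tleft r) (Node (code_nat (a_index (tleft (tright r)))) (item 1 a_mul)).

Definition a_decide : bool :=
  all (fun r => a_good (a_initial r)) (lst (item 2 inp)).

(** Paths are listed from their last state to their first one. *)
Definition a_paths (k : nat) : seq tree :=
  iter k (fun ps => flatten
      [seq [seq Node t p | t <- a_states & a_step (tleft p) t] | p <- ps])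
    [seq Node t Leaf | t <- a_states & mst t == sz (item 1 a_mul)].

(** The region of index [k] is presented by the rational [k / 2], coded as [(k, 1)]. The list is
    reversed because paths start with their last state. The precision is [eps / (4 n)]; it is used
    with [n] one more than the number of paths, hence nonzero. *)
Definition a_query (n : nat) (p : tree) : tree :=
  Node (code_list (rev [seq Node (tleft t)
      (code_list [:: Node (tleft (tright t)) (code_nat 1)]) | t <- lst p]))
    (Node (tleft (item 2 inp))
      (code_nat ((sz (tright (item 2 inp))).+1 * (4 * n)).-1)).

Definition a_queries (k : nat) : seq tree :=
  [seq Node p (a_query (size (a_paths k)).+1 p) | p <- a_paths k].

Definition a_sum (g : pred tree) (items : seq tree) : nnrat :=
  foldr (fun i q => if g (tleft (tleft i)) then qadd (decode_nnrat (tright i)) q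
                    else q) (0, 0)%N items.

(** The test [1 <= eps / 2 + q], where [q] approximates the probability of being decided, multiplied
    by [2] and the two denominators. *)
Definition a_stop (items : seq tree) : bool :=
  let q := a_sum (fun t => a_good t || a_bad t) items in
  2 * ((sz (tright (item 2 inp))).+1 * q.2.+1) <=
  sz (tleft (item 2 inp)) * q.2.+1 + 2 * (q.1 * (sz (tright (item 2 inp))).+1).

End Algorithm.

(** * Computability of the algorithm *)

Section AlgorithmComputable.
Implicit Types (f g h : tree -> tree) (n m k : tree -> nat).

Lemma comp_codes n : comp_nat n -> comp_list (fun x => codes (n x)).
Proof. exact: comp_iota. Qed.

Lemma comp_cmp_index n m k : comp_nat n -> comp_nat m -> comp_nat k ->
  comp_bool (fun x => cmp_index (n x) (m x) (k x)).
Proof. by move=> hn hm hk; rewrite /cmp_index; comp. Qed.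

Ltac comp_lib ::=
  first [ simple apply comp_item | simple apply comp_codes | simple apply comp_cmp_index ].

Lemma comp_same_set f g : computable f -> computable g ->
  comp_bool (fun x => same_set (f x) (g x)).
Proof. by move=> hf hg; rewrite /same_set; comp. Qed.

Lemma comp_max f : computable f -> comp_nat (fun x => a_max (f x)).
Proof. by move=> hf; rewrite /a_max; comp. Qed.

Lemma comp_guard f n : computable f -> comp_nat n ->
  comp_bool (fun x => a_guard (f x) (n x)).
Proof. by move=> hf hn; rewrite /a_guard; comp. Qed.

Lemma comp_a_eq f g : computable f -> computable g ->
  comp_bool (fun x => a_eq (f x) (g x)).
Proof. by move=> hf hg; rewrite /a_eq /loc /reg /mst; comp. Qed.

Ltac comp_lib ::=
  first [ simple apply comp_item | simple apply comp_codes | simple apply comp_cmp_index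
        | simple apply comp_same_set | simple apply comp_max | simple apply comp_guard
        | simple apply comp_a_eq ].

Lemma comp_states f : computable f -> comp_list (fun x => a_states (f x)).
Proof. by move=> hf; rewrite /a_states; comp. Qed.

Lemma comp_a_step f g h : computable f -> computable g -> computable h ->
  comp_bool (fun x => a_step (f x) (g x) (h x)).
Proof.
by move=> hf hg hh; rewrite /a_step /a_thick /a_trans /loc /reg /mst; comp.
Qed.

Ltac comp_lib ::=
  first [ simple apply comp_item | simple apply comp_codes | simple apply comp_cmp_index
        | simple apply comp_same_set | simple apply comp_max | simple apply comp_guard
        | simple apply comp_a_eq | simple apply comp_states | simple apply comp_a_step ].

Lemma comp_connect f g h : computable f -> computable g -> computable h ->
  comp_bool (fun x => a_connect (f x) (g x) (h x)).
Proof. by move=> hf hg hh; rewrite /a_connect /a_reach; comp. Qed.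

Ltac comp_lib ::=
  first [ simple apply comp_item | simple apply comp_codes | simple apply comp_cmp_index
        | simple apply comp_same_set | simple apply comp_max | simple apply comp_guard
        | simple apply comp_a_eq | simple apply comp_states | simple apply comp_a_step
        | simple apply comp_connect ].

Lemma comp_bottom f g : computable f -> computable g ->
  comp_bool (fun x => a_bottom (f x) (g x)).
Proof. by move=> hf hg; rewrite /a_bottom; comp. Qed.

Lemma comp_accept f g : computable f -> computable g ->
  comp_bool (fun x => a_accept (f x) (g x)).
Proof. by move=> hf hg; rewrite /a_accept /mst; comp. Qed.

Ltac comp_lib ::=
  first [ simple apply comp_item | simple apply comp_codes | simple apply comp_cmp_index
        | simple apply comp_same_set | simple apply comp_max | simple apply comp_guard
        | simple apply comp_a_eq | simple apply comp_states | simple apply comp_a_step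
        | simple apply comp_connect | simple apply comp_bottom | simple apply comp_accept ].

Lemma comp_good f g : computable f -> computable g ->
  comp_bool (fun x => a_good (f x) (g x)).
Proof. by move=> hf hg; rewrite /a_good; comp. Qed.

Lemma comp_bad f g : computable f -> computable g ->
  comp_bool (fun x => a_bad (f x) (g x)).
Proof. by move=> hf hg; rewrite /a_bad; comp. Qed.

Ltac comp_lib ::=
  first [ simple apply comp_item | simple apply comp_codes | simple apply comp_cmp_index
        | simple apply comp_same_set | simple apply comp_max | simple apply comp_guard
        | simple apply comp_a_eq | simple apply comp_states | simple apply comp_a_step
        | simple apply comp_connect | simple apply comp_bottom | simple apply comp_accept
        | simple apply comp_good | simple apply comp_bad ].

Lemma comp_decide : comp_bool a_decide.
Proof. by rewrite /a_decide /a_initial /a_index; comp. Qed.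

Lemma comp_paths f n : computable f -> comp_nat n ->
  comp_list (fun x => a_paths (f x) (n x)).
Proof. by move=> hf hn; rewrite /a_paths /mst; comp. Qed.

Lemma comp_queries f n : computable f -> comp_nat n ->
  comp_list (fun x => a_queries (f x) (n x)).
Proof.
move=> hf hn; have hp := comp_paths hf hn; rewrite /a_queries.
apply: (comp_map (F := fun x p => Node p (a_query (f x) (size (a_paths (f x) (n x))).+1 p))) => //.
have hs : comp_nat (fun e => (size (a_paths (f (tleft e)) (n (tleft e)))).+1).
  by apply: (@computable_app (fun x => code_nat (size (a_paths (f x) (n x))).+1)); comp.
by rewrite /a_query; comp.
Qed.

Lemma computable_sum (g : tree -> pred tree) (s : tree -> seq tree) :
  comp_bool (fun e => g (tleft e) (tright e)) -> comp_list s ->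
  computable (fun x => code_nnrat (a_sum (g x) (s x))).
Proof.
move=> hg hs; rewrite /a_sum.
apply: (@computable_foldr _ _ _ (fun x i q => if g x (tleft (tleft i)) then
  qadd (decode_nnrat (tright i)) q else q) _ _ code_nnratK) => //; last first.
  exact: computable_const.
apply: (@computable_if _ code_nnrat (fun e => g (tleft e) _)).
  apply: (@computable_app _ (fun e => Node (tleft e) _) hg).
  by comp.
  by rewrite /code_nnrat /=; comp.
by rewrite /code_nnrat /=; comp.
Qed.

Lemma comp_stop : comp_bool (fun x => a_stop (tleft x) (lst (tright x))).
Proof.
rewrite /a_stop.
pose S x := a_sum (fun t => a_good (tleft x) t || a_bad (tleft x) t) (lst (tright x)).
have hS : computable (fun x => code_nnrat (S x)) by apply: computable_sum; comp.
have h1 : comp_nat (fun x => (S x).1) by apply: (computable_tleft hS).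
have h2 : comp_nat (fun x => (S x).2) by apply: (computable_tright hS).
rewrite -/(S _); comp.
Qed.

Lemma computable_output : computable
  (fun x => code_nnrat (a_sum (a_good (tleft x)) (lst (tright x)))).
Proof. by apply: computable_sum; comp. Qed.

End AlgorithmComputable.

(** * The region graph *)

(** Classical equality, for membership of trees in lists within proofs; the algorithm compares codes
    through [sz]. *)
HB.instance Definition _ := gen_eqMixin tree.

Section RegionGraph.
Variables (R : realType) (L X AP Q : finType) (l0 : L) (A : sta R X l0).
Variables (lab : L -> {set AP}) (M : muller AP Q).

Definition guard_index (g : guard X) (k : nat) : bool :=
  all (fun a => cmp_index (nat_of_cmp a.1.2) k (2 * a.2)) g.

Definition cell : finType := (L * 'I_(2 * (max_const A).+1))%type.

(** Only the odd indices, those of open intervals, are reached by a delay with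
    positive probability. *)
Definition thick (s t : cell) : bool :=
  has (fun e => [&& src e == s.1, tgt e == t.1 &
    has (fun n => [&& s.2 <= (2 * n).+1, guard_index (grd e) (2 * n).+1 &
      (if rst e == finset.set0 then t.2 == (2 * n).+1 :> nat else t.2 == 0 :> nat)])
    (iota 0 (max_const A).+1)]) (finmap.enum_fset (edges A)).

Definition pstate : finType := (cell * Q)%type.

Definition step (s t : pstate) : bool :=
  thick s.1 t.1 && (t.2 == mtrans M s.2 (lab s.1.1)).

Definition bottom_scc (t : pstate) : bool :=
  [forall u, connect step t u ==> connect step u t].

Definition mreach (t : pstate) : {set Q} := [set u.2 | u in connect step t]%SET.

Definition good (t : pstate) : bool :=
  [forall u, connect step t u ==> (bottom_scc u ==> (mreach u \in mfinal M))].

Definition bad (t : pstate) : bool :=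
  [forall u, connect step t u ==> (bottom_scc u ==> (mreach u \notin mfinal M))].

Definition code_state (s : pstate) : tree :=
  Node (code_fin s.1.1) (Node (code_nat s.1.2) (code_fin s.2)).

(** An explicit order, the one in which [a_states] lists the codes, so that the two lists correspond
    entry by entry. *)
Definition states : seq pstate :=
  [seq (lk, q) | lk <- [seq (l, k) | l <- enum L, k <- enum 'I_(2 * (max_const A).+1)],
                 q <- enum Q].

Lemma mem_states t : t \in states.
Proof.
case: t => [[l k] q]; rewrite allpairs_f ?mem_enum //.
by rewrite allpairs_f ?mem_enum.
Qed.

Lemma uniq_states : uniq states.
Proof.
by do ?apply: allpairs_uniq; rewrite ?enum_uniq // => -[? ?] [? ?] _ _ [-> ->].
Qed.

Fixpoint paths (k : nat) : seq (seq pstate) :=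
  if k is k'.+1 then
    flatten [seq [seq t :: p | t <- states & step (head t p) t] | p <- paths k']
  else [seq [:: t] | t <- states & t.2 == minit M].

Section Correctness.
Variable inp : tree.
Hypotheses (inp0 : item 0 inp = code_sta A lab) (inp1 : item 1 inp = code_muller M).

Lemma sz_fin (F : finType) (x : F) : sz (code_fin x) = enum_rank x.
Proof. exact: code_natK. Qed.

Lemma eq_fin (F : finType) (x y : F) : (sz (code_fin x) == sz (code_fin y)) = (x == y).
Proof. by rewrite !sz_fin (inj_eq val_inj) (inj_eq enum_rank_inj). Qed.

Lemma a_maxE : a_max inp = max_const A.
Proof.
rewrite /a_max inp0 !item_code_list /= code_listK /max_const.
elim: (finmap.enum_fset (edges A)) => [|e s IH]; first by rewrite big_nil.
rewrite big_cons /= IH; congr maxn; rewrite /item /= /code_guard code_listK.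
elim: (grd e) => [|a r IHr]; first by rewrite big_nil.
by rewrite big_cons /= IHr code_natK.
Qed.

Lemma a_guardE (g : guard X) k : a_guard (code_guard g) k = guard_index g k.
Proof.
rewrite /a_guard /code_guard code_listK all_map; apply: eq_all => a /=.
by rewrite !code_natK.
Qed.

Lemma lst_set (F : finType) (B : {set F}) : lst (code_set B) = [seq code_fin x | x <- enum B].
Proof. exact: code_listK. Qed.

Lemma has_set (F : finType) (x : F) (B : {set F}) :
  has (fun z => sz (code_fin x) == sz z) (lst (code_set B)) = (x \in B).
Proof.
rewrite lst_set has_map; apply/hasP/idP => [[y]|xB].
  by rewrite mem_enum /= eq_fin => yB /eqP ->.
by exists x; rewrite ?mem_enum //= eq_fin.
Qed.

Lemma same_setE (F : finType) (B C : {set F}) :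
  same_set (code_set B) (code_set C) = (B == C).
Proof.
rewrite /same_set finset.eqEsubset; congr (_ && _).
  rewrite (lst_set B) all_map; apply/allP/fintype.subsetP => h x.
    by move=> xB; rewrite -has_set; apply: h; rewrite mem_enum.
  by rewrite mem_enum /= has_set; exact: h.
rewrite (lst_set C) all_map; apply/allP/fintype.subsetP => h x.
  by move=> xB; rewrite -has_set; apply: h; rewrite mem_enum.
by rewrite mem_enum /= has_set; exact: h.
Qed.

Lemma eq_has_map (T U : Type) (f : T -> U) (p : pred U) (q : pred T) s :
  (forall x, p (f x) = q x) -> has p (map f s) = has q s.
Proof. by move=> pq; rewrite has_map; apply: eq_has => x; exact: pq. Qed.

Lemma has_codes (p : pred tree) n :
  has p (codes n) = has (fun i => p (code_nat i)) (iota 0 n).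
Proof. by rewrite has_map. Qed.

Lemma a_thickE s t : a_thick inp (code_state s) (code_state t) = thick s.1 t.1.
Proof.
rewrite /a_thick /thick a_maxE inp0 /code_sta item_code_list [nth _ _ _]/=.
rewrite code_listK; apply: eq_has_map => e; rewrite !item_code_list.
rewrite ![nth _ _ _]/= !eq_fin; congr [&& _, _ & _].
rewrite has_codes; apply: eq_has => n.
rewrite /reg /= !code_natK a_guardE lst_set; congr [&& _, _ & _].
by rewrite /nilp size_map -cardE cards_eq0; case: ifP.
Qed.

Lemma a_transE s t :
  a_trans inp (code_state s) (code_state t) = (t.2 == mtrans M s.2 (lab s.1.1)).
Proof.
rewrite /a_trans inp0 inp1 /code_sta /code_muller !item_code_list /= code_listK /loc /mst /=.
rewrite [sz (code_fin s.1.1)]sz_fin (nth_map s.1.1) -?cardE ?ltn_ord // nth_enum_rank.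
apply/hasP/eqP => [[d /allpairsP[[q u] [_ _ ->]]] /=|->].
  rewrite !item_code_list /= !eq_fin same_setE => /and3P[/eqP-> /eqP-> /eqP].
  by move=> <-.
exists (code_list [:: code_fin s.2; code_set (lab s.1.1);
   code_fin (mtrans M s.2 (lab s.1.1))]).
  by apply/allpairsP; exists (s.2, lab s.1.1); rewrite !mem_enum.
by rewrite !item_code_list /= !eq_fin same_setE !eqxx.
Qed.

Lemma a_stepE s t : a_step inp (code_state s) (code_state t) = step s t.
Proof. by rewrite /a_step a_thickE a_transE. Qed.

Lemma a_eqE s t : a_eq (code_state s) (code_state t) = (s == t).
Proof.
case: s t => [[l k] q] [[l' k'] q'].
by rewrite /a_eq /loc /reg /mst /= !eq_fin !code_natK !xpair_eqE andbA.
Qed.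

Lemma codes_enum (F : finType) : codes #|F| = [seq code_fin x | x <- enum F].
Proof.
apply: (@eq_from_nth _ Leaf); rewrite !size_map size_iota ?cardT ?enumT //.
rewrite -enumT -cardT => i iF; have x0 : F by case: (pickP F) => [//|F0]; rewrite eq_card0 in iF.
rewrite (nth_map 0) ?size_iota // nth_iota // (nth_map x0) -?cardE //.
rewrite add0n -[i in LHS]/(val (Ordinal iF)) -[i in RHS]/(val (Ordinal iF)).
by rewrite -enum_val_nth /code_fin enum_valK.
Qed.

Lemma codes_ord n : codes n = [seq code_nat i | i : 'I_n <- enum 'I_n].
Proof. by rewrite /codes -val_enum_ord -map_comp. Qed.

Lemma a_statesE : a_states inp = [seq code_state t | t <- states].
Proof.
rewrite /a_states a_maxE inp0 inp1 /code_sta /code_muller !item_code_list.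
rewrite ![nth _ _ _]/= !code_natK !codes_enum codes_ord /states map_allpairs.
elim: (enum L) => //= l s ->.
rewrite flatten_cat map_cat; congr cat; rewrite -!map_comp.
rewrite map_flatten -map_comp; congr flatten; apply: eq_map => k /=.
by rewrite -!map_comp.
Qed.

Lemma a_reachE s :
  exists2 r, a_reach inp (code_state s) = [seq code_state t | t <- r] &
    forall t, (t \in r) = connect step s t.
Proof.
pose P n t := exists2 p, path step s p & t = last s p /\ size p <= n.
have refl n (r : seq pstate) : (forall t, t \in r <-> P n t) ->
    forall t, reflect (P n t) (t \in r).
  by move=> rP t; apply: (iffP idP) => /rP.
suff h n : exists2 r, iter n
    (fun r => [seq t <- a_states inp | has (fun u => a_eq u t || a_step inp u t) r])
    [:: code_state s] = [seq code_state t | t <- r] &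
    forall t, t \in r <-> P n t.
  have [r rE /refl rP] := h (size (a_states inp)); exists r; first exact: rE.
  move=> t; apply/rP/connectP => [[p sp [-> _]]|[p sp ->]]; first by exists p.
  (* A path without repetition has at most as many vertices as there are states, so the rounds of
     [a_reach] suffice. *)
  case/shortenP: sp => p' sp' up' _; exists p' => //; split=> //.
  rewrite a_statesE size_map.
  rewrite -ltnS -[(size p').+1]/(size (s :: p')) ltnW // ltnS.
  by apply: uniq_leq_size => // x _; exact: mem_states.
elim: n => [|n [r rE /refl rP]].
  exists [:: s] => // t; rewrite inE.
  split=> [/eqP ->|[[|? ?] // _ [-> //]]]; by exists [::].
exists [seq t <- states | has (fun u => (u == t) || step u t) r].
  rewrite iterS rE a_statesE filter_map; congr map; apply: eq_filter => t /=.
  by rewrite has_map; apply: eq_has => u /=; rewrite a_eqE a_stepE.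
move=> t; rewrite mem_filter mem_states andbT.
split=> [/hasP[u /rP[p sp [-> sz_p]] /orP[/eqP<-|st]]|[p]].
- by exists p => //; split=> //; exact: leqW.
- by exists (rcons p t); rewrite ?rcons_path ?sp // last_rcons size_rcons.
case/lastP: p => [_ [-> _]|p x].
  by apply/hasP; exists s; rewrite ?eqxx //; apply/rP; exists [::].
rewrite rcons_path last_rcons size_rcons => /andP[sp st] [-> sz_p].
by apply/hasP; exists (last s p); rewrite ?st ?orbT //; apply/rP; exists p.
Qed.

Lemma a_connectE s t : a_connect inp (code_state s) (code_state t) = connect step s t.
Proof.
rewrite /a_connect; have [r -> <-] := a_reachE s; rewrite has_map.
apply/hasP/idP => [[u ur] /=|tr]; first by rewrite a_eqE => /eqP <-.
by exists t => //=; rewrite a_eqE.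
Qed.

Lemma all_states (p : pred tree) : all p (a_states inp) = [forall t, p (code_state t)].
Proof.
rewrite a_statesE all_map; apply/allP/forallP => h x; last by move=> _; exact: h.
exact: (h x (mem_states x)).
Qed.

Lemma has_states (p : pred tree) : has p (a_states inp) = [exists t, p (code_state t)].
Proof.
rewrite a_statesE has_map; apply/hasP/existsP => [[x _ px]|[x px]]; exists x => //.
exact: mem_states.
Qed.

Lemma a_bottomE t : a_bottom inp (code_state t) = bottom_scc t.
Proof.
by rewrite /a_bottom all_states; apply: eq_forallb => u; rewrite !a_connectE.
Qed.

Lemma a_acceptE t : a_accept inp (code_state t) = (mreach t \in mfinal M).
Proof.
rewrite /a_accept inp1 /code_muller item_code_list [nth _ _ _]/= code_listK has_map.
have h F : (all (fun u => a_connect inp (code_state t) u ==>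
      has (fun q => sz q == mst u) (lst (code_set F))) (a_states inp) &&
    all (fun q => has (fun u => a_connect inp (code_state t) u && (sz q == mst u))
      (a_states inp)) (lst (code_set F))) = (F == mreach t).
  rewrite finset.eqEsubset andbC; congr (_ && _).
    rewrite lst_set all_map; apply/allP/fintype.subsetP => h q.
      rewrite -mem_enum => /h /=; rewrite has_states => /existsP[u].
      rewrite a_connectE /mst eq_fin => /andP[tu /eqP ->].
      by apply/imsetP; exists u.
    rewrite mem_enum => /h /imsetP[u tu ->] /=; rewrite has_states.
    have {}tu : connect step t u by [].
    by apply/existsP; exists u; rewrite a_connectE tu /mst eq_fin eqxx.
  have e u : has (fun q => sz q == mst (code_state u)) (lst (code_set F)) = (u.2 \in F).
    by rewrite -has_set; apply: eq_has => q; rewrite eq_sym.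
  rewrite all_states; apply/forallP/fintype.subsetP => [h q /imsetP[u tu ->]|h u].
    by have := h u; rewrite a_connectE e; move/implyP; apply.
  rewrite a_connectE e; apply/implyP => tu; apply: h; apply/imsetP.
  by exists u.
apply/hasP/idP => [[F] /=|tM].
  by rewrite h => + /eqP <-; rewrite mem_enum.
by exists (mreach t); rewrite ?mem_enum //= h.
Qed.

Lemma a_goodE t : a_good inp (code_state t) = good t.
Proof.
rewrite /a_good all_states; apply: eq_forallb => u.
by rewrite a_connectE a_bottomE a_acceptE.
Qed.

Lemma a_badE t : a_bad inp (code_state t) = bad t.
Proof.
rewrite /a_bad all_states; apply: eq_forallb => u.
by rewrite a_connectE a_bottomE a_acceptE.
Qed.

End Correctness.
End RegionGraph.

(** * Runs of the algorithm *)

(** The loop state is [Node x (Node acc rest)] as in [computable_foldl]. The head [Node p q] of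
    [rest] is pushed onto [acc] with [q] replaced by the answer of the oracle, so the results come
    out reversed. *)
Definition oracle_map_body : prog :=
  PNode PLeft (PNode
    (PNode (PNode (PSeq PRight (PSeq PRight (PSeq PLeft PLeft)))
                  (PSeq PRight (PSeq PRight (PSeq PLeft (PSeq PRight POracle)))))
           (PSeq PRight PLeft))
    (PSeq PRight (PSeq PRight PRight))).

Definition oracle_map : prog :=
  PSeq (PNode PLeft (PNode PLeaf PRight))
    (PSeq (PWhile (PSeq PRight PRight) oracle_map_body)
          (PNode PLeft (PSeq PRight PLeft))).

Lemma run_oracle_map (o : tree -> tree -> Prop) (q f : tree -> tree) x s :
  (forall p, p \in s -> o (q p) (f p)) ->
  run o oracle_map (Node x (code_list [seq Node p (q p) | p <- s]))
    (Node x (code_list (rev [seq Node p (f p) | p <- s]))).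
Proof.
move=> of_; rewrite /oracle_map.
econstructor; first by do !econstructor.
apply: (@RunSeq _ _ _ _
    (Node x (Node (code_list (rev [seq Node p (f p) | p <- s])) Leaf))); last first.
  by do !econstructor.
rewrite -[rev _]cats0.
rewrite -[Leaf in Node x (Node Leaf _)]/(code_list [::]).
elim: s [::] of_ => [|p s IH] a of_.
  by apply: RunWhileFalse; do !econstructor.
apply: (@RunWhileTrue _ _ _ _ (Node p (q p))
    (code_list [seq Node p (q p) | p <- s])).
- by do !econstructor.
- rewrite /oracle_map_body; do !econstructor.
  exact: of_ (mem_head _ _).
rewrite map_cons rev_cons cat_rcons.
by apply: (IH (Node p (f p) :: a)) => r rs; apply: of_; rewrite inE rs orbT.
Qed.

(** Induction on the distance [n] to a stage known to pass the test; the loop may stop before it. *)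
Lemma run_while_search (o : tree -> tree -> Prop) (b : tree -> bool) pb body
    (S : nat -> tree) k n :
  (forall x, run o pb x (code_bool (~~ b x))) ->
  (forall i, run o body (S i) (S i.+1)) -> b (S (k + n)%N) ->
  exists2 m, (k <= m)%N & b (S m) /\ run o (PWhile pb body) (S k) (S m).
Proof.
move=> rb rS; elim: n k => [|n IH] k.
  rewrite addn0 => bk; exists k => //; split=> //.
  by apply: RunWhileFalse; have := rb (S k); rewrite bk.
case bk : (b (S k)); first move=> _.
  exists k => //; split=> //.
  by apply: RunWhileFalse; have := rb (S k); rewrite bk.
rewrite addnS -addSn => /IH[m km [bm rm]]; exists m; first exact: ltnW.
split=> //; apply: RunWhileTrue rm => //.
by have := rb (S k); rewrite bk; exact.
Qed.

Section ApproximationProgram.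

Definition answers (inp : tree) (f : nat -> tree -> tree) (k : nat) : seq tree :=
  rev [seq Node p (f k p) | p <- a_paths inp k].

(** An unbounded search over the path length [k]; each round asks all queries of its level afresh. A
    level known to pass the test ensures termination, and the conclusion concerns the level at which
    the loop actually stops. *)
Lemma run_approximation : exists approx : prog,
  forall (o : tree -> tree -> Prop) inp f K,
  (forall k p, p \in a_paths inp k ->
     o (a_query inp (size (a_paths inp k)).+1 p) (f k p)) ->
  a_stop inp (answers inp f K.+1) ->
  exists2 k, a_stop inp (answers inp f k) &
    run o approx inp (code_nnrat (a_sum (a_good inp) (answers inp f k))).
Proof.
have [pb rb] : comp_bool (fun x => ~~ a_stop (tleft (tleft x)) (lst (tright x))).
  apply: comp_negb; apply: (@computable_app
    (fun x => code_bool (a_stop (tleft x) (lst (tright x))))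
    (fun x => Node (tleft (tleft x)) (tright x))) comp_stop _.
  by comp.
have [pq rq] : computable (fun x =>
    Node (Node (tleft (tleft x)) (Node Leaf (tright (tleft x))))
      (code_list (a_queries (tleft (tleft x)) (sz (tright (tleft x))).+1))).
  apply: computable_Node; first by comp.
  by apply: comp_queries; comp.
have [po ro] : computable (fun x => code_nnrat
    (a_sum (a_good (tleft (tleft x))) (lst (tright x)))).
  apply: (@computable_app
    (fun x => code_nnrat (a_sum (a_good (tleft x)) (lst (tright x))))
    (fun x => Node (tleft (tleft x)) (tright x))) computable_output _.
  by comp.
pose body := PSeq pq oracle_map.
exists (PSeq (PNode (PNode PId PLeaf) PLeaf)
  (PSeq body (PSeq (PWhile pb body) po))) => o inp f K of_ stopK.
pose S k := Node (Node inp (code_nat k)) (code_list (answers inp f k)).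
have run_body k its : run o body (Node (Node inp (code_nat k)) its) (S k.+1).
  econstructor; first exact: rq.
  rewrite /= code_natK; apply: run_oracle_map => p; exact: of_.
(* One round precedes the loop, since the test needs answers; the search therefore starts at level
   [1]. *)
have := @run_while_search o (fun x => a_stop (tleft (tleft x)) (lst (tright x)))
  pb body S 1 K (rb o) (fun i => run_body i _).
rewrite /= !code_listK add1n => /(_ stopK)[k _ [stopk runk]].
exists k; first by rewrite code_listK in stopk.
econstructor; first by do !econstructor.
econstructor; first exact: (run_body 0).
econstructor; first exact: runk.
by have := ro o (S k); rewrite /= code_listK.
Qed.

End ApproximationProgram.

Section PathsCorrectness.
Variables (R : realType) (L X AP Q : finType) (l0 : L) (A : sta R X l0).
Variables (lab : L -> {set AP}) (M : muller AP Q) (inp : tree).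
Hypotheses (inp0 : item 0 inp = code_sta A lab) (inp1 : item 1 inp = code_muller M).

Definition code_path (p : seq (pstate Q A)) : tree :=
  code_list [seq code_state t | t <- p].

Lemma paths_nonempty k p : p \in paths A lab M k -> p != [::].
Proof.
case: k => [|k] /=; first by case/mapP=> t _ ->.
by case/flatten_mapP => q _ /mapP[t _ ->].
Qed.

Lemma a_pathsE k : a_paths inp k = [seq code_path p | p <- paths A lab M k].
Proof.
elim: k => [|k IH].
  rewrite /a_paths /= (a_statesE inp0 inp1) filter_map -!map_comp.
  congr map; apply: eq_filter => t /=.
  by rewrite inp1 /code_muller item_code_list /= /mst /= eq_fin.
rewrite /a_paths iterS -/(a_paths inp k) IH /= map_flatten -!map_comp.
congr flatten; apply/eq_in_map => -[/paths_nonempty //|u p _] /=.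
rewrite (a_statesE inp0 inp1) filter_map -!map_comp; congr map.
by apply: eq_filter => t /=; exact: (a_stepE inp0 inp1).
Qed.

Definition index_nnrat (q : nnrat) : nat :=
  (count (fun n => n * q.2.+1 <= q.1) (iota 0 (max_const A).+1) +
   count (fun n => n * q.2.+1 < q.1) (iota 0 (max_const A).+1)).-1.

Lemma a_indexE q : a_index inp (code_nnrat q) = index_nnrat q.
Proof.
rewrite /a_index /index_nnrat (a_maxE inp0) !size_filter /codes !count_map.
by congr (_ + _).-1; apply: eq_count => n /=; rewrite !code_natK.
Qed.

End PathsCorrectness.

Import Order.TTheory GRing.Theory Num.Theory.
Import numFieldNormedType.Exports.

Local Open Scope classical_set_scope.
Local Open Scope ring_scope.

(** * One-clock regions *)

Section CountDownClosed.
Local Open Scope nat_scope.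

(** A downward closed predicate holds on an initial segment, whose length is the count. *)
Lemma count_down_closed (p : pred nat) n c :
  (forall i j, i <= j -> p j -> p i) -> c < n -> (c < count p (iota 0 n)) = p c.
Proof.
move=> pP; elim: n => // n IH; rewrite ltnS leq_eqVlt => cn.
rewrite -[X in iota 0 X]addn1 iotaD count_cat /= addn0 add0n.
have [pn|pn] := boolP (p n); last first.
  rewrite addn0; case/orP: cn => [/eqP ->|]; last exact: IH.
  by rewrite (negbTE pn); apply/negbTE; rewrite -leqNgt -{2}(size_iota 0 n) count_size.
have -> : count p (iota 0 n) = n.
  rewrite -[RHS](size_iota 0 n); apply/eqP; rewrite -all_count; apply/allP => i.
  by rewrite mem_iota => /andP[_ /ltnW/pP]; exact.
rewrite addn1 (pP _ n) //; last by case/orP: cn => [/eqP ->|/ltnW].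
by rewrite ltnS leq_eqVlt cn.
Qed.

(** Abstracts [n <= v] and [n < v]. The counts [a] of [p] and [b] of [q] satisfy [b <= a <= b + 1],
    so their sum determines both; [p 0] keeps the predecessor from truncating. *)
Lemma double_index (p q : pred nat) n :
  (forall i j, i <= j -> p j -> p i) -> (forall i j, i <= j -> q j -> q i) ->
  (forall i, q i -> p i) -> (forall i, p i.+1 -> q i) -> p 0 ->
  let k := (count p (iota 0 n.+1) + count q (iota 0 n.+1)).-1 in
  [/\ k < 2 * n.+1, forall c, c <= n -> (2 * c <= k) = p c
    & forall c, c <= n -> (2 * c < k) = q c].
Proof.
move=> pP qP qp pq p0 k; rewrite {}/k.
have hp c : c <= n -> (c < count p (iota 0 n.+1)) = p c.
  by move=> cn; rewrite count_down_closed.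
have hq c : c <= n -> (c < count q (iota 0 n.+1)) = q c.
  by move=> cn; rewrite count_down_closed.
have := count_size p (iota 0 n.+1); have := count_size q (iota 0 n.+1).
have := hp 0; rewrite leq0n p0 => /(_ isT).
have qlep : count q (iota 0 n.+1) <= count p (iota 0 n.+1) by apply: sub_count.
rewrite size_iota.
move: (count p _) (count q _) hp hq qlep => a b hp hq ba a0 bn an.
have ab : a <= b.+1.
  rewrite leqNgt; apply/negP => ab.
  have : ~~ q b by rewrite -hq ?ltnn //; lia.
  by apply/negP; rewrite negbK; apply: pq; rewrite -hp //; lia.
split=> [|c cn|c cn]; first by lia.
  by rewrite -hp //; lia.
by rewrite -hq //; lia.
Qed.

End CountDownClosed.

Section RegionIndex.
Variables (R : realType) (L X : finType) (l0 : L) (A : sta R X l0).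
Local Notation N := (max_const A).

(** With [N] the maximal constant, the index is [2n] at [v = n], [2n+1] on
    [n < v < n+1] and [2N+1] above [N]; thus [v] compares to an integer [c <= N]
    as its index compares to [2c]. *)
Definition region_index (v : R) : nat :=
  (count (fun n => n%:R <= v) (iota 0 N.+1) +
   count (fun n => n%:R < v) (iota 0 N.+1)).-1.

Lemma region_indexP v : 0 <= v ->
  [/\ (region_index v < 2 * N.+1)%N,
    forall c, (c <= N)%N -> (2 * c <= region_index v)%N = (c%:R <= v)
  & forall c, (c <= N)%N -> (2 * c < region_index v)%N = (c%:R < v)].
Proof.
move=> v0; apply: double_index => // [i j ij|i j ij|i|i].
- by apply: le_trans; rewrite ler_nat.
- by apply: le_lt_trans; rewrite ler_nat.
- exact: ltW.
- by apply: lt_le_trans; rewrite ltr_nat.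
Qed.

Lemma region_index_lt v : (region_index v < 2 * N.+1)%N.
Proof.
have := count_size (fun n => n%:R <= v) (iota 0 N.+1).
have := count_size (fun n => n%:R < v) (iota 0 N.+1).
rewrite size_iota /region_index; lia.
Qed.

Lemma index_nnratE q : region_index (nnrat_val R q)%:num = index_nnrat A q.
Proof.
rewrite /region_index /index_nnrat.
by congr (_ + _).-1; apply: eq_count => n /=;
  rewrite ?ler_pdivlMr ?ltr_pdivlMr // -natrM ?ler_nat ?ltr_nat.
Qed.

Lemma region_index_mono v v' : v <= v' -> (region_index v <= region_index v')%N.
Proof.
move=> vv'; rewrite /region_index -!subn1 leq_sub2r // leq_add //;
  apply: sub_count => n /= h;
  [exact: le_trans h vv'|exact: lt_le_trans h vv'].
Qed.

Lemma region_index0 : region_index 0 = 0%N.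
Proof.
have [_ _ h] := region_indexP (lexx 0); have := h 0%N isT.
by rewrite ltxx lt0n => /negbFE /eqP.
Qed.

Lemma region_index_eq0 v : 0 <= v -> (region_index v == 0%N) = (v == 0).
Proof.
move=> v0; have [_ _ h] := region_indexP v0; have := h 0%N isT.
by rewrite lt0n lt_neqAle v0 andbT [_ == v]eq_sym => /negb_inj.
Qed.

Lemma region_index_top v : 0 <= v ->
  (region_index v == (2 * N).+1) = (N%:R < v).
Proof.
move=> v0; have [h _ <-] := region_indexP v0 => //.
by move: h; lia.
Qed.

Lemma guard_atom c n v : 0 <= v -> (n <= N)%N ->
  eval_cmp c v n%:R = cmp_index (nat_of_cmp c) (region_index v) (2 * n).
Proof.
move=> v0 nN; have [_ hle hlt] := region_indexP v0.
rewrite /cmp_index; case: c => /=; rewrite ?orbF.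
- by rewrite ltNge -hle // -ltnNge.
- by rewrite leNgt -hlt // -leqNgt.
- by rewrite eq_le leNgt -hlt // -hle // -leqNgt eqn_leq.
- by rewrite hle.
- by rewrite hlt.
Qed.

End RegionIndex.

Section OneClock.
Variables (R : realType) (L X : finType) (l0 : L) (A : sta R X l0).
Variables (x0 : X) (allx0 : forall x : X, x = x0).
Local Notation N := (max_const A).
Local Notation E := (finmap.enum_fset (edges A)).
Local Notation idx := (region_index A).
Local Notation cfg := (config R X l0).

Definition clock (c : cfg) : R := (c.2 x0)%:num.

Lemma clock_ge0 c : 0 <= clock c. Proof. rewrite /clock; exact: ge0. Qed.

Definition cell_of (c : cfg) : cell A := (c.1, Ordinal (region_index_lt A (clock c))).

Definition cell_set (s : cell A) : set cfg := [set c | cell_of c = s].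

Lemma const_le_max e a : e \in E -> a \in grd e -> (a.2 <= N)%N.
Proof.
move=> eA ae; apply: leq_trans (leq_bigmax_seq _ eA isT).
exact: (leq_bigmax_seq _ ae isT).
Qed.

Lemma sat_index e (nu : valuation R X) : e \in E ->
  sat nu (grd e) = guard_index (grd e) (idx (nu x0)%:num).
Proof.
move=> eA; apply: eq_in_all => a ae /=.
by rewrite (allx0 a.1.1) (guard_atom (A := A)) ?ge0 //; exact: const_le_max ae.
Qed.

Lemma int_of_floor (c : R) (m : nat) : Num.floor c = m%:Z ->
  m%:R <= c -> (c \is a Num.int) = ~~ (m%:R < c).
Proof. by move=> cm mc; rewrite Num.Theory.intrEfloor cm lt_neqAle mc andbT negbK. Qed.

Lemma floor_index (a b : R) : 0 <= a -> 0 <= b -> a <= N%:R -> idx a = idx b ->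
  [/\ Num.floor a = (Num.truncn a)%:Z, Num.floor b = (Num.truncn a)%:Z &
     (a \is a Num.int) = (b \is a Num.int)].
Proof.
move=> a0 b0 aN ab.
have [_ lea lta] := region_indexP A a0; have [_ leb ltb] := region_indexP A b0.
have /andP[ma am] := truncn_itv a0; set m := Num.truncn a in ma am *.
have mN : (m <= N)%N by rewrite -(ler_nat R) (le_trans ma).
have mb : m%:R <= b by rewrite -leb // -ab lea.
have bm : b < m.+1%:R.
  have [mN'|] := ltnP m N; first by rewrite ltNge -leb // -ab lea // -ltNge.
  (* In the last region below the bound, [a <= N] makes the common index at most [2 N], whence
     [b <= N]. *)
  move=> Nm; apply: (@le_lt_trans _ _ N%:R); last by rewrite ltr_nat.
  by rewrite leNgt -ltb // -ab lta // -leNgt.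
have fl c : m%:R <= c -> c < m.+1%:R -> Num.floor c = m%:Z.
  move=> mc cm; apply: floor_def; rewrite -[_ + 1]/(Posz (m + 1)) addn1.
  by apply/andP.
rewrite !fl //; split=> //.
by rewrite !(@int_of_floor _ m) ?fl // -lta // -ltb // ab.
Qed.

(** Floor and integrality of a value determine how it compares to every integer, and the comparisons
    to the integers up to [N] determine them in return for values at most [N]. *)
Lemma region_equivE (nu nu' : valuation R X) :
  region_equiv A nu nu' <-> idx (nu x0)%:num = idx (nu' x0)%:num.
Proof.
set a := (nu x0)%:num; set b := (nu' x0)%:num.
have a0 : 0 <= a by rewrite /a; exact: ge0.
have b0 : 0 <= b by rewrite /b; exact: ge0.
split=> [[/(_ x0) + _]|ab].
  rewrite -/a -/b => -[[Na Nb]|[fl it]].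
    by transitivity (2 * N).+1; [|symmetry]; apply/eqP; rewrite region_index_top.
  have le n : (n%:R <= a) = (n%:R <= b).
    by rewrite -[n%:R]/((n%:Z)%:~R) -!floor_ge_int fl.
  have lt n : (n%:R < a) = (n%:R < b).
    rewrite !lt_neqAle le; congr (_ && _).
    have h (c d : R) : Num.floor c = Num.floor d ->
        (c \is a Num.int -> d \is a Num.int) -> n%:R == c -> n%:R == d.
      move=> cd ci /eqP nc; have cint : c \is a Num.int.
        by rewrite -nc -[n%:R]/((n%:Z)%:~R) intr_int.
      by rewrite nc -(floorK cint) cd floorK // ci.
    by congr (~~ _); apply/idP/idP; apply: h => // /it.
  by rewrite /region_index; congr (_ + _).-1; apply: eq_count => n.
split=> [x|x y _ _]; last by rewrite (allx0 x) (allx0 y) !lexx.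
rewrite (allx0 x) -/a -/b.
have [aN|Na] := leP a N%:R; last first.
  by left; split=> //; rewrite -region_index_top // -ab region_index_top.
by right; have [-> -> ->] := floor_index a0 b0 aN ab.
Qed.

End OneClock.

(** * Delays and kernel *)

(** The integral of a nonnegative function is a supremum over the simple
    functions below it; stating its monotonicity without measurability avoids
    proving that the kernel is measurable. *)
Section NonnegativeIntegral.
Context d (T : measurableType d) (R : realType).
Variables (m : {measure set T -> \bar R}) (D : set T).
Implicit Types f g : T -> \bar R.

Lemma le_integral_nonmeasurable f g :
  (forall x, D x -> 0 <= f x)%E -> (forall x, D x -> f x <= g x)%E ->
  (\int[m]_(x in D) f x <= \int[m]_(x in D) g x)%E.
Proof.
move=> f0 fg; rewrite !(integral_mkcond D).
have f0' x : (0 <= (f \_ D) x)%E by apply: erestrict_ge0.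
have fg' x : ((f \_ D) x <= (g \_ D) x)%E by apply: lee_restrict.
rewrite !ge0_integralTE //; last by move=> x; apply: le_trans (fg' x).
apply: le_ereal_sup => _ [h /= hf <-]; exists h => //= x.
exact: le_trans (hf x) (fg' x).
Qed.

Lemma integral_ge_cst f (c : R) : measurable D -> 0 <= c ->
  (forall x, D x -> c%:E <= f x)%E -> (c%:E * m D <= \int[m]_(x in D) f x)%E.
Proof.
move=> mD c0 cf; rewrite -integral_cst //.
by apply: le_integral_nonmeasurable => // x _; rewrite lee_fin.
Qed.

Lemma integral_ge_subset f (c : R) (J : set T) :
  measurable D -> measurable J -> 0 <= c -> J `<=` D ->
  (forall x, D x -> 0 <= f x)%E -> (forall x, J x -> c%:E <= f x)%E ->
  (c%:E * m J <= \int[m]_(x in D) f x)%E.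
Proof.
move=> mD mJ c0 JD f0 cf.
apply: (@le_trans _ _ (\int[m]_(x in D) (c * \1_J x)%:E)%E).
  under eq_integral do rewrite EFinM.
  rewrite ge0_integralZl ?lee_fin //.
  - by rewrite integral_indic // setIC (setIidr JD).
  - by apply/measurable_EFinP; exact: measurable_indic.
apply: le_integral_nonmeasurable => x Dx.
  by rewrite lee_fin mulr_ge0.
rewrite indicE; case: (boolP (x \in J)) => xJ.
  by rewrite mulr1 cf //; rewrite inE in xJ.
by rewrite mulr0 f0.
Qed.

Lemma integral_null f (J : set T) :
  measurable D -> measurable J -> m J = 0%E ->
  (forall x, D x -> 0 <= f x <= 1)%E -> (forall x, D x -> ~ J x -> f x = 0%E) ->
  (\int[m]_(x in D) f x = 0)%E.
Proof.
move=> mD mJ J0 f01 fJ; apply/eqP; rewrite eq_le integral_ge0 ?andbT; last first.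
  by move=> x /f01 /andP[].
apply: (@le_trans _ _ (\int[m]_(x in D) (\1_J x)%:E)%E).
  apply: le_integral_nonmeasurable => x Dx; first by have /andP[] := f01 x Dx.
  rewrite indicE; case: (boolP (x \in J)) => xJ.
    by have /andP[] := f01 x Dx.
    by rewrite fJ // => /mem_set xJ1; rewrite xJ1 in xJ.
rewrite integral_indic // -J0; apply: le_measure; rewrite ?inE //.
exact: measurableI.
Qed.

End NonnegativeIntegral.

Section OneClockDelays.
Variables (R : realType) (L X : finType) (l0 : L) (A : sta R X l0).
Variables (x0 : X) (allx0 : forall x : X, x = x0).
Local Notation N := (max_const A).
Local Notation E := (finmap.enum_fset (edges A)).
Local Notation idx := (region_index A).
Local Notation cfg := (config R X l0).
Local Notation clock := (@clock R L X l0 x0).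
Local Notation cell_set := (@cell_set R L X l0 A x0).

Lemma measurable_clock (B : set (measurableTypeR R)) :
  measurable B -> measurable [set c : cfg | B (clock c)].
Proof. by move=> mB; apply: sub_gen_smallest; right; exists x0; exists B. Qed.

Lemma measurable_loc l : measurable [set c : cfg | c.1 = l].
Proof. by apply: sub_gen_smallest; left; exists l. Qed.

(** The index is monotone, so [k <= idx v] defines a half-line, open for odd [k] and closed for even
    [k]; level sets are differences of consecutive half-lines. *)
Lemma measurable_index (p : pred nat) :
  measurable ([set v | 0 <= v /\ p (idx v)] : set (measurableTypeR R)).
Proof.
have ge k : measurable ([set v | 0 <= v /\ (k <= idx v)%N] : set (measurableTypeR R)).
  have [kN|Nk] := ltnP k (2 * N.+1)%N; last first.
    rewrite (_ : [set v | _] = set0); first exact: measurable0.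
    apply/seteqP; split=> // v [_ kv].
    by have := leq_trans Nk kv; rewrite leqNgt region_index_lt.
  rewrite (_ : [set v | _] = `[0, +oo[%classic `&`
      (if odd k then `](k./2)%:R, +oo[%classic else `[(k./2)%:R, +oo[%classic)).
    by apply: measurableI => //; case: ifP.
  have k2 : (k./2 <= N)%N by lia.
  apply/seteqP; split=> v /=; rewrite in_itv /= andbT.
    move=> [v0]; have [_ hle hlt] := region_indexP A v0.
    rewrite v0 -{1}(odd_double_half k) -mul2n; case: (odd k) => /=.
      by rewrite add1n hlt // in_itv /= andbT.
    by rewrite add0n hle // in_itv /= andbT.
  move=> [v0]; have [_ hle hlt] := region_indexP A v0 => kv; split=> //; move: kv.
  rewrite -{4}(odd_double_half k) -mul2n; case: (odd k) => /=.
    by rewrite add1n hlt // in_itv /= andbT.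
  by rewrite add0n hle // in_itv /= andbT.
rewrite (_ : [set v | _] = \bigcup_(k in [set k | p k])
    ([set v | 0 <= v /\ (k <= idx v)%N] `\` [set v | 0 <= v /\ (k.+1 <= idx v)%N])).
  by apply: bigcup_measurable => k _; apply: measurableD.
apply/seteqP; split=> v /=.
  by move=> [v0 pv]; exists (idx v) => //=; split=> //; rewrite ltnn => -[].
move=> [k /= pk [[v0 kv] kv']]; split=> //.
suff -> : idx v = k by [].
apply/eqP; rewrite eqn_leq kv andbT leqNgt; apply/negP => kv''.
exact: kv'.
Qed.

Lemma cell_setE s : cell_set s =
  [set c | c.1 = s.1] `&` [set c | 0 <= clock c /\ idx (clock c) == s.2 :> nat].
Proof.
case: s => l k; apply/seteqP; split=> c /=.
  by move=> [<- <-] /=; split=> //; split=> //; exact: clock_ge0.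
by move=> [<- [_ /eqP ck]]; congr pair; apply: val_inj.
Qed.

Lemma measurable_cell_set s : measurable (cell_set s).
Proof.
rewrite cell_setE; apply: measurableI; first exact: measurable_loc.
exact: measurable_clock (measurable_index (fun k => k == s.2 :> nat)).
Qed.

Definition delay_set (v : R) (p : pred nat) : set (measurableTypeR R) :=
  [set t | 0 <= t /\ p (idx (v + t))].

Lemma measurable_delay_set v p : 0 <= v -> measurable (delay_set v p).
Proof.
move=> v0; rewrite (_ : delay_set v p = `[0, +oo[ `&`
    (fun t => v + t) @^-1` [set u | 0 <= u /\ p (idx u)]).
  apply: measurableI => //; rewrite -[X in measurable X]setTI.
  by apply: measurable_funD => //; exact: measurable_index.
apply/seteqP; split=> t /=; rewrite in_itv /= andbT => -[t0].
  by split=> //; split=> //; exact: addr_ge0.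
by move=> [].
Qed.

Lemma delaysE (c : cfg) : delays (edges A) c = delay_set (clock c)
  (fun k => has (fun e => (src e == c.1) && guard_index (grd e) k) E).
Proof.
apply/seteqP; split=> t /=.
  move=> [e eA [ec [t0]]]; rewrite (sat_index (A := A) allx0) // => ge.
  split=> //; apply/hasP; exists e => //; rewrite ec eqxx /=.
  by move: ge; rewrite /elapse /= ger0_norm.
move=> [t0 /hasP[e eA /andP[/eqP ec ge]]]; exists e => //; split=> //; split=> //.
by rewrite (sat_index (A := A) allx0) // /elapse /= ger0_norm.
Qed.

Lemma exists_unbounded_edge l :
  exists2 e, e \in E & src e = l /\ guard_index (grd e) (2 * N).+1.
Proof.
pose c : cfg := (l, fun=> nnrat_val R (N.+1, 0%N)).
have cN : clock c = N.+1%:R by rewrite /clock /= divr1.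
have [t] : exists t, delays (edges A) c t.
  have [|D0] := ltP 0%E (@lebesgue_measure R (delays (edges A) c)).
    move=> D0; apply/set0P; apply: contraTneq D0 => ->.
    by rewrite measure0 ltxx.
  have {}D0 : @lebesgue_measure R (delays (edges A) c) = 0%E.
    by apply/eqP; rewrite eq_le D0 measure_ge0.
  have [D1 _] := delay_uniform D0.
  apply/set0P; apply/eqP => D2; move: D1; rewrite D2 measure0 => /eqP.
  by rewrite eq_sym onee_eq0.
rewrite delaysE => -[t0 /hasP[e eA /andP[/eqP ec ge]]]; exists e => //; split=> //.
move: ge; suff /eqP -> : idx (clock c + t) == (2 * N).+1 by [].
rewrite region_index_top ?addr_ge0 ?cN //.
by apply: (@lt_le_trans _ _ N.+1%:R); rewrite ?ltr_nat // lerDl.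
Qed.

(** Every delay in [[N + 1, N + 2]] brings the clock above [N], where an unbounded edge is enabled.
    Hence [delay_equiv] applies at every configuration. *)
Lemma lebesgue_delays_gt0 (c : cfg) : (0 < @lebesgue_measure R (delays (edges A) c))%E.
Proof.
have [e eA [ec ge]] := exists_unbounded_edge c.1.
have mD : measurable (delays (edges A) c : set (measurableTypeR R)).
  by rewrite delaysE; apply: measurable_delay_set; exact: clock_ge0.
apply: (@lt_le_trans _ _ (@lebesgue_measure R `[N.+1%:R, N.+2%:R])).
  by rewrite lebesgue_measure_itv /= lte_fin ltr_nat ltnSn -EFinB lte_fin subr_gt0 ltr_nat.
apply: le_measure; rewrite ?inE //.
move=> t /=; rewrite in_itv /= => /andP[Nt _]; rewrite delaysE.
have t0 : 0 <= t by apply: le_trans Nt.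
split=> //; apply/hasP; exists e => //; rewrite ec eqxx /=.
rewrite (eqP (_ : idx _ == (2 * N).+1)) // region_index_top ?addr_ge0 ?clock_ge0 //.
apply: (@lt_le_trans _ _ N.+1%:R); first by rewrite ltr_nat.
by rewrite (le_trans Nt) // lerDr clock_ge0.
Qed.

Lemma delay_itv_gt0 (c : cfg) e (a b : R) : e \in E -> src e = c.1 -> a < b ->
  (forall t, a <= t <= b -> 0 <= t /\ guard_index (grd e) (idx (clock c + t))) ->
  (0 < delay A c `[a, b]%classic)%E.
Proof.
move=> eA ec ab h; rewrite lt0e measure_ge0 andbT; apply/eqP.
rewrite (delay_equiv (lebesgue_delays_gt0 c)) //.
rewrite setIidl; last first.
  move=> t /=; rewrite in_itv /= delaysE => /h[t0 ge].
  by split=> //; apply/hasP; exists e => //; rewrite ec eqxx.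
rewrite lebesgue_measure_itv /= lte_fin ab -EFinB => /eqP.
by rewrite eqe subr_eq0 gt_eqF.
Qed.

Lemma delay_countable (c : cfg) (B : set (measurableTypeR R)) :
  countable B -> delay A c B = 0%E.
Proof.
move=> cB; have mB : measurable B by exact: countable_measurable.
rewrite (delay_equiv (lebesgue_delays_gt0 c)) //.
by apply: countable_lebesgue_measure0; apply: sub_countable cB; exact: subset_card_le.
Qed.

Lemma delay_negative (c : cfg) : delay A c [set t | t < 0] = 0%E.
Proof.
have mB : measurable ([set t | t < 0] : set (measurableTypeR R)).
  by rewrite (_ : [set t | _] = `]-oo, 0[%classic) //; apply/seteqP; split=> t /=; rewrite in_itv.
rewrite (delay_equiv (lebesgue_delays_gt0 c)) // delaysE.
rewrite (_ : _ `&` _ = set0) ?measure0 //.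
by apply/seteqP; split=> // t /= [t0 [t0' _]]; move: t0; rewrite ltNge t0'.
Qed.

Lemma delay_nonneg (c : cfg) : delay A c `[0, +oo[%classic = 1%E.
Proof.
have mB : measurable ([set t | t < 0] : set (measurableTypeR R)).
  by rewrite (_ : [set t | _] = `]-oo, 0[%classic) //; apply/seteqP; split=> t /=; rewrite in_itv.
rewrite (_ : `[0, +oo[%classic = ~` [set t | t < 0]).
  by rewrite probability_setC // delay_negative sube0.
by apply/seteqP; split=> t /=; rewrite in_itv /= andbT leNgt => /negP.
Qed.

End OneClockDelays.

Section KernelBounds.
Variables (R : realType) (L X : finType) (l0 : L) (A : sta R X l0).
Variables (x0 : X) (allx0 : forall x : X, x = x0).
Local Notation N := (max_const A).
Local Notation E := (finmap.enum_fset (edges A)).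
Local Notation idx := (region_index A).
Local Notation cfg := (config R X l0).
Local Notation clock := (@clock R L X l0 x0).
Local Notation cell_set := (@cell_set R L X l0 A x0).

Definition move (c : cfg) (t : R) (e : edge L X) : cfg :=
  (tgt e, reset (rst e) (elapse c.2 t)).

Definition total_weight : nat := \sum_(e <- E) weight A e.

Lemma weightP e : e \in E -> (0 < weight A e <= total_weight)%N.
Proof.
move=> eA; rewrite (weight_gt0 eA) /=.
by rewrite /total_weight (big_rem e) //= leq_addr.
Qed.

Lemma edge_prob_ge0 c e : 0 <= edge_prob A c e.
Proof. by rewrite /edge_prob; case: ifP => // _; rewrite divr_ge0. Qed.

(** Weights are positive integers: the numerator is at least [1] and the denominator at most the
    total weight, uniformly in the configuration. *)
Lemma edge_probP c e : e \in E -> enabled c e ->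
  total_weight%:R^-1 <= edge_prob A c e <= 1.
Proof.
move=> eA ce; rewrite /edge_prob ce.
have /andP[w0 _] := weightP eA.
set S := (X in _ / X%:R).
have wS : (weight A e <= S)%N by rewrite /S (big_rem e) //= ce leq_addr.
have SW : (S <= total_weight)%N.
  by rewrite /S big_mkcond /=; apply: leq_sum => e' _; case: ifP.
have S0 : 0 < S%:R :> R by rewrite ltr0n (leq_trans w0).
rewrite ler_pdivlMr // mulrC -ler_pdivlMr ?invr_gt0 ?ltr0n ?(leq_trans _ SW) //;
  last exact: leq_trans w0 wS.
rewrite invrK ler_pdivrMr // mul1r ler_nat wS andbT.
by rewrite -natrM ler_nat (leq_trans SW) // leq_pmull.
Qed.

Lemma edge_prob_le1 c e : e \in E -> edge_prob A c e <= 1.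
Proof.
move=> eA; have [ce|ce] := boolP (enabled c e).
  by have /andP[] := edge_probP eA ce.
by rewrite /edge_prob (negbTE ce).
Qed.

Lemma integrand01 (B : set cfg) c e t : e \in E ->
  (0 <= (\1_B (move c t e) * edge_prob A (elapsec c t) e)%:E <= 1)%E.
Proof.
move=> eA; rewrite !lee_fin mulr_ge0 ?edge_prob_ge0 //=.
by rewrite mulr_ile1 ?edge_prob_ge0 ?edge_prob_le1 // indicE lern1 leq_b1.
Qed.

Lemma measurable_nonneg : measurable ([set t | 0 <= t] : set (measurableTypeR R)).
Proof.
rewrite (_ : [set t | _] = `[0, +oo[%classic) //.
by apply/seteqP; split=> t /=; rewrite in_itv /= andbT.
Qed.

(** Keeps only the term of [e] in the kernel, and in its integral only the delays in [J]. *)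
Lemma kernel_ge (c : cfg) e B (J : set (measurableTypeR R)) :
  e \in E -> src e = c.1 -> measurable J ->
  (forall t : R, J t -> [/\ 0 <= t, sat (elapse c.2 t) (grd e) & B (move c t e)]) ->
  (total_weight%:R^-1%:E * delay A c J <= kernel_sta A c B)%E.
Proof.
move=> eA ec mJ hJ; rewrite /kernel_sta (big_rem e) //= ec eqxx.
have ge0 e' : e' \in E -> (0 <= \int[delay A c]_(d in [set d : measurableTypeR R | (0 <= d)%R])
      (\1_B (move c d e') * edge_prob A (elapsec c d) e')%:E)%E.
  by move=> e'A; apply: integral_ge0 => t _; have /andP[] := integrand01 B c t e'A.
apply: (@le_trans _ _ (\int[delay A c]_(d in [set d : measurableTypeR R | (0 <= d)%R])
      (\1_B (move c d e) * edge_prob A (elapsec c d) e)%:E)%E); last first.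
  rewrite leeDl // big_seq_cond; apply: sume_ge0 => e' /andP[/mem_rem e'A _].
  exact: ge0.
apply: integral_ge_subset => //.
- exact: measurable_nonneg.
- by move=> t /hJ[].
- by move=> t _; have /andP[] := integrand01 B c t eA.
move=> t /hJ[t0 ge Be]; rewrite indicE mem_set // mul1r lee_fin.
have ce : enabled (elapsec c t) e by rewrite /enabled ec eqxx.
by have /andP[] := edge_probP eA ce.
Qed.

Lemma kernel_eq0 (c : cfg) B (J : set (measurableTypeR R)) : measurable J -> delay A c J = 0%E ->
  (forall e (t : R), e \in E -> src e = c.1 -> 0 <= t -> sat (elapse c.2 t) (grd e) ->
     B (move c t e) -> J t) ->
  kernel_sta A c B = 0%E.
Proof.
move=> mJ J0 hJ; rewrite /kernel_sta big_seq_cond big1 // => e /andP[eA /eqP ec].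
apply: (@integral_null _ _ _ _ _ _ J) => //.
- exact: measurable_nonneg.
- by move=> t _; exact: integrand01.
move=> t t0 nJ; rewrite /edge_prob; case: ifP => [/andP[_ ge]|]; last by rewrite mulr0.
rewrite indicE memNset ?mul0r // => Be.
exact/nJ/(hJ e).
Qed.

Lemma clock_move c t e : 0 <= t ->
  clock (move c t e) = if rst e == finset.set0 then clock c + t else 0.
Proof.
move=> t0; rewrite /clock /move /= /reset.
have -> : (rst e == finset.set0) = (x0 \notin rst e).
  apply/eqP/idP => [->|x0e]; first by rewrite finset.inE.
  by apply/finset.setP => x; rewrite (allx0 x) finset.inE; exact: negbTE.
by case: (x0 \in rst e) => //=; rewrite ger0_norm.
Qed.

(** A move that follows no thick edge is taken at an even index, that is, at an integer clock value.
    The corresponding delays form a countable set, which is null. *)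
Lemma kernel_not_thick c s s' : cell_set s c -> ~~ thick s s' ->
  kernel_sta A c (cell_set s') = 0%E.
Proof.
move=> cs nss'.
pose J : set (measurableTypeR R) := range (fun n : nat => n%:R - clock c).
have cJ : countable J by exact: sub_countable (card_image_le _ _) (countableP _).
apply: (@kernel_eq0 _ _ J); first exact: countable_measurable.
  exact: delay_countable.
move=> e t eA ec t0 ge Be.
have ct0 : 0 <= clock c + t by rewrite addr_ge0 ?clock_ge0.
have ge' : guard_index (grd e) (idx (clock c + t)).
  by move: ge; rewrite (sat_index (A := A) allx0) // /elapse /= ger0_norm.
have [kN hle hlt] := region_indexP A ct0.
have [ok|ek] := boolP (odd (idx (clock c + t))); last first.
  have kE : idx (clock c + t) = (2 * (idx (clock c + t))./2)%N by lia.
  have iN : ((idx (clock c + t))./2 <= N)%N by lia.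
  exists (idx (clock c + t))./2 => //=; apply/eqP; rewrite subr_eq [t + _]addrC.
  rewrite eq_le -hle // -kE leqnn /= leNgt -hlt // -leqNgt.
  by rewrite [X in (X <= _)%N]kE.
case/negP: nss'; apply/hasP; exists e => //.
apply/and3P; split; [by rewrite -cs ec|by rewrite -Be|apply/hasP].
exists (idx (clock c + t))./2.
  by rewrite mem_iota; lia.
have -> : (2 * (idx (clock c + t))./2).+1 = idx (clock c + t) by lia.
rewrite -Be -cs /= ge' region_index_mono ?lerDl //= clock_move //.
by case: ifP => re; rewrite ?re ?region_index0.
Qed.

End KernelBounds.

(** * Continuity and compactness *)

Section UniformLowerBound.
Variables (R : realType) (L X : finType) (l0 : L) (A : sta R X l0).
Variables (x0 : X) (allx0 : forall x : X, x = x0).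
Hypothesis continuousA : delay_continuous A.
Local Notation E := (finmap.enum_fset (edges A)).
Local Notation idx := (region_index A).
Local Notation cfg := (config R X l0).
Local Notation clock := (@clock R L X l0 x0).

(** The absolute value makes this a continuous function on all of [R], so that the extreme value
    theorem applies; it changes nothing at clock values. *)
Definition const_valuation (v : R) : valuation R X := fun=> `|v|%:nng.

Lemma const_valuationE (c : cfg) : c = (c.1, const_valuation (clock c)).
Proof.
case: c => l nu; congr pair; apply/funext => x; rewrite (allx0 x).
by apply/val_inj => /=; rewrite ger0_norm // clock_ge0.
Qed.

Lemma continuous_const_valuation :
  continuous (const_valuation : R -> initial_topology (@valuation_fun R X)).
Proof.
apply: continuous_comp_initial => v; apply/cvg_sup => i U [V] [[W] oW <-] WfN WU.
apply: filterS WU _; apply: (@norm_continuous _ R^o); exact: open_nbhs_nbhs.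
Qed.

Lemma continuous_delay (l : L) (a b : R) : 0 <= a -> a <= b ->
  continuous (fun v : R => fine (delay A (l, const_valuation v) `[a, b]%classic)).
Proof.
move=> a0 ab v.
apply: (@continuous_comp R (initial_topology (@valuation_fun R X)) R
  const_valuation (fun nu => fine (delay A (l, nu) `[a, b]%classic))).
  exact: continuous_const_valuation.
exact: continuousA.
Qed.

Section Window.
Variables (e : edge L X) (a' b' : R).
Hypotheses (eA : e \in E) (ab' : a' < b').
Hypothesis window : forall u, a' <= u <= b' -> guard_index (grd e) (idx u).

Let hit (c : cfg) : set R := `[a' - clock c, b' - clock c]%classic.

(** If [a, b] is shorter than [a', b'], the fixed delay interval
    [a' - a, b' - b] leads from each point of [a, b] into [a', b']. *)
Lemma uniform_hit_short (a b : R) : 0 <= a -> a <= b -> b < a' -> b - a < b' - a' ->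
  exists2 eta : R, 0 < eta & forall c : cfg, c.1 = src e -> a <= clock c <= b ->
    (eta%:E <= delay A c (hit c))%E.
Proof.
have a'b' := ab'; move=> a0 ab ba' short.
have J0 : 0 <= a' - a by lra.
have J1 : a' - a <= b' - b by lra.
pose g (v : R) := fine (delay A (src e, const_valuation v) `[a' - a, b' - b]%classic).
have cg : {within `[a, b], continuous g}.
  by apply: continuous_subspaceT => v; exact: continuous_delay.
have [m /andP[am mb] gm] := EVT_min ab cg.
have m0 : 0 <= m by rewrite (le_trans a0).
pose c0 : cfg := (src e, const_valuation m).
have c0m : clock c0 = m by rewrite /clock /= ger0_norm.
exists (g m).
  rewrite fine_gt0 // (delay_itv_gt0 (A := A) (x0 := x0) allx0 eA) //=; first last.
  - move=> t tJ; rewrite -/c0 c0m; split; first lra.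
    by apply: window; rewrite !bnd_simp in am mb; lra.
  - lra.
  - by rewrite (le_lt_trans (probability_le1 _ _)) // ltry.
move=> c ce cab; rewrite [c in delay A c _]const_valuationE ce.
apply: (@le_trans _ _ (delay A (src e, const_valuation (clock c)) `[a' - a, b' - b]%classic)).
  rewrite -[leRHS]fineK ?lee_fin; last exact: fin_num_measure.
  by apply: gm; rewrite in_itv.
apply: le_measure; rewrite ?inE //.
  exact: measurable_itv.
move=> t; rewrite /hit /= !in_itv /=; lra.
Qed.

(** A longer [[a, b]] is cut into finitely many intervals of length [h], and the least of their
    bounds is taken. Half the window length makes [h] strictly shorter than the window, as
    [uniform_hit_short] demands. *)
Lemma uniform_hit (a b : R) : 0 <= a -> a <= b -> b < a' ->
  exists2 eta : R, 0 < eta & forall c : cfg, c.1 = src e -> a <= clock c <= b ->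
    (eta%:E <= delay A c (hit c))%E.
Proof.
have a'b' := ab'; move=> a0 ab ba'; pose h := (b' - a') / 2.
have h0 : 0 < h by rewrite /h divr_gt0 // subr_gt0.
have [n nh] : exists n : nat, b - a <= n%:R * h.
  exists (Num.truncn ((b - a) / h)).+1.
  by rewrite -ler_pdivrMr // ltW // truncnS_gt.
elim: n a a0 ab nh => [|n IH] a a0 ab nh.
  by rewrite mul0r in nh; apply: uniform_hit_short => //; lra.
have [bah|bah] := leP (b - a) h.
  by apply: uniform_hit_short => //; rewrite /h in h0 bah; lra.
have [e1 e10 h1] : exists2 eta : R, 0 < eta & forall c : cfg, c.1 = src e ->
    a <= clock c <= a + h -> (eta%:E <= delay A c (hit c))%E.
  by apply: uniform_hit_short => //; rewrite /h in h0 bah *; lra.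
have [e2 e20 h2] : exists2 eta : R, 0 < eta & forall c : cfg, c.1 = src e ->
    a + h <= clock c <= b -> (eta%:E <= delay A c (hit c))%E.
  by apply: IH; rewrite -natr1 mulrDl mul1r in nh; lra.
exists (Num.min e1 e2); first by rewrite lt_min e10.
move=> c ce /andP[ac cb]; have [cah|ahc] := leP (clock c) (a + h).
  by apply: (le_trans _ (h1 c ce _)); rewrite ?lee_fin ?ge_min ?lexx // ac.
by apply: (le_trans _ (h2 c ce _)); rewrite ?lee_fin ?ge_min ?lexx ?orbT // (ltW ahc).
Qed.

End Window.
End UniformLowerBound.

(** * Uniform lower bounds *)

Section Pieces.
Variables (R : realType) (L X : finType) (l0 : L) (A : sta R X l0).
Variables (x0 : X) (allx0 : forall x : X, x = x0).
Hypothesis continuousA : delay_continuous A.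
Local Notation N := (max_const A).
Local Notation E := (finmap.enum_fset (edges A)).
Local Notation idx := (region_index A).
Local Notation cfg := (config R X l0).
Local Notation clock := (@clock R L X l0 x0).
Local Notation cell_of := (@cell_of R L X l0 A x0).
Local Notation cell_set := (@cell_set R L X l0 A x0).
Local Notation W := (total_weight A).

Definition band (l : L) (a b : R) : set cfg := [set c | c.1 = l /\ a <= clock c <= b].

(** Sets of configurations from which the thick edges of their cell have
    probabilities bounded away from zero. *)
Definition piece (s : cell A) (K : set cfg) : Prop :=
  (s.2 = (2 * N).+1 :> nat /\ K = cell_set s) \/
  (exists a b : R, [/\ 0 <= a, a <= b, b <= N%:R,
     idx a = s.2 /\ idx b = s.2 & K = band s.1 a b]).

Lemma measurable_band l a b : measurable (band l a b).
Proof.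
rewrite (_ : band l a b = [set c | c.1 = l] `&` [set c | `[a, b]%classic (clock c)]).
  apply: measurableI; first exact: measurable_loc.
  by apply: measurable_clock; exact: measurable_itv.
by apply/seteqP; split=> c /=; rewrite in_itv.
Qed.

Lemma piece_measurable s K : piece s K -> measurable K.
Proof.
case=> [[_ ->]|[a [b [_ _ _ _ ->]]]]; first exact: measurable_cell_set.
exact: measurable_band.
Qed.

Lemma piece_sub s K : piece s K -> K `<=` cell_set s.
Proof.
case=> [[_ ->] //|[a [b [a0 ab bN [ia ib] ->]]]] c [cl /andP[ac cb]].
rewrite cell_setE; split=> //; split; first exact: clock_ge0.
by rewrite eqn_leq -{1}ib -ia !region_index_mono.
Qed.

Lemma weight_gt0R e : e \in E -> 0 < W%:R^-1 :> R.
Proof.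
by move=> /weightP/andP[w0 wW]; rewrite invr_gt0 ltr0n (leq_trans w0).
Qed.

Lemma idx_odd n (u : R) : (n < N)%N -> n%:R < u -> u < n.+1%:R -> idx u = (2 * n).+1.
Proof.
move=> nN nu un; have u0 : 0 <= u by rewrite ltW // (le_lt_trans _ nu).
have [_ hle hlt] := region_indexP A u0.
have : (2 * n < idx u)%N by rewrite hlt // ltnW.
have : ~~ (2 * n.+1 <= idx u)%N by rewrite hle // -ltNge.
by lia.
Qed.

Lemma idx_top (u : R) : N%:R < u -> idx u = (2 * N).+1.
Proof.
move=> Nu; have u0 : 0 <= u by rewrite ltW // (le_lt_trans _ Nu).
by apply/eqP; rewrite region_index_top.
Qed.

(** Above [N] the guard stays true after any delay, so all the mass of the delay distribution counts
    and only the choice of the edge costs a factor. *)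
Lemma kernel_top e (c : cfg) (B : set cfg) : e \in E -> src e = c.1 ->
  guard_index (grd e) (2 * N).+1 -> N%:R < clock c ->
  (forall t : R, 0 <= t -> B (move c t e)) -> (W%:R^-1%:E <= kernel_sta A c B)%E.
Proof.
move=> eA ec ge Nc hB.
rewrite -[leLHS]mule1 -(delay_nonneg A allx0 c).
apply: (kernel_ge eA ec) => // t /=; rewrite in_itv /= andbT => t0; split=> //.
  rewrite (sat_index (A := A) allx0) // /elapse /= ger0_norm //.
  by rewrite idx_top // (lt_le_trans Nc) // lerDl.
exact: hB.
Qed.

Lemma kernel_window e (a b a' b' : R) : e \in E -> 0 <= a -> a <= b -> b < a' ->
  a' < b' -> (forall u, a' <= u <= b' -> guard_index (grd e) (idx u)) ->
  exists2 eta : R, 0 < eta & forall (c : cfg) (B : set cfg), band (src e) a b c ->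
    (forall t : R, 0 <= t -> a' <= clock c + t <= b' -> B (move c t e)) ->
    (eta%:E <= kernel_sta A c B)%E.
Proof.
move=> eA a0 ab ba' ab' win.
have [eta eta0 h] := uniform_hit allx0 continuousA eA ab' win a0 ab ba'.
exists (W%:R^-1 * eta) => [|c B [ce cab] hB].
  by rewrite mulr_gt0 // (weight_gt0R eA).
have k : (W%:R^-1%:E * delay A c `[(a' - clock c)%R, (b' - clock c)%R]%classic
    <= kernel_sta A c B)%E.
  apply: (kernel_ge eA) => // t /=; rewrite in_itv /= => /andP[t1 t2].
  have t0 : 0 <= t by lra.
  have cab' : a' <= clock c + t <= b' by lra.
  split=> //; last exact: hB.
  by rewrite (sat_index (A := A) allx0) // /elapse /= ger0_norm //; exact: win.
apply: le_trans k; rewrite EFinM; apply: lee_wpmul2l; last exact: h.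
by rewrite lee_fin ltW // (weight_gt0R eA).
Qed.

(** The target of a thick edge need not be hit as a whole. After a reset it is the value [0], above
    [N] the unbounded region, and otherwise a compact window [[a', b']] in the open interval, placed
    beyond [b] so that every configuration of the band can reach it by delaying. *)
Lemma piece_step s s' K : piece s K -> thick s s' ->
  exists2 K', piece s' K' & exists2 eta : R, 0 < eta &
    forall c, K c -> (eta%:E <= kernel_sta A c K')%E.
Proof.
move=> pK; rewrite /thick => /hasP[e eA /and3P[/eqP es /eqP et]].
case/hasP=> n; rewrite mem_iota /= add0n ltnS => nN /and3P[sn gn s'n].
pose dest (n : nat) : set cfg := if rst e == finset.set0 then cell_set s' else band s'.1 0 0.
have zero_piece : rst e != finset.set0 -> piece s' (band s'.1 0 0).
  move=> re; right; exists 0, 0; rewrite (negbTE re) in s'n.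
  by rewrite !lexx region_index0 ler0n (eqP s'n).
have zero_move c t : rst e != finset.set0 -> 0 <= t -> band s'.1 0 0 (move c t e).
  by move=> re t0; split=> //; rewrite (clock_move allx0) // (negbTE re) lexx.
have top_move c t : rst e == finset.set0 -> n = N -> 0 <= t -> N%:R < clock c + t ->
    cell_set s' (move c t e).
  move=> re nN' t0 ct; rewrite cell_setE; split; first by rewrite /= et.
  split; first exact: clock_ge0.
  by rewrite (clock_move allx0) // re idx_top //; rewrite re nN' in s'n; rewrite (eqP s'n).
have top_piece : rst e == finset.set0 -> n = N -> piece s' (cell_set s').
  by move=> re nN'; left; split=> //; rewrite re in s'n; rewrite (eqP s'n) nN'.
case: pK => [[sN ->]|[a [b [a0 ab bN [ia ib] ->]]]].
  have nN' : n = N by rewrite sN in sn; lia.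
  have Ncl c : cell_set s c -> N%:R < clock c.
    move=> cs; have {}cs : cell_of c = s := cs.
    by rewrite -(region_index_top A) ?clock_ge0 // -sN -cs.
  have cl c : cell_set s c -> src e = c.1 by rewrite es => <-.
  rewrite nN' in gn.
  have [re|re] := boolP (rst e == finset.set0).
    exists (cell_set s'); first exact: top_piece.
    exists W%:R^-1 => [|c cs]; first exact: weight_gt0R eA.
    apply: (kernel_top eA) => //; [exact: cl|exact: Ncl|move=> t t0].
    by apply: top_move => //; rewrite (lt_le_trans (Ncl c cs)) // lerDl.
  exists (band s'.1 0 0); first exact: zero_piece.
  exists W%:R^-1 => [|c cs]; first exact: weight_gt0R eA.
  apply: (kernel_top eA) => //; [exact: cl|exact: Ncl|move=> t t0].
  exact: zero_move.
(* For [n < N] the ends trisect the interval between [m], the maximum of [b] and [n], and [n + 1];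
   for [n = N] the window is [[N + 1, N + 2]]. *)
have [a' [b' [ba' ab' iw [na' bn]]]] : exists a' b' : R, [/\ b < a', a' < b',
    (forall u : R, a' <= u <= b' -> idx u = (2 * n).+1)
    & n%:R < a' /\ (n = N \/ (n < N)%N /\ b' < n.+1%:R)].
  have [nN'|] := ltnP n N; last first.
    move=> Nn; have nN' : n = N by lia.
    exists N.+1%:R, N.+2%:R; rewrite nN' !ltr_nat !leqnn; split=> //.
    - by rewrite (le_lt_trans bN) // ltr_nat.
    - by move=> u /andP[Nu _]; apply: idx_top; rewrite (lt_le_trans _ Nu) // ltr_nat.
    - by split=> //; left.
  have b1 : b < n.+1%:R.
    have b0 : 0 <= b by rewrite (le_trans a0).
    have [_ hle _] := region_indexP A b0.
    by rewrite ltNge -hle // ib -ltnNge (leq_ltn_trans sn) // mulnS; lia.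
  have [m [bm nm mn]] : exists m : R, [/\ b <= m, n%:R <= m & m < n.+1%:R].
    have [bn|nb] := leP b n%:R; first by exists n%:R; rewrite bn lexx ltr_nat.
    by exists b; rewrite lexx (ltW nb).
  have [d d0 md] : exists2 d : R, 0 < d & n.+1%:R = m + d.
    by exists (n.+1%:R - m); rewrite ?subr_gt0 // addrC subrK.
  exists (m + d / 3), (m + d / 3 * 2); split; [lra|lra| |].
    by move=> u /andP[u1 u2]; apply: idx_odd => //; rewrite ?md; lra.
  by split; [lra|right; split=> //; rewrite md; lra].
have win u : a' <= u <= b' -> guard_index (grd e) (idx u) by move=> /iw ->.
have [eta eta0 h] := kernel_window eA a0 ab ba' ab' win.
rewrite es in h.
have [re|re] := boolP (rst e == finset.set0); last first.
  exists (band s'.1 0 0); first exact: zero_piece.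
  by exists eta => // c cs; apply: h => // t t0 _; exact: zero_move.
case: bn => [nN'|[nN' bn]].
  exists (cell_set s'); first exact: top_piece.
  exists eta => // c cs; apply: h => // t t0 /andP[ct _]; apply: top_move => //.
  by rewrite -nN' (lt_le_trans na').
have s'E : s'.2 = (2 * n).+1 :> nat by rewrite re in s'n; exact/eqP.
exists (band s'.1 a' b').
  right; exists a', b'; rewrite s'E !iw ?lexx ?(ltW ab') //; split=> //.
    by rewrite (le_trans _ (ltW na')).
  by rewrite (le_trans (ltW bn)) // ler_nat.
exists eta => // c cs; apply: h => // t t0 ctab; split; first by rewrite /= et.
by rewrite (clock_move allx0) // re.
Qed.

End Pieces.

(** * Recurrence *)

Section Law.
Variables (R : realType) (L X : finType) (l0 : L) (A : sta R X l0).
Variables (x0 : X) (allx0 : forall x : X, x = x0).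
Hypothesis continuousA : delay_continuous A.
Variables (mu : probability (config R X l0) R) (P : probability (trajectory R X l0) R).
Hypothesis lawP : trajectory_law A mu P.
Local Notation N := (max_const A).
Local Notation E := (finmap.enum_fset (edges A)).
Local Notation idx := (region_index A).
Local Notation cfg := (config R X l0).
Local Notation traj := (trajectory R X l0).
Local Notation clock := (@clock R L X l0 x0).
Local Notation cell_of := (@cell_of R L X l0 A x0).
Local Notation cell_set := (@cell_set R L X l0 A x0).
Local Notation W := (total_weight A).

Definition recurrent_cell (s : cell A) : bool :=
  (s.2 == 0%N :> nat) || (s.2 == (2 * N).+1 :> nat).

(** A recurrent cell is a piece in its entirety, so [path_lower] applies from each of its
    configurations. *)
Lemma recurrent_piece s : recurrent_cell s -> piece x0 s (cell_set s).
Proof.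
move=> /orP[/eqP s0|/eqP sN]; last by left.
right; exists 0, 0; rewrite !lexx region_index0 ler0n s0; split=> //.
rewrite cell_setE; apply/seteqP; split=> c [cl h]; split=> //.
  by move: h; rewrite /= s0 region_index_eq0 ?clock_ge0 // => -[_ /eqP ->]; rewrite lexx.
move: h => /andP[c0 c1]; split; first exact: clock_ge0.
by rewrite /= s0 region_index_eq0 ?clock_ge0 // eq_le c0 c1.
Qed.

Definition recurrent_set : set cfg := [set c | recurrent_cell (cell_of c)].

Lemma measurable_coord n (B : set cfg) :
  measurable B -> measurable [set w : traj | B (w n)].
Proof. by move=> mB; apply: sub_gen_smallest; exists n; exists B. Qed.

Lemma measurable_cell_pred (p : pred (cell A)) : measurable [set c | p (cell_of c)].
Proof.
rewrite (_ : [set c | _] = \bigcup_(s in [set s | p s]) cell_set s).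
  apply: fin_bigcup_measurable => [|s _]; last exact: measurable_cell_set.
  exact: finite_finset.
apply/seteqP; split=> c /=; first by move=> pc; exists (cell_of c).
by move=> [s ps cs]; rewrite (cs : cell_of c = s).
Qed.

Definition past (C : nat -> set cfg) (n : nat) : set traj :=
  [set w | forall i, (i <= n)%N -> C i (w i)].

Lemma measurable_past C n : (forall i, measurable (C i)) -> measurable (past C n).
Proof.
move=> mC; rewrite (_ : past C n = \bigcap_(i in [set i | (i <= n)%N]) [set w | C i (w i)]).
  by apply: bigcap_measurable => [|i _]; [exists 0%N|exact: measurable_coord].
by apply/seteqP; split=> w h i /h.
Qed.

Lemma law_step_ge C n B (eta : R) : (forall i, measurable (C i)) -> measurable B ->
  0 <= eta -> (forall c, C n c -> (eta%:E <= kernel_sta A c B)%E) ->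
  (eta%:E * P (past C n) <= P (past C n `&` [set w | B (w n.+1)]))%E.
Proof.
move=> mC mB eta0 h; have := lawP.2 n C B mC mB; rewrite /= => ->.
apply: integral_ge_cst => //; first exact: measurable_past.
by move=> w /(_ n (leqnn n)); exact: h.
Qed.

Lemma law_step_eq0 C n B : (forall i, measurable (C i)) -> measurable B ->
  (forall c, C n c -> kernel_sta A c B = 0%E) ->
  P (past C n `&` [set w | B (w n.+1)]) = 0%E.
Proof.
move=> mC mB h; have := lawP.2 n C B mC mB; rewrite /= => ->.
apply: integral0_eq => w /(_ n (leqnn n)); exact: h.
Qed.

(** An edge taken above [N] ends there, or at [0] if it resets the clock: both are recurrent. Clocks
    in [[0, N]] aim at the window [[N + 1, N + 2]], larger ones use any delay, and finitely many
    locations leave a positive minimum. *)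
Lemma recurrent_step : exists2 delta : R, 0 < delta &
  forall c, (delta%:E <= kernel_sta A c recurrent_set)%E.
Proof.
have rec_move e c t (t0 : 0 <= t) : N%:R < clock c + t -> recurrent_set (move c t e).
  move=> ct; rewrite /recurrent_set /recurrent_cell /= (clock_move allx0) //.
  by case: ifP => _; rewrite ?region_index0 // idx_top // eqxx orbT.
have step l : exists delta : R, 0 < delta /\
    forall c : cfg, c.1 = l -> (delta%:E <= kernel_sta A c recurrent_set)%E.
  have [e eA [el ge]] := exists_unbounded_edge A allx0 l.
  have win (u : R) : N.+1%:R <= u <= N.+2%:R -> guard_index (grd e) (idx u).
    by move=> /andP[u1 _]; rewrite idx_top // (lt_le_trans _ u1) // ltr_nat.
  have [||eta eta0 h] := kernel_window allx0 continuousA eA (lexx 0) (ler0n R N) _ _ win.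
  - by rewrite ltr_nat.
  - by rewrite ltr_nat.
  exists (Num.min eta W%:R^-1); rewrite lt_min eta0 (weight_gt0R eA); split=> // c cl.
  have [cN|Nc] := leP (clock c) N%:R.
    apply: (@le_trans _ _ eta%:E); first by rewrite lee_fin ge_min lexx.
    apply: h; first by split; rewrite ?cl ?cN ?clock_ge0.
    move=> t t0 /andP[ct _]; apply: rec_move => //.
    by rewrite (lt_le_trans _ ct) // ltr_nat.
  apply: (@le_trans _ _ W%:R^-1%:E); first by rewrite lee_fin ge_min lexx orbT.
  apply: (kernel_top allx0 eA); rewrite ?el //.
  by move=> t t0; apply: rec_move => //; rewrite (lt_le_trans Nc) // lerDl.
have [f fP] := choice step.
exists (\big[Num.min/1]_l f l).
  by apply: lt_bigmin => // l _; have [] := fP l.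
move=> c; apply: (@le_trans _ _ (f c.1)%:E); last exact: (fP c.1).2.
by rewrite lee_fin; apply: bigmin_le_cond.
Qed.

Fixpoint follows (p : seq (cell A)) (n : nat) : set traj :=
  if p is s :: p' then [set w | cell_of (w n) = s] `&` follows p' n.+1 else setT.

Lemma measurable_follows p n : measurable (follows p n).
Proof.
elim: p n => [|s p IH] n /=; first exact: measurableT.
by apply: measurableI => //; exact: (measurable_coord n (@measurable_cell_set R L X l0 A x0 s)).
Qed.

(** [eta] is chosen before [n] and [C]: it is the product of the bounds of [piece_step] along the
    path, each depending only on the current piece. This uniformity is what the recurrence argument
    consumes. *)
Lemma path_lower p s K : piece x0 s K -> path (@thick R L X l0 A) s p ->
  exists2 eta : R, 0 < eta & forall n C, (forall i, measurable (C i)) ->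
    C n `<=` K -> (eta%:E * P (past C n) <= P (past C n `&` follows p n.+1))%E.
Proof.
elim: p s K => [|s' p IH] s K pK /=.
  move=> _; exists 1 => // n C mC CK; rewrite setIT mul1e; exact: lexx.
move=> /andP[ss' s'p]; have [K' pK' [c c0 hc]] := piece_step allx0 continuousA pK ss'.
have [eta eta0 h] := IH s' K' pK' s'p; have mK' := piece_measurable pK'.
exists (eta * c) => [|n C mC CK]; first exact: mulr_gt0.
have step : (c%:E * P (past C n) <= P (past C n `&` [set w | K' (w n.+1)]))%E.
  by apply: law_step_ge => //; [exact: ltW|move=> x /CK; exact: hc].
(* The past is prolonged by the piece at time [n + 1], from which the induction hypothesis
   continues. *)
pose C' i := if (i <= n)%N then C i else K'.
have mC' i : measurable (C' i) by rewrite /C'; case: ifP.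
have pC' : past C' n.+1 = past C n `&` [set w | K' (w n.+1)].
  apply/seteqP; split=> w.
    move=> hw; split; last by have := hw _ (leqnn n.+1); rewrite /C' ltnn.
    by move=> i iN; have := hw i (leqW iN); rewrite /C' iN.
  move=> [hw hK] i; rewrite leq_eqVlt => /orP[/eqP ->|].
    by rewrite /C' ltnn.
  by rewrite ltnS => iN; rewrite /C' iN; exact: hw.
rewrite EFinM -muleA; apply: (@le_trans _ _ (eta%:E * P (past C' n.+1))%E).
  by apply: lee_wpmul2l; [rewrite lee_fin ltW|rewrite pC'].
apply: le_trans (h n.+1 C' mC' _) _; first by rewrite /C' ltnn.
apply: le_measure; rewrite ?inE.
- by apply: measurableI; [exact: measurable_past|exact: measurable_follows].
- apply: measurableI; first exact: measurable_past.
  apply: measurableI; last exact: measurable_follows.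
  exact: (measurable_coord n.+1 (@measurable_cell_set R L X l0 A x0 s')).
rewrite pC' => w [[hw hK] fw]; split=> //; split=> //.
exact: piece_sub pK' _ hK.
Qed.

End Law.

(** * Almost sure properties and Borel-Cantelli *)

Section AlmostSurely.
Context d (T : measurableType d) (R : realType) (P : probability T R).
Implicit Types Q : T -> Prop.

(** Through negligibility, so that the property itself may fail to be measurable. *)
Definition almost_surely Q : Prop := P.-negligible [set w | ~ Q w].

Lemma almost_surelyS Q Q' :
  (forall w, Q w -> Q' w) -> almost_surely Q -> almost_surely Q'.
Proof. by move=> QQ'; apply: negligibleS => w /= nQ' /QQ'. Qed.

Lemma almost_surely_and Q Q' : almost_surely Q -> almost_surely Q' ->
  almost_surely (fun w => Q w /\ Q' w).
Proof.
move=> hQ hQ'; apply: negligibleS (negligibleU hQ hQ') => w /=.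
by move=> /not_andP.
Qed.

Lemma almost_surely_forall (I : countType) (Q : I -> T -> Prop) :
  (forall i, almost_surely (Q i)) -> almost_surely (fun w => forall i, Q i w).
Proof.
move=> hQ.
have : P.-negligible (\bigcup_n [set w | exists i, pickle i = n /\ ~ Q i w]).
  apply: negligible_bigcup => n.
  have [[i in_]|ni] := pselect (exists i : I, pickle i = n).
    by apply: negligibleS (hQ i) => w [j [jn]]; rewrite (pcan_inj pickleK (etrans jn (esym in_))).
  apply: negligibleS (negligible_set0 P) => w [i [in_ _]].
  by apply: ni; exists i.
apply: negligibleS => w /= /existsNP[i nQ].
by exists (pickle i) => //; exists i.
Qed.

Lemma almost_surely_null (B : set T) :
  measurable B -> P B = 0%E -> almost_surely (fun w => ~ B w).
Proof. by move=> mB B0; exists B; split=> // w /= /contrapT. Qed.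

Lemma almost_surely_le (B B' : set T) : measurable B -> measurable B' ->
  almost_surely (fun w => B w -> B' w) -> (P B <= P B')%E.
Proof.
move=> mB mB' [D [mD D0 hD]].
apply: (@le_trans _ _ (P (B' `|` D))).
  apply: le_measure; rewrite ?inE //; first exact: measurableU.
  move=> w Bw; have [B'w|nB'w] := pselect (B' w); first by left.
  by right; apply: hD => /(_ Bw).
by apply: le_trans (measureU2 P mB' mD) _; rewrite [X in (_ + X)%E]D0 adde0.
Qed.

Lemma almost_surely_eq (B B' : set T) : measurable B -> measurable B' ->
  almost_surely (fun w => B w <-> B' w) -> P B = P B'.
Proof.
move=> mB mB' h; apply/eqP; rewrite eq_le; apply/andP.
by split; apply: almost_surely_le => //; apply: almost_surelyS h => w [].
Qed.

End AlmostSurely.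

Section Recurrence.
Context d (T : measurableType d) (R : realType) (P : probability T R).
Variables (H G : nat -> set T) (m : nat) (eta : R).
Hypotheses (mH : forall n, measurable (H n)) (mG : forall n, measurable (G n)).
Hypothesis eta0 : 0 < eta.

(** The condition [k + m <= n] makes [avoid n0 n] an event of the first [n]
    steps when each [G k] is an event of the first [k + m] steps. *)
Definition avoid (n0 n : nat) : set T :=
  [set w | forall k, (n0 <= k)%N -> (k + m <= n)%N -> ~ G k w].

Lemma measurable_avoid n0 n : measurable (avoid n0 n).
Proof.
rewrite (_ : avoid n0 n =
  \bigcap_(k in [set k | (n0 <= k)%N /\ (k + m <= n)%N]) ~` G k).
  by apply: bigcap_measurableType => k _; exact: measurableC.
by apply/seteqP; split=> w h k => [[h1 h2]|h1 h2]; apply: h.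
Qed.

(** Exchanging the lag [m] and the length [K] leaves [m] terms whatever [K] is, which bounds the sum
    uniformly in [K]. *)
Lemma sumr_shift (z : nat -> R) K :
  \sum_(0 <= i < K) (z i - z (i + m)%N) = \sum_(0 <= i < m) (z i - z (i + K)%N).
Proof.
elim: K => [|K IH]; first by rewrite big_geq // big1_seq // => i _; rewrite addn0 subrr.
rewrite big_nat_recr //= IH.
have telescope k : \sum_(0 <= i < k) (z (i + K)%N - z (i + K.+1)%N) = z K - z (k + K)%N.
  elim: k => [|k IHk]; first by rewrite big_geq // add0n subrr.
  by rewrite big_nat_recr //= IHk addnS addSn addrA subrK.
rewrite addnC -telescope -big_split /=; apply: eq_bigr => i _.
by rewrite addrA subrK.
Qed.

Hypothesis step : forall n0 n, (n0 <= n)%N ->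
  (eta%:E * P (avoid n0 n `&` H n) <= P (avoid n0 n `&` H n `&` G n))%E.

(** [P (avoid n0 n `&` H n)] is at most [1 / eta] times the decrease of
    [P (avoid n0 _)] from [n] to [n + m], hence the sum telescopes. *)
Lemma avoid_summable n0 K :
  (\sum_(0 <= n < K) P (avoid n0 (n0 + n) `&` H (n0 + n)) <= (m%:R / eta)%:E)%E.
Proof.
pose z n := fine (P (avoid n0 (n0 + n))).
have fP B : measurable B -> P B = (fine (P B))%:E.
  by move=> mB; rewrite fineK // fin_num_measure.
have z01 n : 0 <= z n <= 1.
  rewrite fine_ge0 ?measure_ge0 //= -lee_fin -fP ?probability_le1 //;
    exact: measurable_avoid.
have mAH n : measurable (avoid n0 n `&` H n).
  by apply: measurableI => //; exact: measurable_avoid.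
(* The event [G (n0 + n)] is disjoint from [avoid n0 (n0 + n + m)], and inside [avoid n0 (n0 + n)]
   the two probabilities add up. *)
have hz n : fine (P (avoid n0 (n0 + n) `&` H (n0 + n))) * eta <= z n - z (n + m)%N.
  rewrite mulrC -lee_fin EFinM -fP //; apply: le_trans (step (leq_addr _ _)) _.
  rewrite EFinB -!fP; try exact: measurable_avoid.
  rewrite leeBrDr; last by rewrite fin_num_measure //; exact: measurable_avoid.
  rewrite -measureU //; last 3 first.
  - by apply: measurableI.
  - exact: measurable_avoid.
  - apply/seteqP; split=> // w [[_ Gw] /(_ (n0 + n)%N (leq_addr _ _))].
    by rewrite addnA => /(_ (leqnn _)).
  apply: le_measure; rewrite ?inE; try exact: measurable_avoid.
    apply: measurableU; last exact: measurable_avoid.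
    by apply: measurableI.
  move=> w [[[]] //|h k k0 kn]; apply: h => //.
  by rewrite (leq_trans kn) // leq_add2l leq_addr.
rewrite (eq_bigr (fun n => (fine (P (avoid n0 (n0 + n) `&` H (n0 + n))))%:E)); last first.
  by move=> n _; exact: fP.
rewrite sumEFin lee_fin ler_pdivlMr // mulr_suml.
apply: (@le_trans _ _ (\sum_(0 <= i < K) (z i - z (i + m)%N))).
  by apply: ler_sum => i _; exact: hz.
rewrite sumr_shift; apply: (@le_trans _ _ (\sum_(0 <= i < m) 1)).
  apply: ler_sum => i _; have /andP[_ zi] := z01 i; have /andP[zK _] := z01 (i + K)%N.
  by rewrite lerBlDr (le_trans zi) // lerDl.
by rewrite sumr_const_nat subn0.
Qed.

(** By Borel-Cantelli, almost surely only finitely many events [avoid n0 n] with [H n] occur. If [G]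
    never occurs from [n0] on, every [avoid n0 n] holds, so [H] occurs only finitely often. *)
Lemma infinitely_often_transfer : almost_surely P (fun w =>
  (forall n0, exists2 n, (n0 <= n)%N & H n w) ->
  (forall n0, exists2 n, (n0 <= n)%N & G n w)).
Proof.
pose F n0 n := avoid n0 (n0 + n) `&` H (n0 + n).
have mF n0 n : measurable (F n0 n) by apply: measurableI => //; exact: measurable_avoid.
have null n0 : P (lim_sup_set (F n0)) = 0%E.
  apply: lim_sup_set_cvg0 => //.
  apply: (@le_lt_trans _ _ (m%:R / eta)%:E); last exact: ltry.
  apply: lime_le; first by apply: is_cvg_nneseries => n _ _; exact: measure_ge0.
  by apply: nearW => K; exact: avoid_summable.
have : almost_surely P (fun w => forall n0, ~ lim_sup_set (F n0) w).
  apply: almost_surely_forall => n0; apply: almost_surely_null (null n0).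
  by apply: bigcapT_measurable => k; apply: bigcup_measurable => n _; exact: mF.
apply: almost_surelyS => w h Hw n0; apply: contrapT => Gw; apply: (h n0) => k _ /=.
have [n kn Hn] := Hw (n0 + k)%N.
exists (n - n0)%N; first by rewrite /=; lia.
rewrite /F subnKC; last by lia.
by split=> // j j0 _ Gj; apply: Gw; exists j.
Qed.

End Recurrence.

(** * The product with the Muller automaton *)

Section InfinitelyOften.
Variables (T : finType) (sigma : nat -> T).

Definition infinitely_often (p : pred T) : Prop :=
  forall n, exists2 m, (n <= m)%N & p (sigma m).

Lemma infinitely_often_pick (p : pred T) :
  infinitely_often p -> exists2 a, p a & infinitely_often (pred1 a).
Proof.
move=> iop; apply: contrapT => nio.
have h a : exists n, p a -> forall m, (n <= m)%N -> sigma m != a.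
  have [pa|npa] := boolP (p a); last by exists 0%N.
  have /existsNP[n hn] : ~ infinitely_often (pred1 a) by move=> ioa; apply: nio; exists a.
  by exists n => _ m nm; apply/negP => am; apply: hn; exists m.
have [f fP] := choice h.
have [m fm pm] := iop (\max_a f a)%N.
have /negP[] // : sigma m != sigma m.
by apply: (fP (sigma m) pm m); apply: leq_trans fm; exact: leq_bigmax.
Qed.

Variable e : rel T.
Hypothesis path_sigma : forall n, e (sigma n) (sigma n.+1).

Lemma connect_sigma n m : (n <= m)%N -> connect e (sigma n) (sigma m).
Proof.
move=> /subnKC <-; elim: (m - n)%N => [|k IH]; first by rewrite addn0.
by rewrite addnS; apply: connect_trans IH (connect1 _).
Qed.

(** Vertices visited infinitely often are connected to each other along the run. Since one of them
    lies in [r], the transfer hypothesis adds all its successors, so they form a bottom component;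
    the hypothesis is required only from vertices in [r]. *)
Lemma infinitely_often_component (r : pred T) :
  infinitely_often r ->
  (forall a u, r a -> connect e a u -> infinitely_often (pred1 a) ->
     infinitely_often (pred1 u)) ->
  exists a, [/\ infinitely_often (pred1 a), forall u, connect e a u -> connect e u a &
    forall u, infinitely_often (pred1 u) <-> connect e a u].
Proof.
move=> /infinitely_often_pick[a ra ioa] tr; exists a.
have fwd b u : infinitely_often (pred1 b) -> infinitely_often (pred1 u) -> connect e b u.
  move=> iob iou; have [n _ /eqP <-] := iob 0%N; have [m nm /eqP <-] := iou n.
  exact: connect_sigma.
split=> // u; first by move=> au; apply: fwd => //; exact: tr au ioa.
by split=> [|au]; [exact: fwd|exact: tr au ioa].
Qed.

End InfinitelyOften.

Section Product.
Variables (R : realType) (L X AP Q : finType) (l0 : L) (A : sta R X l0).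
Variables (lab : L -> {set AP}) (M : muller AP Q).
Variables (x0 : X) (allx0 : forall x : X, x = x0).
Hypothesis continuousA : delay_continuous A.
Variables (mu : probability (config R X l0) R) (P : probability (trajectory R X l0) R).
Hypothesis lawP : trajectory_law A mu P.
Local Notation traj := (trajectory R X l0).
Local Notation cell_of := (@cell_of R L X l0 A x0).
Local Notation cell_set := (@cell_set R L X l0 A x0).
Local Notation pstate := (pstate Q A).
Local Notation past := (@past R L X l0).

Definition pst (n : nat) (w : traj) : pstate :=
  (cell_of (w n), mrun M (fun n => lab (w n).1) n).

Definition determined (n : nat) (Y : set traj) : Prop :=
  forall w w' : traj, (forall i, (i <= n)%N -> cell_of (w i) = cell_of (w' i)) ->
    Y w -> Y w'.

Lemma pst_determined n k (w w' : traj) : (k <= n)%N ->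
  (forall i, (i <= n)%N -> cell_of (w i) = cell_of (w' i)) -> pst k w = pst k w'.
Proof.
move=> kn h; rewrite /pst h //; congr pair.
elim: k kn => //= k IH kn; rewrite IH 1?ltnW //.
by have := h k (ltnW kn); rewrite /cell_of => -[->].
Qed.

Section Words.
Variable n : nat.

Let extend (f : {ffun 'I_n.+1 -> cell A}) : nat -> cell A := fun i => f (inord i).
Let word f : set traj := past (fun i => cell_set (extend f i)) n.

Let wordP f (w : traj) :
  word f w <-> forall i, (i <= n)%N -> cell_of (w i) = extend f i.
Proof. by []. Qed.

Let measurable_word f : measurable (word f).
Proof. by apply: measurable_past => i; exact: measurable_cell_set. Qed.

Let determinedE (Y : set traj) : determined n Y ->
  Y = \bigcup_(f in [set f | word f `<=` Y]) word f.
Proof.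
move=> dY; apply/seteqP; split=> w; last by move=> [f fY] /fY.
move=> Yw; pose f := [ffun i : 'I_n.+1 => cell_of (w i)].
have fE i : (i <= n)%N -> extend f i = cell_of (w i).
  by move=> iN; rewrite /extend ffunE inordK.
exists f => /=; last by apply/wordP => i iN; rewrite fE.
move=> w' /wordP hw'; apply: dY Yw => i iN.
by rewrite hw' // fE.
Qed.

Let trivIset_word D : trivIset D word.
Proof.
move=> f g _ _ [w [/wordP fw /wordP gw]].
apply/ffunP => i; have iN : (i <= n)%N by rewrite -ltnS.
by have := fw i iN; rewrite (gw i iN) /extend inord_val.
Qed.

Lemma measurable_determined Y : determined n Y -> measurable Y.
Proof.
by move=> /determinedE ->; apply: fin_bigcup_measurable; first exact: finite_finset.
Qed.

(** Lower bounds are known for rectangular pasts only. An event determined by the cells up to time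
    [n] is a finite disjoint union of such pasts, over which the inequality is summed. *)
Lemma determined_lower (Y D : set traj) (eta : R) :
  determined n Y -> measurable D -> 0 <= eta ->
  (forall h : nat -> cell A,
     (exists w, Y w /\ forall i, (i <= n)%N -> cell_of (w i) = h i) ->
     (eta%:E * P (past (fun i => cell_set (h i)) n) <=
      P (past (fun i => cell_set (h i)) n `&` D))%E) ->
  (eta%:E * P Y <= P (Y `&` D))%E.
Proof.
move=> dY mD eta0 hyp; rewrite (determinedE dY).
set F := [set f | _].
have finF : finite_set F by exact: finite_finset.
rewrite setI_bigcupl (measure_fin_bigcup P finF (@trivIset_word F)) //.
rewrite (measure_fin_bigcup P finF
  (trivIset_setIr (G := fun=> D) (@trivIset_word F))); last first.
  by move=> f _; exact: measurableI.
rewrite ge0_mule_fsumr //.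
apply: lee_fsum => // f Ff.
have [[w fw]|nw] := pselect (exists w, word f w).
  by apply: hyp; exists w; split; [exact: Ff|exact/wordP].
have -> : word f = set0 by apply/seteqP; split=> // w fw; apply: nw; exists w.
by rewrite measure0 mule0.
Qed.

End Words.
End Product.

Section AlmostSureComponent.
Variables (R : realType) (L X AP Q : finType) (l0 : L) (A : sta R X l0).
Variables (lab : L -> {set AP}) (M : muller AP Q).
Variables (x0 : X) (allx0 : forall x : X, x = x0).
Hypothesis continuousA : delay_continuous A.
Variables (mu : probability (config R X l0) R) (P : probability (trajectory R X l0) R).
Hypothesis lawP : trajectory_law A mu P.
Local Notation traj := (trajectory R X l0).
Local Notation cell_of := (@cell_of R L X l0 A x0).
Local Notation cell_set := (@cell_set R L X l0 A x0).
Local Notation pstate := (pstate Q A).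
Local Notation step := (@step R L X AP Q l0 A lab M).
Local Notation bottom_scc := (@bottom_scc R L X AP Q l0 A lab M).
Local Notation mreach := (@mreach R L X AP Q l0 A lab M).
Local Notation past := (@past R L X l0).
Local Notation follows := (@follows R L X l0 A x0).

Local Notation pst := (@pst R L X AP Q l0 A lab M x0).
Local Notation determined := (@determined R L X l0 A x0).

Lemma almost_surely_step : almost_surely P (fun w => forall n, step (pst n w) (pst n.+1 w)).
Proof.
have h : almost_surely P (fun w => forall i : nat * cell A * cell A,
    ~~ thick i.1.2 i.2 ->
    ~ (cell_set i.1.2 (w i.1.1) /\ cell_set i.2 (w i.1.1.+1))).
  apply: almost_surely_forall => -[[n s] s'] /=.
  have [ss'|nss'] := boolP (thick s s').
    by exists set0; split=> // w /=; case.
  pose C i := if i == n then cell_set s else setT.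
  have mC i : measurable (C i).
    by rewrite /C; case: ifP => _; [exact: measurable_cell_set|exact: measurableT].
  have pC : past C n = [set w | cell_set s (w n)].
    apply/seteqP; split=> w.
      by move=> /(_ n (leqnn n)); rewrite /C eqxx.
    by move=> h i _; rewrite /C; case: eqP => // ->.
  have mB := measurable_cell_set x0 s'.
  apply: almost_surelyS (almost_surely_null (B := past C n `&` [set w | cell_set s' (w n.+1)]) _ _).
  - by move=> w nCw _ [h1 h2]; apply: nCw; rewrite pC.
  - apply: measurableI; first exact: measurable_past.
    exact: (measurable_coord n.+1 mB).
  apply: (law_step_eq0 lawP) => // c; rewrite /C eqxx => cs.
  exact: (kernel_not_thick allx0 cs).
apply: almost_surelyS h => w h n; rewrite /step eqxx andbT.
apply/negPn/negP => nt; exact: (h (n, cell_of (w n), cell_of (w n.+1)) nt).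
Qed.

(** The transfer lemma with [H] always true, [G n] recurrence at time [n + 1], and lag [1]. *)
Lemma almost_surely_recurrent : almost_surely P (fun w =>
  forall n0, exists2 n, (n0 <= n)%N & recurrent_cell (cell_of (w n))).
Proof.
have [delta delta0 hd] := recurrent_step allx0 continuousA.
pose G n : set traj := [set w | recurrent_set A x0 (w n.+1)].
have mrec : measurable (recurrent_set A x0) by exact: measurable_cell_pred.
have mG n : measurable (G n) by exact: measurable_coord.
have mT (n : nat) : measurable (setT : set traj) by exact: measurableT.
have := @infinitely_often_transfer _ _ _ P (fun=> setT) G 1 delta mT mG delta0.
move=> h; apply: almost_surelyS (h _) => [w io n0|n0 n n0n].
  have [|n n0n Gn] := io _ n0; first by move=> k; exists k.
  by exists n.+1 => //; exact: leqW.
rewrite setIT.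
(* Here [avoid] forbids recurrence exactly at the times from [n0 + 1] to [n], so it is a rectangular
   past. *)
pose C i := if (n0 < i)%N then ~` recurrent_set A x0 else setT.
have mC i : measurable (C i).
  by rewrite /C; case: ifP => _; [exact: measurableC|exact: measurableT].
have -> : avoid G 1 n0 n = past C n.
  apply/seteqP; split=> w hw.
    move=> i iN; rewrite /C; have [n0i|//] := ltnP n0 i.
    case: i iN n0i => // i iN n0i.
    by apply: (hw i n0i); rewrite addn1.
  move=> k n0k; rewrite addn1 => kn; have := hw _ kn.
  by rewrite /C ltnS n0k.
by apply: (law_step_ge lawP) => //; exact: ltW.
Qed.

(** The Muller state is a function of the past cells, so following the cells of a product path means
    following the path. *)
Lemma follows_pst (p : seq pstate) (a : pstate) n (w : traj) :
  pst n w = a -> path step a p -> follows [seq t.1 | t <- p] n.+1 w ->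
  forall i, (i < size p)%N -> pst (n + i.+1) w = nth a p i.
Proof.
elim: p a n => [|t p IH] a n //= na /andP[at_ tp] [tw fw].
have nt : pst n.+1 w = t.
  rewrite /pst /= (tw : cell_of _ = _).
  move: na; rewrite /pst => na; have a1 : a.1 = cell_of (w n) by rewrite -na.
  have a2 : a.2 = mrun M (fun n => lab (w n).1) n by rewrite -na.
  by move: at_; rewrite /step a1 a2 => /andP[_ /eqP] <-; case: (t).
case=> [|i] /=; first by rewrite addn1.
rewrite ltnS => ip; rewrite addnS -addSn (IH t n.+1) //.
exact: set_nth_default.
Qed.

Lemma follows_determined (p : seq (cell A)) n k (w w' : traj) : (n + size p <= k.+1)%N ->
  (forall i, (i <= k)%N -> cell_of (w i) = cell_of (w' i)) ->
  follows p n w -> follows p n w'.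
Proof.
elim: p n => //= s p IH n nk h [ws fw]; split.
  by rewrite /= -h //; lia.
by apply: IH fw => //; lia.
Qed.

(** The transfer lemma from visits of [a] to visits of [a] followed by the path, with the length of
    the path as lag. *)
Lemma almost_surely_follow (a : pstate) (p : seq pstate) :
  recurrent_cell a.1 -> path step a p ->
  almost_surely P (fun w => infinitely_often (pst^~ w) (pred1 a) ->
    infinitely_often (pst^~ w) (pred1 (last a p))).
Proof.
case/lastP: p => [|p u] ra ap.
  by exists set0; split=> // w /=; apply.
set p' := rcons p u in ap *.
have ap1 : path (@thick R L X l0 A) a.1 [seq t.1 | t <- p'].
  elim: p' a ap {ra} => //= t q IH a /andP[at_ tq].
  by rewrite IH // andbT; case/andP: at_.
have [eta eta0 he] := path_lower allx0 continuousA lawP (recurrent_piece x0 ra) ap1.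
pose H n : set traj := [set w | pst n w = a].
pose G n : set traj := H n `&` follows [seq t.1 | t <- p'] n.+1.
have dH n : determined n (H n) by move=> w w' h; rewrite /H /= -(pst_determined _ _ (leqnn n) h).
have mH n : measurable (H n) by exact: measurable_determined (dH n).
have mG n : measurable (G n) by apply: measurableI => //; exact: measurable_follows.
have := @infinitely_often_transfer _ _ _ P H G (size p') eta mH mG eta0.
move=> h; apply: almost_surelyS (h _) => [w io ioa n0|n0 n n0n].
  have [n n0n [Hn fn]] : exists2 n, (n0 <= n)%N & G n w.
    by apply: io => k; have [n kn /eqP na] := ioa k; exists n.
  exists (n + size p')%N; first exact: leq_trans n0n (leq_addr _ _).
  have := follows_pst Hn ap fn (i := (size p').-1).
  rewrite prednK; last by rewrite /p' size_rcons.
  move=> ->; first by rewrite nth_last /= eqxx.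
  by rewrite /p' size_rcons.
(* This event is not rectangular, but it only depends on the cells up to time [n]:
   [k + size p' <= n] confines every forbidden path to the past. *)
have dY : determined n (avoid G (size p') n0 n `&` H n).
  move=> w w' hw [av Hw]; split; last exact: dH hw Hw.
  have hw' i : (i <= n)%N -> cell_of (w' i) = cell_of (w i) by move=> iN; rewrite hw.
  move=> k n0k kn [Hk fk]; apply: (av k n0k kn); split.
    apply: dH Hk => i ik; apply: hw'; apply: leq_trans ik _.
    exact: leq_trans (leq_addr _ _) kn.
  by apply: follows_determined hw' fk; rewrite size_map addSn ltnS.
have -> : avoid G (size p') n0 n `&` H n `&` G n =
    (avoid G (size p') n0 n `&` H n) `&` follows [seq t.1 | t <- p'] n.+1.
  by rewrite /G setIA -[X in X `&` _ = _]setIA setIid.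
apply: (determined_lower (P := P) dY).
- exact: measurable_follows.
- exact: ltW.
move=> h' [w [[_ Hw] hw]]; apply: he => [i|]; first exact: measurable_cell_set.
rewrite -hw //; have -> : cell_of (w n) = a.1 by rewrite -Hw.
by [].
Qed.

(** Describes the limit behaviour of a run, accepting or not: acceptance then amounts to
    [mreach a \in mfinal M]. *)
Definition component_accepts (w : traj) (a : pstate) : Prop :=
  [/\ bottom_scc a, infinitely_often (pst^~ w) (pred1 a) &
      minf M (fun n => lab (w n).1) = mreach a].

Lemma almost_surely_component : almost_surely P (fun w =>
  (forall n, step (pst n w) (pst n.+1 w)) /\ exists a, component_accepts w a).
Proof.
(* Pairs of a state and a path are countable, so one null set serves them all. *)
have hf : almost_surely P (fun w => forall ap : pstate * seq pstate,
    recurrent_cell ap.1.1 -> path step ap.1 ap.2 ->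
    infinitely_often (pst^~ w) (pred1 ap.1) ->
    infinitely_often (pst^~ w) (pred1 (last ap.1 ap.2))).
  apply: almost_surely_forall => -[a p] /=.
  have [ra|nra] := boolP (recurrent_cell a.1); last first.
    by exists set0; split=> // w /=; case.
  have [pa|npa] := boolP (path step a p); last first.
    by exists set0; split=> // w /=; case.
  by apply: almost_surelyS (almost_surely_follow ra pa) => w h _ _.
apply: almost_surelyS (almost_surely_and (almost_surely_and almost_surely_step
  almost_surely_recurrent) hf) => w [[hs hr] {}hf]; split=> //.
have [|a u ra /connectP[p ap ->] ioa|a [ioa ba iou]] :=
    @infinitely_often_component _ (pst^~ w) step hs (fun t => recurrent_cell t.1).
- by move=> n; have [m nm rm] := hr n; exists m.
- exact: (hf (a, p)).
exists a; split=> //; first by apply/forallP => u; apply/implyP; exact: ba.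
apply/finset.setP => q; rewrite finset.inE; apply/asboolP/imsetP => [io|[u au ->] n].
  have [|u /eqP uq iou'] := @infinitely_often_pick _ (pst^~ w) (fun t => t.2 == q).
    by move=> n; have [m nm <-] := io n; exists m => //=.
  by exists u => //; exact/iou.
have [m nm /eqP mu_] := (iou u).2 au n; exists m => //.
by rewrite -mu_.
Qed.

End AlmostSureComponent.

(** * Acceptance probability as a limit *)

Section AcceptanceProbability.
Variables (R : realType) (L X AP Q : finType) (l0 : L) (A : sta R X l0).
Variables (lab : L -> {set AP}) (M : muller AP Q).
Variables (x0 : X) (allx0 : forall x : X, x = x0).
Hypothesis continuousA : delay_continuous A.
Variables (mu : probability (config R X l0) R) (P : probability (trajectory R X l0) R).
Hypothesis lawP : trajectory_law A mu P.
Local Notation traj := (trajectory R X l0).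
Local Notation cell_of := (@cell_of R L X l0 A x0).
Local Notation pstate := (pstate Q A).
Local Notation step := (@step R L X AP Q l0 A lab M).
Local Notation good := (@good R L X AP Q l0 A lab M).
Local Notation bad := (@bad R L X AP Q l0 A lab M).
Local Notation bottom_scc := (@bottom_scc R L X AP Q l0 A lab M).
Local Notation mreach := (@mreach R L X AP Q l0 A lab M).
Local Notation follows := (@follows R L X l0 A x0).

Local Notation pst := (@pst R L X AP Q l0 A lab M x0).

Local Notation acc := (@maccepting AP Q M R L X l0 lab).
Local Notation component_accepts := (@component_accepts R L X AP Q l0 A lab M x0).

Lemma measurable_pst n (p : pred pstate) : measurable [set w | p (pst n w)].
Proof.
apply: (@measurable_determined R L X l0 A x0 n) => w w1 h /=.
by rewrite (pst_determined lab M (leqnn n) h).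
Qed.

(** Acceptance is a finite Boolean combination of the events that [q] is visited infinitely
    often. *)
Lemma measurable_accepting : measurable acc.
Proof.
pose B (q : Q) : set traj := \bigcap_n \bigcup_(m in [set m | (n <= m)%N])
  [set w | (pst m w).2 == q].
have mB q : measurable (B q).
  apply: bigcapT_measurable => n; apply: bigcup_measurable => m _.
  exact: (measurable_pst m (fun t => t.2 == q)).
have BP q (w : traj) : B q w <-> q \in minf M (fun n => lab (w n).1).
  rewrite finset.inE; split=> [h|/asboolP h].
    by apply/asboolP => n; have [m nm /eqP mq] := h n I; exists m.
  by move=> n _; have [m nm mq] := h n; exists m => //; apply/eqP.
rewrite (_ : acc = \bigcup_(F in [set F | F \in mfinal M])
    \bigcap_(q in [set: Q]) (if q \in F then B q else ~` B q)).
  apply: fin_bigcup_measurable; first exact: finite_finset.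
  move=> F _; apply: fin_bigcap_measurable; first exact: finite_finset.
  by move=> q _; case: ifP => _ //; exact: measurableC.
apply/seteqP; split=> w.
  move=> aw; exists (minf M (fun n => lab (w n).1)) => // q _.
  by case: ifP => [/BP //|/negP nq /BP].
move=> [F FM hF]; rewrite /maccepting /maccepts /=.
suff -> : minf M (fun n => lab (w n).1) = F by [].
apply/finset.setP => q; have := hF q I; case: ifP => qF; first by move/BP ->.
by move=> nB; apply/negP => /BP.
Qed.

Lemma good_connect t u : connect step t u -> good t -> good u.
Proof.
move=> tu /forallP gt; apply/forallP => v; apply/implyP => uv.
exact: implyP (gt v) (connect_trans tu uv).
Qed.

Lemma bad_connect t u : connect step t u -> bad t -> bad u.
Proof.
move=> tu /forallP gt; apply/forallP => v; apply/implyP => uv.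
exact: implyP (gt v) (connect_trans tu uv).
Qed.

Lemma bottom_mreach t u : bottom_scc t -> connect step t u -> mreach u = mreach t.
Proof.
move=> /forallP bt tu; have ut : connect step u t := implyP (bt u) tu.
apply/finset.setP => q; apply/imsetP/imsetP => -[v hv ->]; exists v => //.
  exact: connect_trans tu hv.
exact: connect_trans ut hv.
Qed.

Lemma bottom_good t : bottom_scc t -> good t = (mreach t \in mfinal M).
Proof.
move=> bt; apply/forallP/idP => [/(_ t)|tF u]; first by rewrite connect0 bt.
by apply/implyP => tu; apply/implyP => _; rewrite (bottom_mreach bt tu).
Qed.

Lemma bottom_bad t : bottom_scc t -> bad t = (mreach t \notin mfinal M).
Proof.
move=> bt; apply/forallP/idP => [/(_ t)|tF u]; first by rewrite connect0 bt.
by apply/implyP => tu; apply/implyP => _; rewrite (bottom_mreach bt tu).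
Qed.

Let good_at n : set traj := [set w | good (pst n w)].
Let bad_at n : set traj := [set w | bad (pst n w)].

(** Good and bad states keep their status along a run, up to the state [a] of the limit component;
    and a state of a bottom component is one or the other. *)
Lemma component_decides (w : traj) n a :
  (forall n, step (pst n w) (pst n.+1 w)) -> component_accepts w a ->
  [/\ good_at n w -> acc w, bad_at n w -> ~ acc w &
      exists m, if pselect (acc w) then good_at m w else bad_at m w].
Proof.
move=> hs [ba ioa mw]; have con := connect_sigma hs.
rewrite /maccepting /maccepts /= mw /good_at /bad_at /=.
have [m nm /eqP ma] := ioa n.
split=> [gn|bn|].
- by rewrite -bottom_good // -ma; apply: good_connect gn; exact: con.
- by apply/negP; rewrite -bottom_bad // -ma; apply: bad_connect bn; exact: con.
exists m; case: pselect => [am|nam]; first by rewrite ma bottom_good.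
by rewrite ma bottom_bad //; exact/negP.
Qed.

Lemma good_at_le n : (P (good_at n) <= P acc)%E.
Proof.
apply: almost_surely_le; [exact: measurable_pst|exact: measurable_accepting|].
apply: almost_surelyS (almost_surely_component lab M allx0 continuousA lawP) => w [hs [a ha]].
by have [] := component_decides n hs ha.
Qed.

Lemma bad_at_le n : (P (bad_at n) <= P (~` acc))%E.
Proof.
apply: almost_surely_le; [exact: measurable_pst| |].
  by apply: measurableC; exact: measurable_accepting.
apply: almost_surelyS (almost_surely_component lab M allx0 continuousA lawP) => w [hs [a ha]].
by have [] := component_decides n hs ha.
Qed.

(** The increasing unions [U n] tend to an event of probability one. Because decided states remain
    decided, [U n] is almost surely contained in [D n]. *)
Lemma decided_limit (eps : R) : 0 < eps -> exists n, forall m, (n <= m)%N ->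
  ((1 - eps)%:E <= P [set w | good (pst m w) || bad (pst m w)])%E.
Proof.
move=> eps0.
pose D n : set traj := [set w | good (pst n w) || bad (pst n w)].
have mD n : measurable (D n) by exact: (measurable_pst n (fun t => good t || bad t)).
pose U n : set traj := \bigcup_(k in [set k | (k <= n)%N]) D k.
have mU n : measurable (U n) by rewrite /U; apply: bigcup_measurable => k _; exact: mD.
have UD n : (P (U n) <= P (D n))%E.
  apply: almost_surely_le => //.
  apply: almost_surelyS (almost_surely_component lab M allx0 continuousA lawP) => w [hs _].
  have con := connect_sigma (sigma := pst^~ w) hs.
  move=> [k /= kn] /orP[gk|bk]; apply/orP.
    by left; apply: good_connect gk; exact: con.
  by right; apply: bad_connect bk; exact: con.
have cU : P (\bigcup_n U n) = 1%E.
  rewrite -(@probability_setT _ _ _ P).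
  apply: almost_surely_eq => //; first exact: bigcupT_measurable.
  apply: almost_surelyS (almost_surely_component lab M allx0 continuousA lawP) => w [hs [a ha]].
  split=> // _; have [_ _ [m]] := component_decides 0 hs ha.
  by case: pselect => ? hm; exists m => //; exists m => //=; apply/orP; [left|right].
have : P (U n) @[n --> \oo] --> P (\bigcup_n U n).
  apply: nondecreasing_cvg_mu => //; first exact: bigcupT_measurable.
  by move=> n m nm; apply/subsetPset => w [k /= kn Dk]; exists k => //=; exact: leq_trans nm.
rewrite cU => /fine_cvgP[_] /cvgrPdist_lt /(_ eps eps0) [n _ hn]; exists n => m nm.
apply: le_trans (UD m); have := hn m nm; rewrite /= -[P (U m)]fineK ?fin_num_measure //.
rewrite lee_fin ltr_norml => /andP[_ h]; rewrite lerBlDr -lerBlDl; exact: ltW.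
Qed.

Definition path_event (p : seq pstate) : set traj := follows (rev [seq t.1 | t <- p]) 0.

Lemma follows_rcons p s n :
  follows (rcons p s) n = follows p n `&` [set w | cell_of (w (n + size p)%N) = s].
Proof.
elim: p n => [|s' p IH] n /=; first by rewrite addn0 setIT setTI.
by rewrite IH setIA addSnnS.
Qed.

Lemma path_event_cons t p :
  path_event (t :: p) = path_event p `&` [set w | cell_of (w (size p)) = t.1].
Proof. by rewrite /path_event /= rev_cons follows_rcons size_rev size_map. Qed.

Lemma measurable_path_event p : measurable (path_event p).
Proof. exact: measurable_follows. Qed.

Lemma paths_size k p : p \in paths A lab M k -> size p = k.+1.
Proof.
elim: k p => [|k IH] p /=; first by case/mapP => t _ ->.
by case/flatten_mapP => q /IH qk /mapP[t _ ->] /=; rewrite qk.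
Qed.

Lemma path_event_pst k p t (w : traj) : p \in paths A lab M k -> path_event p w ->
  pst k w = head t p.
Proof.
elim: k p t => [|k IH] p t /=.
  case/mapP => u; rewrite mem_filter => /andP[/eqP u2 _] ->.
  by rewrite path_event_cons => -[_ /= uw]; rewrite /pst /= uw -u2; case: (u).
case/flatten_mapP => q qk /mapP[u]; rewrite mem_filter => /andP[qu _] -> /=.
rewrite path_event_cons => -[qw /=]; rewrite (paths_size qk) => uw.
have := IH q u qk qw; move: qu; rewrite /step => /andP[_ /eqP u2] hq.
have h1 : (head u q).1 = cell_of (w k) by rewrite -hq.
have h2 : (head u q).2 = mrun M (fun n => lab (w n).1) k by rewrite -hq.
by rewrite /pst /= uw; move: u2; rewrite h1 h2 => /esym ->; case: (u).
Qed.

Lemma measure_cell_partition n (Y : set traj) : measurable Y ->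
  P Y = (\sum_(s : cell A) P (Y `&` [set w | cell_of (w n) = s]))%E.
Proof.
move=> mY; pose F (s : cell A) : set traj := Y `&` [set w | cell_of (w n) = s].
have YE : Y = \bigcup_(s in [set: cell A]) F s.
  apply/seteqP; split=> w; last by move=> [s _ []].
  by move=> Yw; exists (cell_of (w n)).
rewrite [in LHS]YE measure_fin_bigcup //; first last.
- by move=> s _; apply: measurableI => //; exact: (measurable_coord n (measurable_cell_set x0 s)).
- by move=> s s' _ _ [w [[_ <-] [_ <-]]].
- exact: finite_finset.
rewrite fsbig_finite /=; last exact: finite_finset.
apply: perm_big; apply: uniq_perm; rewrite ?index_enum_uniq ?finmap.fset_uniq // => s.
rewrite mem_index_enum in_fset_set; last exact: finite_finset.
by rewrite mem_set.
Qed.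

(** For fixed [q], the product states with Muller state [q] are in bijection with the cells. *)
Lemma sum_states (c : pred (cell A)) (q : Q) (f : cell A -> \bar R) :
  (\sum_(t <- states Q A | c t.1 && (t.2 == q)) f t.1 = \sum_(s | c s) f s)%E.
Proof.
rewrite (perm_big (index_enum pstate)) /=; last first.
  apply: uniq_perm; [exact: uniq_states|exact: index_enum_uniq|].
  by move=> t; rewrite mem_states mem_index_enum.
rewrite (reindex_onto (fun s => (s, q)) fst) /=; last first.
  by case=> s q' /= /andP[_ /eqP ->].
by apply: eq_bigl => s; rewrite !eqxx !andbT.
Qed.

(** Cell sequences that are not paths of the graph are null, and the deterministic Muller component
    splits no event further; hence each path continues by the thick successors of its cell. *)
Lemma path_partition k (Y : set traj) : measurable Y ->
  P Y = (\sum_(p <- paths A lab M k) P (Y `&` path_event p))%E.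
Proof.
elim: k Y => [|k IH] Y mY /=.
  rewrite big_map big_filter (measure_cell_partition 0 mY).
  rewrite -(sum_states xpredT (minit M)); apply: eq_bigr => t _.
  by rewrite /path_event /= setIT.
rewrite (IH Y mY) big_flatten big_map big_seq [RHS]big_seq; apply: eq_bigr => p pk.
rewrite big_map big_filter; have sp := paths_size pk.
case: p sp pk => // u p sp pk.
set Z := Y `&` path_event (u :: p).
have mZ : measurable Z by apply: measurableI => //; exact: measurable_path_event.
rewrite (measure_cell_partition k.+1 mZ) /= (bigID (thick u.1)) /=.
rewrite [X in (_ + X)%E]big1 ?adde0; last first.
  move=> s nus; apply/eqP; rewrite eq_le measure_ge0 andbT.
  rewrite -(@measure0 _ _ _ P); apply: almost_surely_le.
  - apply: measurableI => //; exact: (measurable_coord k.+1 (measurable_cell_set x0 s)).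
  - exact: measurable0.
  apply: almost_surelyS (almost_surely_step lab M allx0 lawP) => w hs [[_ pw] ws].
  have := hs k; rewrite /step => /andP[+ _].
  rewrite (path_event_pst u pk pw) /= (ws : cell_of (w k.+1) = s).
  by rewrite (negbTE nus).
rewrite -(sum_states (thick u.1) (mtrans M u.2 (lab u.1.1))); apply: eq_bigr => t _.
by rewrite [in RHS]path_event_cons setIA sp.
Qed.

Definition on_head (g : pred pstate) (p : seq pstate) : bool :=
  if p is t :: _ then g t else false.

Lemma measure_pst_paths k (g : pred pstate) :
  P [set w | g (pst k w)] =
  (\sum_(p <- paths A lab M k | on_head g p) P (path_event p))%E.
Proof.
rewrite (path_partition k (measurable_pst k g)) [RHS]big_mkcond /=.
rewrite big_seq [RHS]big_seq; apply: eq_bigr => -[/paths_size //|t p] pk /=.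
case: ifPn => gt.
  congr (P _); apply/setIidPr => w pw /=; by rewrite (path_event_pst t pk pw).
rewrite (_ : _ `&` _ = set0) ?measure0 //; apply/seteqP; split=> // w [/= gw pw].
by move: gw; rewrite (path_event_pst t pk pw) /= (negbTE gt).
Qed.

End AcceptanceProbability.

(** * Almost-sure acceptance and the initial distribution *)

Section InitialDistribution.
Variables (R : realType) (L X AP Q : finType) (l0 : L) (A : sta R X l0).
Variables (lab : L -> {set AP}) (M : muller AP Q).
Variables (x0 : X) (allx0 : forall x : X, x = x0).
Hypothesis continuousA : delay_continuous A.
Variables (mu : probability (config R X l0) R) (P : probability (trajectory R X l0) R).
Hypothesis lawP : trajectory_law A mu P.
Local Notation cfg := (config R X l0).
Local Notation traj := (trajectory R X l0).
Local Notation cell_of := (@cell_of R L X l0 A x0).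
Local Notation cell_set := (@cell_set R L X l0 A x0).
Local Notation pstate := (pstate Q A).
Local Notation good := (@good R L X AP Q l0 A lab M).
Local Notation bad := (@bad R L X AP Q l0 A lab M).
Local Notation past := (@past R L X l0).
Local Notation follows := (@follows R L X l0 A x0).

Local Notation pst := (@pst R L X AP Q l0 A lab M x0).

Local Notation acc := (@maccepting AP Q M R L X l0 lab).

Local Notation N := (max_const A).
Local Notation clock := (@clock R L X l0 x0).
Local Notation idx := (region_index A).

Lemma small_inverse (d : R) : 0 < d -> exists k : nat, k.+2%:R^-1 <= d.
Proof.
move=> d0; exists (Num.truncn d^-1); rewrite invf_ple ?posrE ?ltr0n //.
by rewrite ltW // (lt_trans (truncnS_gt _)) // ltr_nat.
Qed.

(** A cell is a piece or, if it is a bounded open interval, a countable union of compact bands; by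
    countable additivity they cannot all be null. *)
Lemma positive_piece s : (0 < mu (cell_set s))%E ->
  exists2 K, piece x0 s K & (0 < mu K)%E.
Proof.
move=> s0; apply: contrapT => nK.
have null K : piece x0 s K -> mu.-negligible K.
  move=> pK; exists K; split=> //; first exact: piece_measurable pK.
  by apply/eqP; rewrite eq_le measure_ge0 andbT leNgt; apply/negP => K0; apply: nK; exists K.
suff : mu.-negligible (cell_set s).
  move=> /(negligibleP _ (measurable_cell_set x0 s)) s00.
  by move: s0; rewrite s00 ltxx.
have [sN|sN] := eqVneq (s.2 : nat) (2 * N).+1.
  by apply: null; left.
have sN' : (s.2 <= 2 * N)%N by have := ltn_ord s.2; lia.
pose n := (s.2 : nat)./2.
have nN : (n <= N)%N by rewrite /n; lia.
have [os|es] := boolP (odd s.2); last first.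
  have sE : s.2 = (2 * n)%N :> nat by rewrite /n; lia.
  have idxn : idx n%:R = (2 * n)%N.
    have [_ hle hlt] := region_indexP A (ler0n R n).
    by apply/eqP; rewrite eqn_leq hle // lexx andbT leqNgt hlt // ltxx.
  apply: null; right; exists n%:R, n%:R; rewrite sE idxn lexx ler_nat ler0n; split=> //.
  rewrite cell_setE; apply/seteqP; split=> c [cl h]; split=> //.
    have [_ hle hlt] := region_indexP A (clock_ge0 x0 c).
    case: h => _ /eqP; rewrite sE => h.
    by rewrite -hle // h leqnn leNgt -hlt // h ltnn.
  split; first exact: clock_ge0.
  have -> : clock c = n%:R by apply/eqP; rewrite eq_le andbC.
  by rewrite idxn sE.
have sE : s.2 = (2 * n).+1 :> nat by rewrite /n; lia.
have nN' : (n < N)%N by lia.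
(* The margins [1 / (k + 2)] are at most [1 / 2], so that even the first band is nonempty. *)
have [i [inv0 inv2 small]] : exists i : nat -> R,
    [/\ forall k, 0 < i k, forall k, i k <= 2^-1 & forall d, 0 < d -> exists k, i k <= d].
  exists (fun k => k.+2%:R^-1); split=> [k|k|d].
  - by rewrite invr_gt0 ltr0n.
  - by rewrite lef_pV2 ?posrE ?ltr0n // ler_nat.
  - exact: small_inverse.
pose a (k : nat) : R := n%:R + i k.
pose b (k : nat) : R := n.+1%:R - i k.
have n0 : 0 <= n%:R :> R by rewrite ler0n.
have n1 : n.+1%:R = n%:R + 1 :> R by rewrite natr1.
have nN1 : n.+1%:R <= N%:R :> R by rewrite ler_nat.
have ab k : a k <= b k by rewrite /a /b n1; have := inv2 k; lra.
apply: (@negligibleS _ _ _ _ (\bigcup_k band x0 s.1 (a k) (b k))).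
  rewrite cell_setE => c [cl [c0 /eqP ck]].
  have [_ hle hlt] := region_indexP A c0.
  have nc : n%:R < clock c by rewrite -hlt // ck sE.
  have cn : clock c < n.+1%:R by rewrite ltNge -hle // ck sE; lia.
  have [|k hk] := small (Num.min (clock c - n%:R) (n.+1%:R - clock c)).
    by rewrite lt_min !subr_gt0 nc.
  exists k => //; split=> //; move: hk; rewrite le_min => /andP[k1 k2].
  by rewrite /a /b; apply/andP; split; lra.
apply: negligible_bigcup => k; apply: null; right; exists (a k), (b k).
have ak := inv0 k; have abk := ab k.
have na : n%:R < a k by rewrite /a; lra.
have bn : b k < n.+1%:R by rewrite /b; lra.
split=> //; [lra|lra|split; rewrite sE; apply: idx_odd => //; lra].
Qed.

Lemma accepting_surely :
  (forall s, (0 < mu (cell_set s))%E -> good (s, minit M)) -> P acc = 1%E.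
Proof.
move=> hs; apply/eqP; rewrite eq_le probability_le1 ?andTb; last exact: measurable_accepting.
pose B : set cfg := [set c | good (cell_of c, minit M)].
have mB : measurable B by exact: (measurable_cell_pred x0 (fun s => good (s, minit M))).
apply: (@le_trans _ _ (P [set w : traj | B (w 0%N)])); last first.
  exact: (good_at_le lab M allx0 continuousA lawP 0).
rewrite lawP.1 // -(@probability_setT _ _ _ mu).
apply: almost_surely_le => //.
have : almost_surely mu (fun c => forall s : cell A, cell_set s c -> good (s, minit M)).
  apply: almost_surely_forall => s.
  have [gs|ngs] := boolP (good (s, minit M)).
    by exists set0; split=> // c /=; case.
  apply: almost_surelyS (almost_surely_null (measurable_cell_set x0 s) _).
    by move=> c nc /nc.
  apply/eqP; rewrite eq_le measure_ge0 andbT leNgt; apply/negP => /hs gs.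
  by rewrite gs in ngs.
by apply: almost_surelyS => c hc _; exact: hc.
Qed.

(** From a state that is not good some path leads to a rejecting bottom component. A piece of
    positive initial mass follows it with positive probability and then rejects almost surely. *)
Lemma accepting_not_surely s :
  (0 < mu (cell_set s))%E -> ~~ good (s, minit M) -> P acc <> 1%E.
Proof.
move=> /positive_piece[K pK K0] /forallPn[u]; rewrite !negb_imply => /and3P[].
move=> /connectP[p sp ->] bu nF acc1.
have mK := piece_measurable pK.
have sp1 : path (@thick R L X l0 A) s [seq t.1 | t <- p].
  rewrite -[s]/((s, minit M).1); elim: p (s, minit M) sp {bu nF} => //= t q IH a /andP[at_ tq].
  by rewrite IH // andbT; case/andP: at_.
have [eta eta0 he] := path_lower allx0 continuousA lawP pK sp1.
have /= hK := he 0%N (fun=> K) (fun=> mK) (@subset_refl _ K).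
have pastK : past (fun=> K) 0 = [set w : traj | K (w 0%N)].
  by apply/seteqP; split=> [w /(_ 0%N isT)|w Kw [|i]].
have sub : past (fun=> K) 0 `&` follows [seq t.1 | t <- p] 1 `<=`
    [set w | bad (pst (size p) w)].
  rewrite pastK => w [Kw fw] /=.
  have w0 : pst 0 w = (s, minit M) by rewrite /pst /= (piece_sub pK Kw : cell_of _ = s).
  suff -> : pst (size p) w = last (s, minit M) p by rewrite bottom_bad.
  have := follows_pst w0 sp fw (i := (size p).-1).
  case: (p) => [|t q] /=; first by rewrite w0.
  by rewrite add0n => ->//; rewrite (last_nth (s, minit M)).
have : (0 < P (~` acc))%E.
  apply: lt_le_trans (bad_at_le lab M allx0 continuousA lawP (size p)).
  apply: (@lt_le_trans _ _ (eta%:E * mu K)%E); first by rewrite mule_gt0.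
  rewrite -lawP.1 // -pastK; apply: le_trans hK _.
  apply: le_measure => //; rewrite ?inE.
    by apply: measurableI; [exact: measurable_past|exact: measurable_follows].
  exact: (measurable_pst lab M x0 (size p) bad).
by rewrite probability_setC ?acc1 ?subee ?ltxx //; exact: measurable_accepting.
Qed.

End InitialDistribution.

(** * Correctness of the approximation *)

Section RegionRepresentatives.
Variables (R : realType) (L X : finType) (l0 : L) (A : sta R X l0).
Variables (x0 : X) (allx0 : forall x : X, x = x0).
Local Notation N := (max_const A).
Local Notation cell_of := (@cell_of R L X l0 A x0).
Local Notation cell_set := (@cell_set R L X l0 A x0).

(** The value [k / 2], the same choice as in [a_query]. *)
Definition representative (s : cell A) : locreg L X :=
  (s.1, [ffun=> (s.2 : nat, 1%N)]).

Definition cell_locreg (r : locreg L X) : cell A :=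
  (r.1, Ordinal (region_index_lt A (nnrat_val R (r.2 x0))%:num)).

Lemma locreg_setE r : locreg_set A r = cell_set (cell_locreg r).
Proof.
apply/seteqP; split=> c.
  move=> [c1 /(region_equivE A allx0) rc].
  by rewrite /cell_set /= /cell_of c1; congr pair; apply: val_inj.
move=> /= cr; have cr1 : c.1 = r.1 by rewrite -[RHS]/((cell_locreg r).1) -cr.
split=> //; apply/(region_equivE A allx0).
by rewrite -[LHS]/(val (cell_locreg r).2) -cr.
Qed.

Lemma region_index_half k : (k < 2 * N.+1)%N -> region_index A (k%:R / 2) = k.
Proof.
move=> kN; have v0 : 0 <= k%:R / 2 :> R by rewrite divr_ge0.
have [iN hle hlt] := region_indexP A v0.
have le c : (c%:R <= k%:R / 2 :> R) = (2 * c <= k)%N.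
  by rewrite ler_pdivlMr // -natrM ler_nat mulnC.
have lt c : (c%:R < k%:R / 2 :> R) = (2 * c < k)%N.
  by rewrite ltr_pdivlMr // -natrM ltr_nat mulnC.
have cN : (k./2 <= N)%N by lia.
have h1 := hle _ cN; have h2 := hlt _ cN; rewrite le in h1; rewrite lt in h2.
have h3 : (k./2 < N)%N -> (2 * (k./2).+1 <= region_index A (k%:R / 2))%N = (2 * (k./2).+1 <= k)%N.
  by move=> cN'; rewrite hle // le.
have [ok|ek] := boolP (odd k).
  have {}h2 : (2 * k./2 < region_index A (k%:R / 2))%N by rewrite h2; lia.
  have [cN'|cN'] := ltnP k./2 N; last by lia.
  by move: (h3 cN') => {}h3; lia.
by lia.
Qed.

Lemma cell_representative s : cell_locreg (representative s) = s.
Proof.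
case: s => l k; congr pair; apply: val_inj => /=.
by rewrite ffunE /= region_index_half.
Qed.

Lemma locreg_representative s : locreg_set A (representative s) = cell_set s.
Proof. by rewrite locreg_setE cell_representative. Qed.

Lemma cell_set_inj s s' c : cell_set s c -> cell_set s = cell_set s' -> s = s'.
Proof. by move=> cs ss'; move: (cs); rewrite ss' => <-; exact: esym. Qed.

Lemma enum_unique : enum X = [:: x0].
Proof.
have := mem_enum X x0; have := enum_uniq X.
case: (enum X) => [|y [|z s]] //=; first by rewrite (allx0 y).
by rewrite (allx0 y) (allx0 z) inE eqxx.
Qed.

Lemma code_locregE (r : locreg L X) :
  code_locreg r = Node (code_fin r.1) (code_list [:: code_nnrat (r.2 x0)]).
Proof. by rewrite /code_locreg enum_unique. Qed.

End RegionRepresentatives.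

Section AmenableApproximation.
Variables (R : realType) (L X AP Q : finType) (l0 : L) (A : sta R X l0).
Variables (lab : L -> {set AP}) (M : muller AP Q).
Variables (x0 : X) (allx0 : forall x : X, x = x0).
Variables (mu : probability (config R X l0) R) (P : probability (trajectory R X l0) R).
Hypothesis lawP : trajectory_law A mu P.
Local Notation cell_of := (@cell_of R L X l0 A x0).
Local Notation pstate := (pstate Q A).
Local Notation path_event := (@path_event R L X Q l0 A x0).

Definition nnreal (q : nnrat) : R := q.1%:R / q.2.+1%:R.

Lemma nnrealE q : (nnrat_val R q)%:num = nnreal q. Proof. by []. Qed.

Lemma nnreal_qadd p q : nnreal (qadd p q) = nnreal p + nnreal q.
Proof.
have den : (qadd p q).2.+1 = (p.2.+1 * q.2.+1)%N by rewrite prednK ?muln_gt0.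
rewrite /nnreal den natrM [(qadd p q).1]/(_ + _)%N natrD !natrM.
by rewrite addf_div ?pnatr_eq0 // [X in _ + X]mulrC [X in _ + X]mulrC.
Qed.

Lemma nnreal_sum (g : pred tree) (items : seq tree) :
  nnreal (a_sum g items) =
  \sum_(i <- items | g (tleft (tleft i))) nnreal (decode_nnrat (tright i)).
Proof.
rewrite /a_sum; elim: items => [|i s IH].
  by rewrite big_nil /nnreal mul0r.
by rewrite big_cons /=; case: ifP => _ //; rewrite nnreal_qadd IH.
Qed.

Lemma followsP (p : seq (cell A)) n (w : trajectory R X l0) s0 :
  follows x0 p n w <-> forall i, (i < size p)%N -> cell_of (w (n + i)%N) = nth s0 p i.
Proof.
elim: p n => [|s p IH] n /=; first by split.
split=> [[h1 /IH h2] [|i]|h].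
- by rewrite addn0.
- by rewrite ltnS => /h2; rewrite addnS.
split; first by have := h 0%N isT; rewrite addn0.
by apply/IH => i ip; have := h i.+1 ip; rewrite addnS.
Qed.

Lemma code_state_inj : injective (@code_state R L X Q l0 A).
Proof.
move=> [[l k] q] [[l' k'] q'] [].
move=> /(can_inj code_natK)/val_inj/enum_rank_inj <-.
move=> /(can_inj code_natK)/val_inj <-.
by move=> /(can_inj code_natK)/val_inj/enum_rank_inj <-.
Qed.

Lemma code_path_inj : injective (@code_path R L X Q l0 A).
Proof.
move=> p p' /(can_inj code_listK); exact: (inj_map code_state_inj).
Qed.

(** With [n - 1] queries of this precision, the total error is at most [eps / 4]. *)
Definition precision (eps : nnrat) (n : nat) : nnrat := (eps.1, (eps.2.+1 * (4 * n)).-1)%N.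

Lemma nnreal_precision eps n : n.+1%:R * nnreal (precision eps n.+1) = nnreal eps / 4.
Proof.
have den : (precision eps n.+1).2.+1 = (eps.2.+1 * (4 * n.+1))%N.
  by rewrite prednK ?muln_gt0.
rewrite /nnreal den [(precision _ _).1]/(eps.1) !natrM.
by field; rewrite !nat1r !pnatr_eq0.
Qed.

Lemma a_queryE inp eps n (p : seq pstate) k t0 :
  item 2 inp = code_nnrat eps -> size p = k.+1 ->
  a_query inp n (code_path p) =
  Node (code_list [seq code_locreg (representative (nth t0 (rev p) i).1)
                  | i : 'I_k.+1 <- enum 'I_k.+1])
       (code_nnrat (precision eps n)).
Proof.
move=> inp2 pk; rewrite /a_query inp2 /= !code_natK; congr (Node (code_list _) _).
rewrite /code_path code_listK -map_comp -map_rev.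
transitivity [seq code_locreg (representative t.1) | t <- rev p].
  by apply: eq_map => t /=; rewrite (code_locregE allx0) /= ffunE.
rewrite -{1}(mkseq_nth t0 (rev p)) /mkseq -map_comp size_rev pk -val_enum_ord -map_comp.
exact: eq_map.
Qed.

Variables (amenable : prog) (eps : nnrat) (inp : tree).
Hypotheses (amenableP : approximates_region_trajectories A mu amenable)
  (eps0 : (0 < eps.1)%N) (inp2 : item 2 inp = code_nnrat eps)
  (inp0 : item 0 inp = code_sta A lab) (inp1 : item 1 inp = code_muller M).
Local Notation paths := (paths A lab M).

Lemma path_eventE (p : seq pstate) k t0 : size p = k.+1 ->
  [set w : trajectory R X l0 | forall i : 'I_k.+1,
     locreg_set A (representative (nth t0 (rev p) i).1) (w i)] = path_event p.
Proof.
move=> pk; apply/seteqP; split=> w.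
  move=> h; apply/(followsP _ _ _ t0.1) => i; rewrite size_rev size_map pk => ik.
  have := h (Ordinal ik); rewrite (locreg_representative allx0) /= => hi.
  by rewrite -map_rev (nth_map t0) ?size_rev ?pk // add0n.
move=> /(followsP _ _ _ t0.1) h i; rewrite (locreg_representative allx0).
have := h i; rewrite size_rev size_map pk ltn_ord => /(_ isT).
by rewrite -map_rev (nth_map t0) ?size_rev ?pk // add0n.
Qed.

(** Amenability only asserts that suitable answers exist. [g] chooses them for paths and [f]
    transports them to trees, which is consistent because [code_path] is injective. *)
Lemma oracle_answers : exists f : nat -> tree -> tree, exists g : nat -> seq pstate -> nnrat,
  (forall k t, t \in a_paths inp k ->
    run no_oracle amenable (a_query inp (size (a_paths inp k)).+1 t) (f k t)) /\
  (forall k p, p \in paths k -> f k (code_path p) = code_nnrat (g k p) /\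
    `| nnreal (g k p) - fine (P (path_event p)) | <=
      nnreal (precision eps (size (paths k)).+1)).
Proof.
have ex (kp : nat * seq pstate) : exists q : nnrat, kp.2 \in paths kp.1 ->
    run no_oracle amenable (a_query inp (size (a_paths inp kp.1)).+1 (code_path kp.2))
      (code_nnrat q) /\
    `| nnreal q - fine (P (path_event kp.2)) | <=
      nnreal (precision eps (size (paths kp.1)).+1).
  case: kp => k p /=; have [pk|_] := boolP (p \in paths k); last by exists (0, 0)%N.
  have szp := paths_size pk; case: p pk szp => // t0 p pk szp.
  have [|q [rq hq]] := amenableP lawP
    (fun i : 'I_k.+1 => representative (nth t0 (rev (t0 :: p)) i).1)
    (eps := precision eps (size (paths k)).+1); first exact: eps0.
  have {}hq : `| nnreal q - fine (P (path_event (t0 :: p))) | <=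
      nnreal (precision eps (size (paths k)).+1) by rewrite -(path_eventE t0 szp); exact: hq.
  exists q => _; split=> //.
  by rewrite (a_queryE _ t0 inp2 szp) (a_pathsE inp0 inp1) size_map.
have [g gP] := choice ex.
have ex2 (kt : nat * tree) : exists y, forall p, p \in paths kt.1 ->
    kt.2 = code_path p -> y = code_nnrat (g (kt.1, p)).
  have [[p tp]|np] := pselect (exists p : seq pstate, kt.2 = code_path p).
    by exists (code_nnrat (g (kt.1, p))) => p' _; rewrite tp => /code_path_inj ->.
  by exists Leaf => p _ tp; case: np; exists p.
have [f fP] := choice ex2.
exists (fun k t => f (k, t)), (fun k p => g (k, p)); split=> [k t|k p pk].
  rewrite (a_pathsE inp0 inp1) => /mapP[p pk ->].
  rewrite (fP (k, code_path p) p pk erefl) -(a_pathsE inp0 inp1).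
  exact: (gP (k, p) pk).1.
by split; [exact: (fP (k, code_path p) p)|exact: (gP (k, p) pk).2].
Qed.

Lemma a_initialE r :
  a_initial inp (code_locreg r) = code_state (cell_locreg A x0 r, minit M).
Proof.
rewrite (code_locregE allx0) /a_initial /= (a_indexE inp0) -(index_nnratE (R := R)).
by rewrite inp1 /code_muller item_code_list.
Qed.

(** The probability is a sum over disjoint path events. The sum of all the path errors is at most
    [eps / 4], so the bound holds for whichever subset of paths [h] selects. *)
Lemma answers_sum f g k (h : pred pstate) (h' : pred tree) :
  (forall t, h' (code_state t) = h t) ->
  (forall p, p \in paths k -> f k (code_path p) = code_nnrat (g k p) /\
    `| nnreal (g k p) - fine (P (path_event p)) | <=
      nnreal (precision eps (size (paths k)).+1)) ->
  `| nnreal (a_sum h' (answers inp f k)) -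
     fine (P [set w | h (pst A lab M x0 k w)]) | <= nnreal eps / 4.
Proof.
move=> hh fg; rewrite nnreal_sum (measure_pst_paths lab M allx0 lawP).
have -> : fine (\sum_(p <- paths k | on_head h p) P (path_event p))%E =
    \sum_(p <- paths k | on_head h p) fine (P (path_event p)).
  rewrite (eq_bigr (fun p => (fine (P (path_event p)))%:E)) ?sumEFin // => p _.
  by rewrite fineK // fin_num_measure //; exact: measurable_path_event.
have -> : \sum_(i <- answers inp f k | h' (tleft (tleft i))) nnreal (decode_nnrat (tright i))
    = \sum_(p <- paths k | on_head h p) nnreal (g k p).
  rewrite /answers (perm_big _ (permEl (perm_rev _))) /= (a_pathsE inp0 inp1) !big_map.
  rewrite big_seq_cond [RHS]big_seq_cond; apply: eq_big => p.
    case: p => [|t p]; last by rewrite /= hh.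
    by case: (boolP ([::] \in _)) => // /paths_size.
  by move=> /andP[/fg[-> _] _]; rewrite /= code_nnratK.
rewrite -sumrB; apply: le_trans (ler_norm_sum _ _ _) _.
rewrite -(nnreal_precision eps (size (paths k))).
apply: (@le_trans _ _ (\sum_(p <- paths k) nnreal (precision eps (size (paths k)).+1))).
  rewrite big_mkcond /= big_seq [leRHS]big_seq; apply: ler_sum => p /fg[_ hp].
  by case: ifP => // _; apply: le_trans hp.
rewrite big_const_seq count_predT iter_addr_0 -[leLHS]mulr_natl.
by rewrite ler_wpM2r // ?divr_ge0 // ler_nat.
Qed.

End AmenableApproximation.

(** The stopping test gives [1 - d <= 3 e / 4], hence [g <= a <= 1 - b <= g + 3 e / 4]; the last
    quarter of [e] pays for the error of [g']. *)
Lemma approximation_error (R : realType) (e g' d' g d b a : R) : 0 < e ->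
  `|g' - g| <= e / 4 -> `|d' - d| <= e / 4 -> 1 <= e / 2 + d' ->
  g <= a -> b <= 1 - a -> d <= g + b -> `|g' - a| <= e.
Proof. by rewrite !ler_norml => e0 /andP[h1 h2] /andP[h3 h4] h5 h6 h7 h8; lra. Qed.

Lemma approximation_stops (R : realType) (e d' d : R) :
  `|d' - d| <= e / 4 -> 1 - e / 4 <= d -> 1 <= e / 2 + d'.
Proof. by rewrite ler_norml => /andP[h1 h2] h3; lra. Qed.

Theorem corollary72 (R : realType) :
  (exists decide : prog,
     forall (L X AP Q : finType) (l0 : L) (A : sta R X l0) (lab : L -> {set AP})
       (M : muller AP Q),
     #|X| = 1%N ->
     delay_continuous A -> delay_monotone A -> delay_unbounded A ->
     forall (mu : probability (config R X l0) R) (s : seq (locreg L X)),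
     region_support A mu s ->
     forall P : probability (trajectory R X l0) R, trajectory_law A mu P ->
     exists b : bool,
       run no_oracle decide
         (code_list [:: code_sta A lab; code_muller M;
                        code_list [seq code_locreg r | r <- s]])
         (code_bool b) /\
       (b <-> P (maccepting M lab) = 1%E))
  /\
  (exists approx : prog,
     forall (L X AP Q : finType) (l0 : L) (A : sta R X l0) (lab : L -> {set AP})
       (M : muller AP Q),
     #|X| = 1%N ->
     delay_continuous A -> delay_monotone A -> delay_unbounded A ->
     forall (mu : probability (config R X l0) R)
       (hmu : numerically_amenable A mu) (eps : nnrat), (0 < eps.1)%N ->
     forall P : probability (trajectory R X l0) R, trajectory_law A mu P ->
     exists q : nnrat,
       run (run no_oracle (sval hmu)) approx
         (code_list [:: code_sta A lab; code_muller M; code_nnrat eps])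
         (code_nnrat q) /\
       `| (nnrat_val R q)%:num - fine (P (maccepting M lab)) |
         <= (nnrat_val R eps)%:num).
Proof.
split.
  have [decide run_decide] := comp_decide.
  exists decide => L X AP Q l0 A lab M X1 continuousA _ _ mu s supp P lawP.
  have [x0 allx0] : exists x0 : X, forall x, x = x0 by apply/fintype1P/eqP.
  set inp := code_list _; exists (a_decide inp); split; first exact: run_decide.
  have inp0 : item 0 inp = code_sta A lab by rewrite item_code_list.
  have inp1 : item 1 inp = code_muller M by rewrite item_code_list.
  have -> : a_decide inp = all (fun r => good lab M (cell_locreg A x0 r, minit M)) s.
    rewrite /a_decide [item 2 inp]item_code_list code_listK all_map.
    by apply: eq_all => r /=; rewrite (a_initialE allx0 inp0 inp1) (a_goodE inp0 inp1).
  split=> [/allP sgood|acc1].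
    apply: (accepting_surely allx0 continuousA lawP) => c c0.
    have [|r rs rc] := (supp (representative c)).1; first by rewrite (locreg_representative allx0).
    (* [supp] yields equality of region sets; a configuration in them turns it into equality of
       cells. *)
    have [w cw] : exists w, cell_set x0 c w.
      by apply/set0P; apply: contraTneq c0 => ->; rewrite measure0 ltxx.
    rewrite (locreg_representative allx0) (locreg_setE A allx0) in rc.
    by rewrite (cell_set_inj cw (esym rc)); exact: sgood.
  apply/allP => r rs; apply/negPn/negP => nr.
  apply: (accepting_not_surely allx0 continuousA lawP) nr acc1.
  by rewrite -(locreg_setE A allx0); apply/supp; exists r.
have [approx run_approx] := run_approximation.
exists approx => L X AP Q l0 A lab M X1 continuousA _ _ mu [amenable amenableP] eps eps0 P lawP.
have [x0 allx0] : exists x0 : X, forall x, x = x0 by apply/fintype1P/eqP.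
set inp := code_list _.
have inp0 : item 0 inp = code_sta A lab by rewrite item_code_list.
have inp1 : item 1 inp = code_muller M by rewrite item_code_list.
have inp2 : item 2 inp = code_nnrat eps by rewrite item_code_list.
have [f [g [fo fg]]] := oracle_answers allx0 lawP amenableP eps0 inp2 inp0 inp1.
have e0 : 0 < nnreal R eps by rewrite /nnreal divr_gt0 ?ltr0n.
have goodE := a_goodE inp0 inp1; have badE := a_badE inp0 inp1.
pose decided (t : pstate Q A) := good lab M t || bad lab M t.
have sumG k := answers_sum allx0 lawP inp0 inp1 goodE (fg k).
have sumD k : `| nnreal R (a_sum (fun t => a_good inp t || a_bad inp t) (answers inp f k)) -
    fine (P [set w | decided (pst A lab M x0 k w)]) | <= nnreal R eps / 4.
  by apply: (answers_sum allx0 lawP inp0 inp1) (fg k) => t; rewrite goodE badE.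
have stopE k : a_stop inp (answers inp f k) =
    (1 <= nnreal R eps / 2 +
      nnreal R (a_sum (fun t => a_good inp t || a_bad inp t) (answers inp f k))).
  rewrite /a_stop inp2 [tleft _]/= [tright _]/= !code_natK.
  move: (a_sum _ _) => q; rewrite /nnreal.
  have d1 : (0 : R) < eps.2.+1%:R by rewrite ltr0n.
  have d2 : (0 : R) < q.2.+1%:R by rewrite ltr0n.
  have -> : eps.1%:R / eps.2.+1%:R / 2 + q.1%:R / q.2.+1%:R =
      (eps.1 * q.2.+1 + 2 * (q.1 * eps.2.+1))%N%:R / (2 * (eps.2.+1 * q.2.+1))%N%:R :> R.
    rewrite !(natrD, natrM); field.
    by rewrite !nat1r !pnatr_eq0.
  by rewrite ler_pdivlMr ?ltr0n ?muln_gt0 // mul1r ler_nat.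
have mP n (p : pred (pstate Q A)) := measurable_pst lab M x0 n p.
have [n hn] := decided_limit lab M allx0 continuousA lawP (divr_gt0 e0 (ltr0n R 4)).
have fineP B : measurable B -> P B = (fine (P B))%:E.
  by move=> mB; rewrite fineK // fin_num_measure.
(* The tail bound holds at all levels from [n] on; [n + 1] is used because the search starts at
   level [1]. *)
have stopN : a_stop inp (answers inp f n.+1).
  have := hn n.+1 (leqnSn n); rewrite (fineP _ (mP _ decided)) lee_fin => hd.
  rewrite stopE; exact: (approximation_stops (sumD n.+1) hd).
have [k stopk runk] := run_approx _ _ f n fo stopN.
exists (a_sum (a_good inp) (answers inp f k)); split; first exact: runk.
move: stopk; rewrite stopE !nnrealE.
move=> stopk.
have macc := measurable_accepting A lab M x0.
have mG := mP k (good lab M); have mB := mP k (bad lab M); have mD := mP k decided.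
have hG : fine (P [set w | good lab M (pst A lab M x0 k w)]) <= fine (P (maccepting M lab)).
  rewrite -lee_fin -!fineP //; exact: (good_at_le lab M allx0 continuousA lawP).
have hB : fine (P [set w | bad lab M (pst A lab M x0 k w)]) <= 1 - fine (P (maccepting M lab)).
  rewrite -lee_fin EFinB -!fineP // -probability_setC //.
  exact: (bad_at_le lab M allx0 continuousA lawP).
have hD : fine (P [set w | decided (pst A lab M x0 k w)]) <=
    fine (P [set w | good lab M (pst A lab M x0 k w)]) +
    fine (P [set w | bad lab M (pst A lab M x0 k w)]).
  rewrite -lee_fin EFinD -!fineP //; apply: le_trans (measureU2 _ mG mB).
  apply: le_measure; rewrite ?inE //; first exact: measurableU.
  by move=> w /orP[]; [left|right].
exact: (approximation_error e0 (sumG k) (sumD k) stopk hG hB hD).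
Qed.
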